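(* Let $d\in\{1,2,3\}$ and $0<R\le\infty$. Let $h\in\mathcal{X}_R$ be a solution (on $[0,R^4]$ if $R<\infty$, on $(0,\infty)$ if $R=\infty$) of $\partial_t h+\Delta^2 h+\Delta|\nabla h|^2=0$ on $\mathbf{R}^d$, with some initial condition $h_0\in\mathcal{B}_R$. Then $h(t)\in C_b^\infty(\mathbf{R}^d)$ for all $t\in(0,R^4)$.
   Context: $C_b^\infty(\mathbf{R}^d)$ denotes the space of $C^\infty$ functions on $\mathbf{R}^d$ that are bounded together with all their partial derivatives. Let $A=\Delta^2$ and let $G(t,x)$, $t>0$, $x\in\mathbf{R}^d$, be the kernel with spatial Fourier transform $\widehat G(t,\xi)=e^{-t|\xi|^4}$. For a function $k:\mathbf{R}^d\to\mathbf{R}$ for which the convolution is defined, $e^{-tA}k=G(t,\cdot)\star k$. For $0<R<\infty$, $\mathcal{X}_R$ is the space of functions on $[0,R^4]\times\mathbf{R}^d$ (identified when they differ by an additive constant) with $\|h\|_{\mathcal{X}_R}=\sup_{0<t\le R^4}t^{1/4}\|\nabla h(t)\|_\infty<\infty$; for $R=\infty$, $\mathcal{X}_\infty=\mathcal{X}$ is the space of functions on $(0,\infty)\times\mathbf{R}^d$ with $\|h\|_{\mathcal X}=\sup_{t>0}t^{1/4}\|\nabla h(t)\|_\infty<\infty$, and $R^4=\infty$. $\mathcal{B}_R$ is the space of $k:\mathbf{R}^d\to\mathbf{R}$ with $\|k\|_{\mathcal{B}_R}=\|e^{-tA}k\|_{\mathcal{X}_R}<\infty$. A solution in $\mathcal{X}_R$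 with initial condition $h_0$ is $h\in\mathcal{X}_R$ satisfying $h(t)=e^{-tA}h_0-\mathcal{V}(h,h)(t)$ for all $t\in[0,R^4]$ (all $t>0$ if $R=\infty$), where $\mathcal{V}(h,k)(t)=\int_0^t\Delta\, e^{-(t-s)A}\bigl(\nabla h(s)\cdot\nabla k(s)\bigr)\,ds$.
   Formalization: Boundedness of h(t) itself is claimed only when e^{-tA}h_0 is bounded (h=h_0=x_1 is an unbounded solution for finite R); smoothness and boundedness of all partial derivatives of order at least 1 are unconditional. *)

(* Defs.v *)
From HB Require Import structures.
From mathcomp Require Import all_boot all_order all_algebra.
From mathcomp Require Import all_classical all_reals all_analysis.

Set Implicit Arguments.
Unset Strict Implicit.
Unset Printing Implicit Defensive.
Import Order.TTheory GRing.Theory Num.Theory.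
Import numFieldNormedType.Exports.
Local Open Scope classical_set_scope.
Local Open Scope ring_scope.

Definition rV_display : measure_display.
Proof. exact: default_measure_display. Qed.

Section rV_measurable.
Context {R : realType} (n : nat).

Let coors : 'I_n -> 'rV[R]_n -> measurableTypeR R := fun i x => x 0 i.

Let rV_set0 : g_sigma_preimage coors set0.
Proof. exact: sigma_algebra0. Qed.

Let rV_setC A : g_sigma_preimage coors A -> g_sigma_preimage coors (~` A).
Proof. exact: sigma_algebraC. Qed.

Let rV_bigcup (F : _^nat) : (forall i, g_sigma_preimage coors (F i)) ->
  g_sigma_preimage coors (\bigcup_i (F i)).
Proof. exact: sigma_algebra_bigcup. Qed.

(* The sigma-algebra generated by the coordinates, i.e. the Borel sets. *)
HB.instance Definition _ := @isMeasurable.Build rV_display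
  'rV[R]_n (g_sigma_preimage coors) rV_set0 rV_setC rV_bigcup.

Lemma measurable_coord (i : 'I_n) :
  measurable_fun [set: 'rV[R]_n] (fun x : 'rV[R]_n => x 0 i : measurableTypeR R).
Proof.
move=> _ Y mY; rewrite setTI; apply: sub_sigma_algebra => /=.
rewrite -bigcup_seq/=; exists i => /=; first by rewrite mem_index_enum.
by exists Y => //; rewrite setTI.
Qed.

Lemma measurable_fun_rV d (T : measurableType d) (f : T -> 'rV[R]_n) :
  (forall i, measurable_fun [set: T] (fun x => f x 0 i : measurableTypeR R)) ->
  measurable_fun [set: T] f.
Proof.
move=> mf; apply: (@measurability _ _ _ _ _ _
  (\big[setU/set0]_(i < n) preimage_set_system setT (coors i) measurable)) => //.
move=> _ [B + <-]; rewrite -bigcup_seq => -[i _ [A mA <-]].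
by rewrite !setTI -comp_preimage -[X in measurable X]setTI; exact: mf.
Qed.

End rV_measurable.

Section lebesgue_rV.
Context {R : realType}.

Definition cons_rV n (p : measurableTypeR R * 'rV[R]_n) : 'rV[R]_n.+1 :=
  row_mx (p.1%:M : 'rV[R]_1) p.2.

Lemma cons_rVK n (p : measurableTypeR R * 'rV[R]_n) :
  (cons_rV p 0 0 : measurableTypeR R,
   rsubmx (cons_rV p : 'rV[R]_(1 + n))) = p.
Proof.
case: p => x v; rewrite /cons_rV /= row_mxKr; congr pair.
have -> : (0 : 'I_n.+1) = lshift n (0 : 'I_1) by exact/val_inj.
by rewrite (@row_mxEl R 1 1 n) mxE eqxx mulr1n.
Qed.

Lemma measurable_cons_rV n : measurable_fun setT (@cons_rV n).
Proof.
apply: measurable_fun_rV => i; rewrite -[n.+1]/(1 + n)%N in i *.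
case: (split_ordP i) => j ->.
  rewrite (_ : (fun x => _) = fst); first exact: measurable_fst.
  by apply/funext => -[x v]; rewrite /cons_rV row_mxEl mxE ord1 eqxx mulr1n.
rewrite (_ : (fun x => _) =
  (fun v : 'rV[R]_n => v 0 j : measurableTypeR R) \o snd).
  exact: (measurableT_comp (measurable_coord j) measurable_snd).
by apply/funext => -[x v]; rewrite /cons_rV row_mxEr.
Qed.

Section step.
Variables (n : nat) (mu : {sigma_finite_measure set 'rV[R]_n -> \bar R}).

Definition lebesgue_rV_step : set 'rV[R]_n.+1 -> \bar R :=
  pushforward (@lebesgue_measure R \x mu)%E (@cons_rV n).

Let m : {measure set 'rV[R]_n.+1 -> \bar R} :=
  measure_function_pushforward__canonical__measure_function_Measure
    (@lebesgue_measure R \x mu)%E (@measurable_cons_rV n).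

HB.instance Definition _ := isMeasure.Build _ _ _ lebesgue_rV_step
  (measure0 m) (measure_ge0 m) (@measure_semi_sigma_additive _ _ _ m).

Lemma lebesgue_rV_step_sigma_finite : sigma_finite setT lebesgue_rV_step.
Proof.
have /sigma_finiteP[F [TF ndF Foo]] := sigma_finiteT (@lebesgue_measure R).
have /sigma_finiteP[H [TH ndH Hoo]] := sigma_finiteT mu.
pose u (v : 'rV[R]_n.+1) :=
  (v 0 0 : measurableTypeR R, rsubmx (v : 'rV[R]_(1 + n))).
have mu_ : measurable_fun setT u.
  apply: measurable_fun_pair; first exact: measurable_coord.
  apply: measurable_fun_rV => i.
  rewrite (_ : (fun x => _) =
    (fun v : 'rV[R]_n.+1 => v 0 (rshift 1 i) : measurableTypeR R)).
    exact: measurable_coord.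
  by apply/funext => v; rewrite mxE.
exists (fun k => u @^-1` (F k `*` H k)).
  apply/esym/seteqP; split => // v _.
  have [i _ Fi] : (\bigcup_k F k) (v 0 0) by rewrite -TF.
  have [j _ Hj] : (\bigcup_k H k) (u v).2 by rewrite -TH.
  exists (maxn i j) => //; split.
    by apply: subsetPset (ndF i _ _) _ Fi; exact: leq_maxl.
  by apply: subsetPset (ndH j _ _) _ Hj; exact: leq_maxr.
move=> k; have [mF Fk] := Foo k; have [mH Hk] := Hoo k; split.
  by rewrite -[X in measurable X]setTI; apply: mu_ => //; exact: measurableX.
rewrite /lebesgue_rV_step /pushforward -comp_preimage.
rewrite (_ : u \o _ = id) ?preimage_id; last first.
  by apply/funext => p; exact: cons_rVK.
by rewrite product_measure1E// lte_mul_pinfty// ge0_fin_numE.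
Qed.

HB.instance Definition _ := Measure_isSigmaFinite.Build _ _ _
  lebesgue_rV_step lebesgue_rV_step_sigma_finite.

End step.

(* Lebesgue measure on R^n, as an iterated product of the one on R. *)
Fixpoint lebesgue_rV n : {sigma_finite_measure set 'rV[R]_n -> \bar R} :=
  match n return {sigma_finite_measure set 'rV[R]_n -> \bar R} with
  | 0%N => \d_(0 : 'rV[R]_0)
  | m.+1 => lebesgue_rV_step (lebesgue_rV m)
  end.

End lebesgue_rV.

Section equation.
Context {R : realType} {d : nat}.
Implicit Types (f k : 'rV[R]_d -> R) (h : R -> 'rV[R]_d -> R).
Local Notation mu := (@lebesgue_rV R d).

Definition dot (x y : 'rV[R]_d) : R := \sum_i x 0 i * y 0 i.

(* The norm of the normed module 'rV[R]_d is the sup norm. *)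
Definition enorm (x : 'rV[R]_d) : R := Num.sqrt (dot x x).

Definition partial (i : 'I_d) f : 'rV[R]_d -> R :=
  fun x => 'D_(delta_mx 0 i) f x.

Definition gradient f (x : 'rV[R]_d) : 'rV[R]_d := \row_i partial i f x.

Definition laplacian f (x : 'rV[R]_d) : R := \sum_i partial i (partial i f) x.

Definition iter_partial (s : seq 'I_d) f := foldr partial f s.

Definition smooth f :=
  forall (s : seq 'I_d) x, differentiable (iter_partial s f : _ -> R^o) x.

(* iter_partial [::] f is f itself. *)
Definition Cb_infty f :=
  smooth f /\ forall s : seq 'I_d, bounded_fun (iter_partial s f : _ -> R^o).

(* Inverse Fourier transform of xi |-> exp (- t |xi|^4), for the convention
   (F u)(xi) = \int u(x) exp (- i x.xi) dx under which Delta^2 has symbol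
   |xi|^4; the imaginary part of the integral vanishes by parity. *)
Definition kernel_G (t : R) (x : 'rV[R]_d) : R :=
  ((2 * pi) ^+ d)^-1 *
  Rintegral mu setT (fun xi => expR (- t * enorm xi ^+ 4) * cos (dot x xi)).

Definition conv f k (x : 'rV[R]_d) : R :=
  Rintegral mu setT (fun y => f (x - y) * k y).

(* e^{-tA}, including e^{-0A} = id *)
Definition semigroup (t : R) k : 'rV[R]_d -> R :=
  if t == 0 then k else conv (kernel_G t) k.

(* kernel_G t x oscillates with amplitude exp (- c |x|^(4/3) t^(-1/3)), up to
   powers of |x|: these are the k for which the integrals defining
   conv (kernel_G t) k converge absolutely for all t > 0. *)
Definition conv_defined k := forall eps : R, 0 < eps ->
  mu.-integrable setT
    (fun y => (expR (- eps * enorm y `^ (4 / 3)) * k y)%:E).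

Section spaces.
Variable Rad : \bar R.

Definition horizon : \bar R := (Rad ^+ 4)%E.

(* ]0, Rad^4], which is ]0, +oo[ for Rad = +oo *)
Definition pos_times : set R := [set t | 0 < t /\ (t%:E <= horizon)%E].

(* [0, Rad^4] for finite Rad, and ]0, +oo[ for Rad = +oo *)
Definition times : set R :=
  [set t | [/\ 0 <= t, (t%:E <= horizon)%E & Rad = +oo%E -> 0 < t]].

Definition normX h : \bar R :=
  ereal_sup [set ((t `^ (1 / 4))%:E *
                  Lnorm mu +oo (fun x => (enorm (gradient (h t) x))%:E))%E
            | t in pos_times].

(* A function whose (distributional) gradient is bounded is Lipschitz, and its
   gradient is then the almost everywhere defined classical one. Only the
   gradient is constrained, so that this does not distinguish functions which
   differ by a constant. *)
Definition inX h :=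
  [/\ forall t, pos_times t -> lipschitz (h t : _ -> R^o),
      forall i : 'I_d,
        measurable_fun ((pos_times : set (measurableTypeR R)) `*` setT)
          (fun p : measurableTypeR R * 'rV[R]_d => partial i (h p.1) p.2)
    & (normX h < +oo)%E].

Definition inB k := conv_defined k /\ inX (fun t => semigroup t k).

Definition duhamel (h k : R -> 'rV[R]_d -> R) (t : R) (x : 'rV[R]_d) : R :=
  Rintegral (@lebesgue_measure R) `]0, t[ (fun s =>
    laplacian
      (semigroup (t - s) (fun y => dot (gradient (h s) y) (gradient (k s) y)))
      x).

(* Elements of X are only defined modulo additive constants; as normX does not
   see functions of t alone, the constant may depend on t. *)
Definition solution h (h0 : 'rV[R]_d -> R) :=
  inX h /\
  forall t, times t -> exists c : R, forall x,
    h t x = semigroup t h0 x - duhamel h h t x + c.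

End spaces.
End equation.

(* Main.v *)
Require Import Defs.
From HB Require Import structures.
From mathcomp Require Import all_boot all_order all_algebra.
From mathcomp Require Import all_classical all_reals all_analysis.
From mathcomp Require Import measurable_realfun ess_sup_inf.
From mathcomp Require Import ring lra zify.
Import Order.TTheory GRing.Theory Num.Theory.
Import numFieldNormedType.Exports.
Local Open Scope classical_set_scope.
Local Open Scope ring_scope.
Set Implicit Arguments.
Unset Strict Implicit.
Unset Printing Implicit Defensive.

(* Differentiating the kernel G(t) costs t^(-1/4) per derivative, and every
   derivative of G(t) has integral zero, so that its convolution with an
   al-Hoelder function is better by t^(al/4). The source F = |grad h|^2 of the
   Duhamel term is O(s^(-1/2)); in D(t) = \int_0^t Delta G(t-s) * F(s) ds the times
   s < t/2 only see a smooth kernel, while near s = t, if F(s) has m derivatives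
   which are al-Hoelder, interpolation between two consecutive derivatives gives
   an integrable singularity (t-s)^(-e), e < 1, for th-Hoelder differences of
   derivatives of D. Hence al = 0 with m derivatives of F yields th = 1/2 for m
   derivatives of grad h, hence of F, and then al = 1/2 yields th = 1/4 for
   m+1 derivatives. The linear evolution is smooth by the semigroup property:
   u(t) is G(t-tau) * u(tau), up to a nonzero constant, and u(tau) is Lipschitz.
   The decay exp(-c |x|^(4/3)) of G comes from shifting the Fourier contour, and
   the identity G(t) * G(tau) = c G(t+tau) from an ordinary differential equation
   for the Fourier transform of G along rays, which avoids Fourier inversion. *)

(** Three derivatives are spent before any is gained: the Laplacian of the Duhamel term takes two,
    the gradient in the source one. Putting J derivatives on the kernel against an al-Hoelder source
    and asking for a th-Hoelder result costs (t-s)^(-(J+th-al)/4), so integrability means J + th -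
    al < 4. With al = 0 and th > 0 this allows at most J = 3, which only restores the order m; the
    Hoelder exponent gained in that round is what admits J = 4. The datum h0 is integrable only
    against the weights exp(-eps |y|^(4/3)), so every estimate of the kernel must carry a weight of
    that shape, whose rate may shrink from step to step. Differentiability always comes from a
    first-order remainder bound passed through an integral. For the time integral this is essential:
    at top order the second derivatives of the integrand may be too singular at s = t, while Hoelder
    continuity of the first ones still leaves an integrable majorant. *)

(** * Affine maps and Lebesgue measure on the line *)

Lemma measurable_affine1 (R : realType) (a b : R) :
  measurable_fun [set: measurableTypeR R] (fun x : measurableTypeR R => a * x + b : measurableTypeR R).
Proof. by apply: measurable_funD => //; apply: measurable_funM. Qed.

Lemma affine_preimage_itv (R : realType) (a b u v : R) : a != 0 ->
  (fun x => a * x + b) @^-1` `]u, v]%classic =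
  if 0 < a then `](u - b) / a, (v - b) / a]%classic else `[(v - b) / a, (u - b) / a[%classic.
Proof.
move=> a0; case: ifPn => [ap|/negP an].
  apply/seteqP; split => x /=; rewrite !in_itv/= => /andP[h1 h2]; apply/andP; split.
  - by rewrite ltr_pdivrMr// ltrBlDr mulrC.
  - by rewrite ler_pdivlMr// lerBrDr mulrC.
  - by move: h1; rewrite ltr_pdivrMr// ltrBlDr mulrC.
  - by move: h2; rewrite ler_pdivlMr// lerBrDr mulrC.
have {}an : a < 0 by rewrite lt_neqAle a0/= leNgt; apply/negP.
apply/seteqP; split => x /=; rewrite !in_itv/= => /andP[h1 h2]; apply/andP; split.
- by rewrite ler_ndivrMr// lerBrDr mulrC.
- by rewrite ltr_ndivlMr// ltrBlDr mulrC.
- by move: h2; rewrite ltr_ndivlMr// ltrBlDr mulrC.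
- by move: h1; rewrite ler_ndivrMr// lerBrDr mulrC.
Qed.

(** Uniqueness of Lebesgue measure reduces this to half-open intervals, whose preimages have their
    length divided by |a|; a negative slope merely swaps the open and the closed end. *)
Lemma lebesgue_measure_affine (R : realType) (a b : R) (A : set (measurableTypeR R)) :
  a != 0 -> measurable A ->
  (@lebesgue_measure R A = `|a|%R%:E *
    pushforward (@lebesgue_measure R) (fun x : measurableTypeR R => (a * x + b)%R : measurableTypeR R) A)%E.
Proof.
move=> a0 mA.
pose r := NngNum (normr_ge0 a).
pose m : {measure set (measurableTypeR R) -> \bar R} :=
  measure_function_pushforward__canonical__measure_function_Measure (@lebesgue_measure R) (measurable_affine1 a b).
pose m' : {measure set (measurableTypeR R) -> \bar R} := mscale r m.
change (lebesgue_measure A = m' A).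
apply: lebesgue_measure_unique => // _ [[u v]] _ <-.
rewrite /= /mscale/= /pushforward affine_preimage_itv//.
have e : (v - b) / a - (u - b) / a = (v - u) / a by field.
case: ifPn => [ap|/negP an].
  rewrite [in RHS]lebesgue_measure_itv [in LHS]lebesgue_measure_itv /= !lte_fin.
  rewrite ltr_pM2r ?invr_gt0// ltrD2r; case: ifPn => _; rewrite ?mule0//.
  by rewrite -EFinM -EFinB e (gtr0_norm ap) mulrC divfK.
have {}an : a < 0 by rewrite lt_neqAle a0/= leNgt; apply/negP.
rewrite [in RHS]lebesgue_measure_itv [in LHS]lebesgue_measure_itv /= !lte_fin.
rewrite ltr_nM2r ?invr_lt0// ltrD2r; case: ifPn => _; rewrite ?mule0//.
by rewrite -!EFinB -EFinM (ltr0_norm an); congr (_%:E); field.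
Qed.

(** * Affine changes of variables *)

Section affine_rV.
Context {R : realType}.

Lemma measurable_affine_rV n (a : R) (b : 'rV[R]_n) :
  measurable_fun [set: 'rV[R]_n] (fun x : 'rV[R]_n => a *: x + b).
Proof.
apply: measurable_fun_rV => i.
rewrite (_ : (fun x => _) = (fun x : measurableTypeR R => a * x + b 0 i : measurableTypeR R) \o
   (fun x : 'rV[R]_n => x 0 i : measurableTypeR R)); last by apply/funext => x; rewrite /= !mxE.
exact: (measurableT_comp (measurable_affine1 _ _) (measurable_coord i)).
Qed.

Lemma lebesgue_rVS n (A : set 'rV[R]_n.+1) :
  (lebesgue_rV n.+1 A = \int[@lebesgue_measure R]_x
    lebesgue_rV n (xsection (@cons_rV R n @^-1` A) x))%E.
Proof. by []. Qed.

Lemma measurable_cons_preimage n (A : set 'rV[R]_n.+1) : measurable A ->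
  measurable (@cons_rV R n @^-1` A).
Proof. by move=> mA; rewrite -[X in measurable X]setTI; apply: measurable_cons_rV. Qed.

Lemma rV0_all (A : set 'rV[R]_0) (x : 'rV[R]_0) : A x -> A = setT.
Proof. by move=> Ax; apply/seteqP; split => // y _; rewrite (_ : y = x)//; apply/rowP => -[]. Qed.

(** Induction on the dimension: a slice of the preimage is an affine preimage of a slice ([E]),
    which yields |a|^n, and the integral over the slice parameter contributes one more |a|. *)
Lemma lebesgue_rV_affine n (a : R) (b : 'rV[R]_n) (A : set 'rV[R]_n) :
  a != 0 -> measurable A ->
  (lebesgue_rV n A = (`|a| ^+ n)%R%:E * pushforward (lebesgue_rV n) (fun x : 'rV[R]_n => a *: x + b)%R A)%E.
Proof.
move=> a0; elim: n b A => [|n IH] b A mA.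
  rewrite expr0 mul1e /pushforward /=.
  rewrite /dirac /indic/=; congr (_%:R%:E); congr (nat_of_bool _).
  apply/idP/idP; rewrite !inE /= => /rV0_all.
    by move=> ->.
  by move=> /seteqP[_] /(_ 0 Logic.I) /= /rV0_all ->.
pose A' := (fun x : 'rV[R]_n.+1 => a *: x + b) @^-1` A.
have mA' : measurable A'.
  by rewrite -[X in measurable X]setTI; apply: measurable_affine_rV.
rewrite /pushforward -/A' !lebesgue_rVS.
pose g (x : measurableTypeR R) := lebesgue_rV n (xsection (@cons_rV R n @^-1` A) x).
have mg : measurable_fun [set: measurableTypeR R] g.
  exact: measurable_fun_xsection (measurable_cons_preimage mA).
pose b' : 'rV[R]_n := rsubmx (b : 'rV_(1 + n)).
have E x : xsection (@cons_rV R n @^-1` A') x =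
   (fun v => a *: v + b') @^-1` (xsection (@cons_rV R n @^-1` A) (a * x + b 0 0)).
  have H v : a *: cons_rV (x : measurableTypeR R, v) + b =
      cons_rV (a * x + b 0 0 : measurableTypeR R, a *: v + b').
    rewrite /cons_rV /=; apply/rowP => j; rewrite !mxE.
    rewrite -[n.+1]/(1 + n)%N in j *.
    case: (split_ordP j) => k ->; rewrite /= ?ord1 !mxE ?eqxx ?mulr1n.
      by congr (_ + b _ _); apply/val_inj.
    by congr (_ + b _ _); apply/val_inj.
  by apply/seteqP; split => v; rewrite /xsection /= !inE /A' /= H.
have gE x : (g (a * x + b 0 0)%R = (`|a| ^+ n)%R%:E * lebesgue_rV n (xsection (@cons_rV R n @^-1` A') x))%E.
  rewrite E /g (IH b') //; apply: measurable_xsection; exact: measurable_cons_preimage.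
pose m : {measure set (measurableTypeR R) -> \bar R} :=
  measure_function_pushforward__canonical__measure_function_Measure (@lebesgue_measure R) (measurable_affine1 a (b 0 0)).
pose r := NngNum (normr_ge0 a).
transitivity (\int[(mscale r m : {measure set (measurableTypeR R) -> \bar R})]_x g x)%E.
  by apply: eq_measure_integral => X mX _; first [exact: (lebesgue_measure_affine (b 0 0) a0 mX)|exact: esym (lebesgue_measure_affine (b 0 0) a0 mX)].
rewrite ge0_integral_mscale//.
rewrite ge0_integral_pushforward//=.
rewrite exprS EFinM -muleA; congr (_ * _)%E.
rewrite -ge0_integralZl//.
- by apply: eq_integral => x _; rewrite gE.
- by apply: measurable_fun_xsection; exact: measurable_cons_preimage.
- exact: measurable_affine1.
Qed.

(** Serves twice: [Lnorm] at +oo is the essential supremum only on a space of positive measure, and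
    the whole space must not be negligible in [K0_gt0] and [mass_neq0]. *)
Lemma measure_rV_setT_gt0 n : (0 < lebesgue_rV n [set: 'rV[R]_n])%E.
Proof.
elim: n => [|n IH]; first by rewrite /= diracT lte01.
rewrite lebesgue_rVS.
rewrite (eq_integral (fun=> lebesgue_rV n setT)); last first.
  by move=> x _; congr (lebesgue_rV n _); apply/seteqP; split => // v _; rewrite /xsection/= inE.
by rewrite integral_cst//= -set_itvNyy lebesgue_measure_itv/= mule_gt0// ltey.
Qed.

Lemma integrable_affine n (a : R) (b : 'rV[R]_n) (f : 'rV[R]_n -> R) : a != 0 ->
  (lebesgue_rV n).-integrable setT (EFin \o f) ->
  (lebesgue_rV n).-integrable setT (EFin \o (fun x => f (a *: x + b))) /\
  \int[lebesgue_rV n]_x f (a *: x + b) = (`|a| ^- n) * \int[lebesgue_rV n]_x f x.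
Proof.
move=> a0 intf.
have ia0 : a^-1 != 0 by rewrite invr_eq0.
have an0 : `|a| ^+ n != 0 by rewrite expf_neq0 ?normr_eq0.
pose phi (x : 'rV[R]_n) := a *: x + b.
have mphi : measurable_fun setT phi := measurable_affine_rV a b.
have mf : measurable_fun setT (EFin \o f) := measurable_int _ intf.
pose m : {measure set 'rV[R]_n -> \bar R} :=
  measure_function_pushforward__canonical__measure_function_Measure (lebesgue_rV n) mphi.
have k0 : 0 <= `|a| ^- n by rewrite invr_ge0 exprn_ge0.
pose r := NngNum k0.
pose m' : {measure set 'rV[R]_n -> \bar R} := mscale r (lebesgue_rV n).
have mE A : measurable A -> m A = m' A.
  move=> mA; rewrite /m' /= /mscale/=.
  rewrite (lebesgue_rV_affine b a0 mA) muleA -EFinM mulVf// mul1e//.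
have intE (h : 'rV[R]_n -> R) : measurable_fun setT h -> (forall x, 0 <= h x) ->
  (\int[lebesgue_rV n]_x (h (phi x))%:E = (`|a| ^- n)%:E * \int[lebesgue_rV n]_x (h x)%:E)%E.
  move=> mh h0.
  transitivity (\int[m]_x (h x)%:E)%E.
    by rewrite ge0_integral_pushforward//; [exact/measurable_EFinP|move=> x _; rewrite lee_fin].
  rewrite -(ge0_integral_mscale _ measurableT r)//; first last.
  - by move=> x _; rewrite lee_fin.
  - exact/measurable_EFinP.
    by apply: eq_measure_integral => A mA _; rewrite (mE A mA).
have mf' : measurable_fun setT f by exact/measurable_EFinP.
have iphi : (lebesgue_rV n).-integrable setT (EFin \o (f \o phi)).
  apply/integrableP; split; first exact/measurable_EFinP/measurableT_comp.
  rewrite (_ : (fun _ => _) = (fun x => ((fun y => `|f y|) (phi x))%:E))//.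
  rewrite (intE (fun y => `|f y|)) //; last exact: measurableT_comp.
  move/integrableP : intf => [_ intf]; rewrite lte_mul_pinfty//.
split => //.
rewrite /Rintegral.
transitivity (fine (\int[m]_x (f x)%:E)%E).
  by rewrite integral_pushforward.
transitivity (fine (\int[m']_x (f x)%:E)%E).
  by congr fine; apply: eq_measure_integral => A mA _; rewrite (mE A mA).
rewrite [in LHS]integralE ge0_integral_mscale//; last first.
  exact: measurable_funepos.
rewrite ge0_integral_mscale//; last first.
  exact: measurable_funeneg.
rewrite [in RHS]integralE -muleBr//; last first.
  by apply: fin_num_adde_defl; rewrite fin_numN; exact: integrable_neg_fin_num.
rewrite fineM//= fin_numB.
by rewrite integrable_pos_fin_num// integrable_neg_fin_num.
Qed.
End affine_rV.

(** * Domination, integrals with a parameter, and Fubini *)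

Section integral_tools.
Context d1 d2 (T1 : measurableType d1) (T2 : measurableType d2) (R : realType).

Lemma integrable_le (m : {measure set T1 -> \bar R}) (D : set T1) (f g : T1 -> R) :
  measurable D -> measurable_fun D f ->
  (forall x, D x -> `|f x| <= g x) -> m.-integrable D (EFin \o g) ->
  m.-integrable D (EFin \o f).
Proof.
move=> mD mf fg; apply: le_integrable => //; first exact/measurable_EFinP.
move=> x Dx /=; rewrite lee_fin; apply: le_trans (fg x Dx) _; exact: ler_norm.
Qed.

Lemma integrable_Zl (m : {measure set T1 -> \bar R}) (D : set T1) k (f : T1 -> R) :
  measurable D -> m.-integrable D (EFin \o f) -> m.-integrable D (EFin \o (fun x => k * f x)).
Proof. by move=> mD /(integrableZl mD k); apply: eq_integrable. Qed.

(** Tonelli makes the integrals of the positive and negative parts measurable, and [fine] is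
    measurable, so parameters at which the integral diverges do no harm. *)
Lemma measurable_Rintegral (m2 : {sigma_finite_measure set T2 -> \bar R}) (f : T1 * T2 -> R) :
  measurable_fun setT f -> measurable_fun setT (fun x => \int[m2]_y f (x, y)).
Proof.
move=> mf; apply: (@measurableT_comp _ _ _ _ _ _ fine); first exact: fine_measurable.
rewrite (_ : (fun x => _) = (fun x => (\int[m2]_y (EFin \o f)^\+ (x, y) - \int[m2]_y (EFin \o f)^\- (x, y)))%E).
  have mEf : measurable_fun setT (EFin \o f) by exact/measurable_EFinP.
  apply: emeasurable_funB.
    apply: (@measurable_fun_fubini_tonelli_F _ _ _ _ _ _ (EFin \o f)^\+)%E => //.
    exact: measurable_funepos.
  apply: (@measurable_fun_fubini_tonelli_F _ _ _ _ _ _ (EFin \o f)^\-)%E => //.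
  exact: measurable_funeneg.
by apply/funext => x; rewrite [LHS]integralE; congr (_ - _)%E; apply: eq_integral => y _; rewrite ?funeposE ?funenegE.
Qed.

End integral_tools.

(** The product majorant makes every section integrable, and not just almost every one, so that
    [fine] can be removed from the inner integrals at all points. *)
Lemma Rfubini_dom d1 d2 (T1 : measurableType d1) (T2 : measurableType d2) (R : realType)
    (m1 : {sigma_finite_measure set T1 -> \bar R})
    (m2 : {sigma_finite_measure set T2 -> \bar R}) (f : T1 * T2 -> R) (g : T1 -> R) (h : T2 -> R) :
  measurable_fun setT f ->
  m1.-integrable setT (EFin \o g) -> m2.-integrable setT (EFin \o h) ->
  (forall x y, `|f (x, y)| <= g x * h y) ->
  \int[m1]_x \int[m2]_y f (x, y) = \int[m2]_y \int[m1]_x f (x, y).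
Proof.
move=> mf ig ih fgh.
have i2 x : m2.-integrable setT (EFin \o (fun y => f (x, y))).
  apply: (@integrable_le _ _ _ _ _ _ (fun y => g x * h y)) => //.
    exact: measurableT_comp mf _.
  exact: integrable_Zl.
have i1 y : m1.-integrable setT (EFin \o (fun x => f (x, y))).
  apply: (@integrable_le _ _ _ _ _ _ (fun x => h y * g x)) => //.
  - exact: measurableT_comp mf _.
  - by move=> x _; rewrite mulrC.
  - exact: integrable_Zl.
have i12 : (m1 \x m2)%E.-integrable setT (EFin \o f).
  apply/integrable12ltyP; first exact/measurable_EFinP.
  apply: (@le_lt_trans _ _ (\int[m1]_x (`|g x|%:E * \int[m2]_y `|(h y)%:E|))%E).
    apply: ge0_le_integral => //.
    - by move=> x _; apply: integral_ge0.
    - apply: (@measurable_fun_fubini_tonelli_F _ _ _ _ _ _ (fun z => `|(f z)%:E|%E)) => //.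
      by apply: measurableT_comp => //; exact/measurable_EFinP.
    - apply: emeasurable_funM => //; apply/measurable_EFinP; apply: measurableT_comp => //.
      by apply/measurable_EFinP; exact: measurable_int ig.
    - move=> x _; rewrite -ge0_integralZl//.
        apply: ge0_le_integral => //.
        - by apply: measurableT_comp => //; apply: measurable_int (i2 x).
        - apply: emeasurable_funM => //; apply: measurableT_comp => //; apply: measurable_int ih.
        - move=> y _ /=; rewrite -EFinM lee_fin -normrM; apply: le_trans (fgh x y) _; exact: ler_norm.
      by apply: measurableT_comp => //; apply: measurable_int ih.
  move: ih ig => /integrableP[mh ih] /integrableP[mg ig].
  rewrite ge0_integralZr//; last 2 first.
  - exact: (measurableT_comp (f := abse) _ mg).
  - exact: integral_ge0.
  by rewrite lte_mul_pinfty ?integral_ge0// ge0_fin_numE// integral_ge0.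
rewrite /Rintegral; congr fine.
transitivity (\int[m1]_x \int[m2]_y (f (x, y))%:E)%E.
  by apply: eq_integral => x _; rewrite fineK//; exact: integrable_fin_num (i2 x).
rewrite (Fubini i12).
by apply: eq_integral => x _; rewrite fineK//; exact: integrable_fin_num (i1 x).
Qed.

(** * Elementary inequalities between powers *)

Section expo.
Context {R : realType}.
Implicit Types c M r : R.

Lemma lin_le_pow43 M c : 0 < c -> 0 <= M -> exists C, 0 <= C /\ forall r, 0 <= r -> M * r <= c * r `^ (4/3) + C.
Proof.
(* At r = (M / c)^3 the two sides M r and c r^(4/3) cross; below it M r is at most M r0, above it
   the power dominates. *)
move=> c0 M0; pose r0 := (M / c) ^+ 3.
have r00 : 0 <= r0 by rewrite exprn_ge0// divr_ge0// ltW.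
exists (M * r0); split; first by rewrite mulr_ge0.
move=> r rge; case: (lerP r r0) => rr0.
  apply: ler_wpDl; first by rewrite mulr_ge0 ?powR_ge0// ltW.
  by rewrite ler_wpM2l.
apply: ler_wpDr; first by rewrite mulr_ge0.
have r0p : 0 < r by apply: le_lt_trans rr0.
have -> : (4/3 : R) = 1 + 3^-1 by field.
rewrite powRD; last by rewrite gt_eqF ?implybT.
rewrite powRr1// mulrCA mulrC ler_pM2l//.
rewrite -ler_pdivrMl// mulrC.
have -> : M / c = r0 `^ (3^-1).
  rewrite /r0 -powR_mulrn ?divr_ge0 ?(ltW c0)// -powRrM divff// powRr1// divr_ge0// ltW//.
by rewrite ge0_ler_powR// ?nnegrE// ltW.
Qed.

Lemma pow43_le_pow4 r : 0 <= r -> r `^ (4/3) <= 1 + r ^+ 4.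
Proof.
move=> r0; case: (lerP r 1) => r1.
  apply: ler_wpDr; first exact: exprn_ge0.
  have := @ge0_ler_powR R (4/3) _ r 1; rewrite !nnegrE r0 ler01 powR1; apply => //; lra.
apply: ler_wpDl => //; rewrite -powR_mulrn//; apply: ler_powR; [exact: ltW|lra].
Qed.

End expo.

(** By symmetry, twice an integral over the half-line, where the integrand is the density of the
    exponential law of rate 1. *)
Lemma integral_expR_abs (R : realType) :
  (\int[@lebesgue_measure R]_x (expR (- `|x|))%:E < +oo)%E.
Proof.
rewrite (@ge0_symfun_integralT _ (fun x : R => expR (- `|x|)))//; last 2 first.
- move=> x; apply: continuous_comp; last exact: continuous_expR.
  by apply: continuousN; exact: (@norm_continuous _ R^o).
- by move=> x /=; rewrite normrN.
apply: lte_mul_pinfty => //.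
have P1 := @integral_exponential_pdf R 1 ltr01.
apply: (@le_lt_trans _ _ (\int[lebesgue_measure]_(x in [set x : R | (0 <= x)%R]) (exponential_pdf 1 x)%:E)%E).
  rewrite le_eqVlt; apply/orP; left; apply/eqP; apply: eq_integral => x.
  by rewrite inE/= => x0; rewrite exponential_pdfE// mul1r mulN1r ger0_norm.
apply: (@le_lt_trans _ _ (\int[lebesgue_measure]_x (exponential_pdf 1 x)%:E)%E).
  apply: ge0_subset_integral => //.
  - rewrite (_ : [set x | _] = `[0, +oo[%classic); first exact: measurable_itv.
    by apply/seteqP; split=> x /=; rewrite in_itv/= andbT.
  - by apply/measurable_EFinP; exact: measurable_exponential_pdf.
  - by move=> x _; rewrite lee_fin exponential_pdf_ge0.
by rewrite P1 ltry.
Qed.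

(** * Rapidly decreasing functions *)

Section weight.
Context {R : realType} {d : nat}.
Implicit Types (x y v : 'rV[R]_d) (c M : R) (f g : 'rV[R]_d -> R).

Lemma dot_ge0 x : 0 <= dot x x.
Proof. by apply: sumr_ge0 => i _; rewrite -expr2 sqr_ge0. Qed.

Lemma enorm_ge0 x : 0 <= enorm x. Proof. exact: sqrtr_ge0. Qed.

Lemma sqr_enorm x : enorm x ^+ 2 = dot x x.
Proof. by rewrite sqr_sqrtr// dot_ge0. Qed.

Lemma enorm4 x : enorm x ^+ 4 = dot x x ^+ 2.
Proof. by rewrite -sqr_enorm -exprM. Qed.

Lemma coord_le_enorm x i : `|x 0 i| <= enorm x.
Proof.
rewrite -sqrtr_sqr /enorm ler_wsqrtr// /dot (bigD1 i)//= -expr2 lerDl.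
by apply: sumr_ge0 => j _; rewrite -expr2 sqr_ge0.
Qed.

(** A quasi-triangle inequality from (a + b)^2 <= 2 a^2 + 2 b^2 in each coordinate; the loss of a
    constant is harmless because the rates of the weights may shrink. *)
Lemma enormD x y : enorm (x + y) <= 2 * Num.max (enorm x) (enorm y).
Proof.
set m := Num.max _ _.
have m0 : 0 <= m by rewrite le_max enorm_ge0.
rewrite -(@ler_pXn2r _ 2)// ?nnegrE ?enorm_ge0 ?mulr_ge0//.
have hx : dot x x <= m ^+ 2.
  by rewrite -sqr_enorm ler_pXn2r// ?nnegrE ?enorm_ge0// le_max lexx.
have hy : dot y y <= m ^+ 2.
  by rewrite -sqr_enorm ler_pXn2r// ?nnegrE ?enorm_ge0// le_max lexx orbT.
rewrite sqr_enorm.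
have : dot (x + y) (x + y) <= 2 * dot x x + 2 * dot y y.
  rewrite /dot !mulr_sumr -big_split/=; apply: ler_sum => i _; rewrite !mxE.
  rewrite -subr_ge0 (_ : _ - _ = (x 0 i - y 0 i) ^+ 2) ?sqr_ge0//; ring.
move=> h; apply: le_trans h _; rewrite exprMn; nra.
Qed.

Lemma enormN x : enorm (- x) = enorm x.
Proof. by congr Num.sqrt; apply: eq_bigr => i _; rewrite !mxE mulrNN. Qed.

(** 4/3 is the exponent conjugate to 4: optimizing - x h + C h^4 over the contour shift h leaves a
    negative multiple of x^(4/3). *)
Definition pen x : R := enorm x `^ (4 / 3).

Lemma pen_ge0 x : 0 <= pen x. Proof. exact: powR_ge0. Qed.

Lemma penN x : pen (- x) = pen x. Proof. by rewrite /pen enormN. Qed.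

(** The constant 4 rounds up 2^(4/3); it is the origin of the rates c / 4 that appear after each
    translation or splitting of a weight. *)
Lemma penD x y : pen (x + y) <= 4 * (pen x + pen y).
Proof.
have h2 : (2 : R) `^ (4/3) <= 4.
  apply: (@le_trans _ _ (2 `^ 2)); last by rewrite powR_mulrn// expr2; lra.
  by apply: ler_powR; lra.
apply: (@le_trans _ _ ((2 * Num.max (enorm x) (enorm y)) `^ (4/3))).
  apply: ge0_ler_powR; rewrite ?nnegrE ?enorm_ge0 ?enormD// ?divr_ge0//.
  by rewrite mulr_ge0// le_max enorm_ge0.
rewrite powRM// ?le_max ?enorm_ge0//.
apply: ler_pM; rewrite ?powR_ge0//.
by rewrite /Num.max; case: ifP => _; rewrite ?lerDr ?lerDl powR_ge0.
Qed.

Definition wt c x : R := expR (- c * enorm x `^ (4 / 3)).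

Lemma wtE c x : wt c x = expR (- c * pen x). Proof. by []. Qed.

Lemma wt_gt0 c x : 0 < wt c x. Proof. exact: expR_gt0. Qed.

Lemma wt_le1 c x : 0 <= c -> wt c x <= 1.
Proof. by move=> c0; rewrite wtE -expR0 ler_expR mulNr oppr_le0 mulr_ge0// pen_ge0. Qed.

Lemma wt_mono c c' x : c <= c' -> wt c' x <= wt c x.
Proof. by move=> h; rewrite !wtE ler_expR ler_wpM2r ?pen_ge0// lerN2. Qed.

Lemma wtN c x : wt c (- x) = wt c x. Proof. by rewrite !wtE penN. Qed.

Lemma wtD c c' x : wt (c + c') x = wt c x * wt c' x.
Proof. by rewrite !wtE -expRD opprD mulrDl. Qed.

Lemma wt_shift c x v : 0 <= c -> wt c (x + v) <= expR (c * pen v) * wt (c / 4) x.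
Proof.
move=> c0; rewrite !wtE -expRD ler_expR.
have := penD (x + v) (- v); rewrite addrK penN => h.
by nra.
Qed.

Lemma wt_split c x y : 0 <= c -> wt c x * wt c y <= wt (c / 4) (x + y).
Proof. by move=> c0; rewrite !wtE -expRD ler_expR; have := penD x y => h; nra. Qed.

Lemma measurable_dot (x : 'rV[R]_d) : measurable_fun setT (fun y : 'rV[R]_d => dot x y).
Proof. by apply: measurable_sum => i; apply: measurable_funM => //; exact: measurable_coord. Qed.

Lemma measurable_dotxx : measurable_fun setT (fun y : 'rV[R]_d => dot y y).
Proof. by apply: measurable_sum => i; apply: measurable_funM; exact: measurable_coord. Qed.

Lemma measurable_enorm : measurable_fun setT (@enorm R d).
Proof. by apply: measurableT_comp measurable_dotxx; apply: continuous_measurable_fun; exact: sqrt_continuous. Qed.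

Lemma measurable_wt c : measurable_fun setT (wt c).
Proof.
apply: measurableT_comp => //; apply: measurable_funM => //.
exact: (measurableT_comp (measurable_powR (4/3)) measurable_enorm).
Qed.

Lemma expR_wt M c : 0 < c -> 0 <= M -> exists C, 0 < C /\ forall x, expR (M * enorm x) * wt c x <= C * wt (c / 2) x.
Proof.
move=> c0 M0; have [|C [C0 h]] := @lin_le_pow43 R M (c / 2) _ M0; first by rewrite divr_gt0.
exists (expR C); split; first exact: expR_gt0.
move=> x; rewrite !wtE -!expRD ler_expR /pen.
by have := h _ (enorm_ge0 x); lra.
Qed.

Lemma expR4_wt c x : 0 <= c -> expR (- c * enorm x ^+ 4) <= expR c * wt c x.
Proof.
move=> c0; rewrite wtE -expRD ler_expR.
by have := pow43_le_pow4 (enorm_ge0 x); rewrite /pen => h; nra.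
Qed.

(* Rapid decay, at the rate of the kernel. *)
Definition rap f := measurable_fun setT f /\
  exists C c, [/\ 0 <= C, 0 < c & forall x, `|f x| <= C * wt c x].

(** The exponential of the l1 norm factorizes over the coordinates, which matches the iterated
    product defining the measure; it then majorizes the weights up to a constant. *)
Lemma integrable_expRl1 n :
  (lebesgue_rV n).-integrable setT (EFin \o (fun x : 'rV[R]_n => expR (- \sum_i `|x 0 i|))).
Proof.
elim: n => [|n IH].
  apply/integrableP; split.
    apply/measurable_EFinP; apply: measurableT_comp => //; apply: measurableT_comp => //.
    by apply: measurable_sum => i; apply: measurableT_comp => //; exact: measurable_coord.
  rewrite (eq_integral (cst 1%E)); last by move=> x _ /=; rewrite big_ord0 oppr0 expR0 normr1.
  by rewrite integral_cst//= diracT mule1 ltey.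
pose E n (x : 'rV[R]_n) := expR (- \sum_i `|x 0 i|).
have mE k : measurable_fun setT (@E k).
  apply: measurableT_comp => //; apply: measurableT_comp => //.
  by apply: measurable_sum => i; apply: measurableT_comp => //; exact: measurable_coord.
apply/integrableP; split; first by apply/measurable_EFinP; exact: (mE n.+1).
pose e (x : measurableTypeR R) : R := expR (- `|x|).
have me : measurable_fun [set: measurableTypeR R] e.
  by apply: measurableT_comp => //; apply: measurableT_comp => //; exact: measurableT_comp.
pose P : set ('rV[R]_n.+1) -> \bar R := pushforward (@lebesgue_measure R \x lebesgue_rV n)%E (@cons_rV R n).
have EP : (\int[P]_x (E n.+1 x)%:E < +oo)%E.
  rewrite ge0_integral_pushforward//=; last 3 first.
  - exact: measurable_cons_rV.
  - by apply/measurable_EFinP; exact: (mE _).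
  - by move=> x _; rewrite lee_fin expR_ge0.
  rewrite fubini_tonelli1/=; last 2 first.
  - by apply/measurable_EFinP/measurableT_comp; [exact: mE|exact: measurable_cons_rV].
  - by move=> x; rewrite lee_fin expR_ge0.
  rewrite (eq_integral (fun x : measurableTypeR R => ((e x)%:E * \int[lebesgue_rV n]_v (E n v)%:E)%E)); last first.
    move=> x _; rewrite /fubini_F -ge0_integralZl//; last 3 first.
    - by apply/measurable_EFinP; exact: (mE _).
    - by move=> y _; rewrite lee_fin expR_ge0.
    - by rewrite lee_fin expR_ge0.
    apply: eq_integral => v _; rewrite -EFinM; congr (_%:E).
    rewrite /E /e -expRD; congr expR; rewrite big_ord_recl -opprD; congr (- (`|_| + _)).
      by have := congr1 fst (cons_rVK (x, v)).
    apply: eq_bigr => i _; congr (`|_|).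
    have /= E2 := congr1 snd (cons_rVK (x, v)).
    transitivity (rsubmx (cons_rV (x, v) : 'rV_(1 + n)) 0 i); last by rewrite E2.
    rewrite [RHS]mxE; have -> : lift ord0 i = rshift 1 i by exact/val_inj.
    by [].
  have In0 : (0 <= \int[lebesgue_rV n]_v (E n v)%:E)%E.
    by apply: integral_ge0 => y _; rewrite lee_fin expR_ge0.
  rewrite ge0_integralZr//; last 2 first.
  - exact/measurable_EFinP.
  - by move=> x _; rewrite lee_fin expR_ge0.
  have fin1 : (\int[lebesgue_rV n]_v (E n v)%:E < +oo)%E.
    move/integrableP : IH => [_]; apply: le_lt_trans; apply: ge0_le_integral => //.
    - by move=> y _; rewrite lee_fin expR_ge0.
    - by apply/measurable_EFinP; exact: (mE _).
    - by apply: measurableT_comp => //; by apply/measurable_EFinP; exact: (mE _).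
    - by move=> y _ /=; rewrite lee_fin ler_norm.
  apply: lte_mul_pinfty.
  - by apply: integral_ge0 => y _; rewrite lee_fin expR_ge0.
  - rewrite ge0_fin_numE; last by apply: integral_ge0 => y _; rewrite lee_fin expR_ge0.
    exact: integral_expR_abs.
  - exact: fin1.
apply: le_lt_trans EP; rewrite le_eqVlt; apply/orP; left; apply/eqP.
by apply: eq_integral => x _ /=; rewrite ger0_norm// expR_ge0.
Qed.

Lemma integrable_wt c : 0 < c -> (lebesgue_rV d).-integrable setT (EFin \o wt c).
Proof.
move=> c0; have [|C [C0 h]] := @lin_le_pow43 R d%:R c c0; first by [].
apply: (@integrable_le _ _ _ _ _ _ (fun x : 'rV[R]_d => expR C * expR (- \sum_i `|x 0 i|))) => //.
- exact: measurable_wt.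
- move=> x _; rewrite ger0_norm ?expR_ge0// -expRD ler_expR.
  have : \sum_i `|x 0 i| <= d%:R * enorm x.
    apply: (@le_trans _ _ (\sum_(i < d) enorm x)); first by apply: ler_sum => i _; exact: coord_le_enorm.
    by rewrite sumr_const card_ord mulr_natl.
  by have := h _ (enorm_ge0 x); lra.
- by apply: integrable_Zl => //; exact: integrable_expRl1.
Qed.

Lemma rap_integrable f : rap f -> (lebesgue_rV d).-integrable setT (EFin \o f).
Proof.
move=> [mf [C [c [C0 c0 fC]]]].
apply: (@integrable_le _ _ _ _ _ _ (fun x => C * wt c x)) => //.
by apply: integrable_Zl => //; exact: integrable_wt.
Qed.

(** Half of the rate absorbs the exponential growth of g. This one class of multipliers covers
    monomials in the frequency, moments of the kernel and bounded oscillating factors. *)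
Lemma rapM f g : rap f -> measurable_fun setT g ->
  (exists A M, [/\ 0 <= A, 0 <= M & forall x, `|g x| <= A * expR (M * enorm x)]) ->
  rap (fun x => f x * g x).
Proof.
move=> [mf [C [c [C0 c0 fC]]]] mg [A [M [A0 M0 gA]]]; split; first exact: measurable_funM.
have [B [B0 hB]] := expR_wt c0 M0.
exists (C * A * B), (c / 2); split; [by rewrite !mulr_ge0// ltW|by rewrite divr_gt0|].
move=> x; rewrite normrM.
apply: (@le_trans _ _ (C * wt c x * (A * expR (M * enorm x)))); first exact: ler_pM.
rewrite (_ : C * wt c x * _ = C * A * (expR (M * enorm x) * wt c x)); last by ring.
by rewrite -[leRHS]mulrA ler_wpM2l// mulr_ge0.
Qed.

Lemma rap_bounded f g : rap f -> measurable_fun setT g ->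
  (exists A, 0 <= A /\ forall x, `|g x| <= A) -> rap (fun x => f x * g x).
Proof.
move=> rf mg [A [A0 gA]]; apply: rapM => //; exists A, 0; split => // x.
by rewrite mul0r expR0 mulr1.
Qed.

Lemma rapZ k f : rap f -> rap (fun x => k * f x).
Proof.
move=> [mf [C [c [C0 c0 fC]]]]; split; first exact: measurable_funM.
exists (`|k| * C), c; split => //; first by rewrite mulr_ge0.
by move=> x; rewrite normrM -mulrA ler_wpM2l.
Qed.

Lemma rapD f g : rap f -> rap g -> rap (fun x => f x + g x).
Proof.
move=> [mf [C [c [C0 c0 fC]]]] [mg [C' [c' [C0' c0' gC]]]]; split; first exact: measurable_funD.
exists (C + C'), (Num.min c c'); split; rewrite ?addr_ge0 ?lt_min ?c0 ?c0'//.
move=> x; apply: le_trans (ler_normD _ _) _; rewrite mulrDl; apply: lerD.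
  by apply: le_trans (fC x) _; rewrite ler_wpM2l// wt_mono// ge_min lexx.
by apply: le_trans (gC x) _; rewrite ler_wpM2l// wt_mono// ge_min lexx orbT.
Qed.

Lemma rap_sum (I : Type) (r : seq I) (f : I -> 'rV[R]_d -> R) :
  (forall i, rap (f i)) -> rap (fun x => \sum_(i <- r) f i x).
Proof.
move=> rf; elim: r => [|i r IH].
  rewrite (_ : (fun x => _) = fun=> 0); last by apply/funext => x; rewrite big_nil.
  split => //; exists 0, 1; split => // x; by rewrite normr0 mul0r.
rewrite (_ : (fun x => _) = fun x => f i x + \sum_(i <- r) f i x); first exact: rapD.
by apply/funext => x; rewrite big_cons.
Qed.

Lemma rap_affine f (a : R) b : (a == 1) || (a == -1) -> rap f -> rap (fun x => f (a *: x + b)).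
Proof.
move=> a1 [mf [C [c [C0 c0 fC]]]]; split.
  by apply: measurableT_comp => //; exact: measurable_affine_rV.
exists (C * expR (c * pen b)), (c / 4); split; [by rewrite mulr_ge0// expR_ge0|by rewrite divr_gt0|].
move=> x; apply: le_trans (fC _) _; rewrite -mulrA ler_wpM2l//.
apply: le_trans (wt_shift _ _ (ltW c0)) _.
by case/orP: a1 => /eqP ->; rewrite ?scale1r ?scaleN1r ?wtN.
Qed.

End weight.

Lemma Rintegral_sum (R : realType) dT (T : measurableType dT) (m : {measure set T -> \bar R}) (D : set T)
    (I : Type) (r : seq I) (F : I -> T -> R) : measurable D ->
  (forall i, m.-integrable D (EFin \o F i)) ->
  m.-integrable D (EFin \o (fun w => \sum_(i <- r) F i w)) /\
  \int[m]_(w in D) (\sum_(i <- r) F i w) = \sum_(i <- r) \int[m]_(w in D) F i w.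
Proof.
move=> mD Fi; elim: r => [|i r [IH1 IH2]].
  rewrite (_ : (fun w => _) = cst 0); last by apply/funext => w; rewrite big_nil.
  by rewrite big_nil /Rintegral integral0; split => //; exact: integrable0.
rewrite (_ : (fun w => _) = (fun w => F i w + \sum_(i <- r) F i w)); last first.
  by apply/funext => w; rewrite big_cons.
split; first by apply: (eq_integrable mD) (integrableD mD (Fi i) IH1).
by rewrite big_cons RintegralD// IH2.
Qed.

(** * Remainders and differentiability *)

Section row_norm.
Context {R : realType} {d : nat}.
Implicit Types (x y v : 'rV[R]_d) (a : 'I_d -> R) (r b c s : R).

Lemma coord_le_norm v i : `|v 0 i| <= `|v|.
Proof.
rewrite [leRHS]mx_normrE.
exact: (@le_bigmax_cond _ _ _ _ (0, i) _ (fun ij : 'I_1 * 'I_d => `|v ij.1 ij.2|)).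
Qed.

Lemma norm_le_coord v r : 0 <= r -> (forall i, `|v 0 i| <= r) -> `|v| <= r.
Proof.
move=> r0 h; rewrite [leLHS]mx_normrE; apply: bigmax_le => // -[i j] _ /=.
by rewrite (ord1 i).
Qed.

Lemma norm_delta (i : 'I_d) : `|delta_mx 0 i : 'rV[R]_d| = 1.
Proof.
apply/eqP; rewrite eq_le; apply/andP; split.
  apply: norm_le_coord => // j; rewrite mxE eqxx/=.
  by case: (j == i); rewrite ?normr1// normr0.
have := coord_le_norm (delta_mx 0 i : 'rV[R]_d) i.
by rewrite mxE !eqxx/= normr1.
Qed.

Lemma norm_le_enorm v : `|v| <= enorm v.
Proof. by apply: norm_le_coord; [exact: enorm_ge0|exact: coord_le_enorm]. Qed.

Lemma enorm_le_norm v : enorm v <= d%:R * `|v|.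
Proof.
rewrite -(@ler_pXn2r _ 2)// ?nnegrE ?enorm_ge0 ?mulr_ge0//.
rewrite sqr_enorm /dot.
have -> : (d%:R * `|v|) ^+ 2 = d%:R * (d%:R * `|v| ^+ 2) :> R by ring.
apply: (@le_trans _ _ (\sum_(i < d) `|v| ^+ 2)).
  apply: ler_sum => i _; rewrite -expr2.
  by rewrite -[leLHS]ger0_norm ?sqr_ge0// normrX ler_pXn2r ?nnegrE// coord_le_norm.
rewrite sumr_const card_ord -[leLHS]mulr_natl ler_wpM2l//.
case: (posnP d) => d0; last by rewrite ler_peMl ?sqr_ge0// ler1n.
have /le_anti -> : `|v| <= 0 <= `|v|.
  by rewrite normr_ge0 andbT; apply: norm_le_coord => // i; have := ltn_ord i; rewrite {2}d0.
by rewrite expr0n mulr0.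
Qed.

Definition lform a : 'rV[R]_d -> R^o := fun v => \sum_i v 0 i * a i.

Lemma lform_is_linear a : linear (lform a).
Proof.
move=> k u v; rewrite /lform scaler_sumr -big_split/=; apply: eq_bigr => i _.
by rewrite !mxE mulrDl -mulrA.
Qed.

HB.instance Definition _ a :=
  GRing.isLinear.Build R 'rV[R]_d R^o _ (lform a) (lform_is_linear a).

Lemma lform_le a v : `|lform a v| <= `|v| * \sum_i `|a i|.
Proof.
apply: le_trans (ler_norm_sum _ _ _) _; rewrite mulr_sumr; apply: ler_sum => i _.
by rewrite normrM ler_wpM2r// coord_le_norm.
Qed.

Lemma continuous_lform a : continuous (lform a).
Proof.
apply/linear_bounded_continuous/linear_boundedP.
near=> r => x; apply: le_trans (lform_le a x) _.
rewrite mulrC ler_wpM2r//; near: r; apply: nbhs_pinfty_ge; exact: num_real.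
Unshelve. all: by end_near. Qed.

Lemma lform_delta a i : lform a (delta_mx 0 i) = a i.
Proof.
rewrite /lform (bigD1 i)//= mxE !eqxx mul1r big1 ?addr0// => j ji.
by rewrite mxE (negbTE ji) andbF mul0r.
Qed.

(** A remainder of order 1 + t with t > 0 is o(|v|). The quantitative form is preferred because,
    unlike o(|v|), it survives integration over a parameter ([rem_integral]). *)
Lemma rem_differentiable (f : 'rV[R]_d -> R) a x (C e t : R) : 0 < e -> 0 < t ->
  (forall v, `|v| <= e -> `|f (x + v) - f x - lform a v| <= C * `|v| * `|v| `^ t) ->
  differentiable (f : _ -> R^o) x /\ forall i, partial i f x = a i.
Proof.
move=> e0 t0 H.
pose g : 'rV[R]_d -> R^o := f.
pose L : {linear 'rV[R]_d -> R^o} := lform a.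
have dxf : g \o shift x = cst (g x) + L +o_ (0 : 'rV[R]_d) id.
  apply/eqaddoP => eps eps0; rewrite !fctE.
  (* Below this radius |C| |v|^t <= eps; the added 1 keeps the divisor positive. *)
  pose r := Num.min e ((eps / (`|C| + 1)) `^ t^-1).
  have C1 : 0 < `|C| + 1 by rewrite ltr_wpDl.
  have r0 : 0 < r by rewrite lt_min e0 powR_gt0// divr_gt0.
  have : \forall v \near (0 : 'rV[R]_d), `|v| <= r.
    exact: nbhs0_le.
  apply: filterS => v; rewrite le_min => /andP[ve vr].
  have -> : g (shift x v) - (g x + lform a v) = f (x + v) - f x - lform a v.
    by rewrite /g /= opprD addrA [x + v]addrC.
  apply: le_trans (H _ ve) _.
  rewrite -mulrA mulrC -mulrA [leRHS]mulrC ler_wpM2l// mulrC.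
  apply: (@le_trans _ _ ((`|C| + 1) * `|v| `^ t)).
    by rewrite ler_wpM2r ?powR_ge0//; apply: le_trans (ler_norm C) _; rewrite lerDl.
  rewrite -ler_pdivlMl// mulrC.
  have q0 : 0 <= eps / (`|C| + 1) by rewrite divr_ge0 ?ltW.
  have -> : eps / (`|C| + 1) = ((eps / (`|C| + 1)) `^ t^-1) `^ t.
    by rewrite -powRrM mulVf ?lt0r_neq0// powRr1.
  by apply: ge0_ler_powR => //; rewrite ?nnegrE ?powR_ge0// ltW.
have dE : 'd g x = L :> (_ -> _) := diff_unique (continuous_lform (a := a)) dxf.
have df : differentiable g x.
  apply/diffP => /=.
  (* The differential is a chosen value, so one continuous linear map with the right expansion shows
     that the choice succeeds. *)
  apply: (@getPex _ (fun (df : {linear 'rV[R]_d -> R^o}) => continuous df /\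
    forall y, g y = g (lim (nbhs x)) + df (y - lim (nbhs x))
                  +o_(y \near x) (y - lim (nbhs x)))).
  have hdf h : (g \o shift x = cst (g x) + h +o_ (0 : 'rV[R]_d) id) ->
      h = g \o shift x - cst (g x) +o_ (0 : 'rV[R]_d) id.
    move=> hdf; apply: eqaddoE.
    rewrite hdf addrAC -!addrA addrC !addrA subrK.
    rewrite -[LHS]addr0 -addrA; congr (_ + _).
    by apply/eqP; rewrite eq_sym addrC addr_eq0 oppo.
  exists L; split; first exact: continuous_lform.
  apply: eqaddoEx => z.
  rewrite (hdf _ dxf) !addrA lim_id // /(_ \o _) /= subrK [g _ + _]addrC addrK.
  rewrite -addrA -[LHS]addr0; congr (_ + _).
  apply/eqP; rewrite eq_sym addrC addr_eq0 oppox; apply/eqP.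
  rewrite [in LHS]littleo_center0 (comp_centerK x id).
  by rewrite -[- _ in RHS](comp_centerK x).
split => // i; rewrite /partial deriveE// dE.
exact: lform_delta.
Unshelve. all: by end_near. Qed.

Lemma derive_lform (f : 'rV[R]_d -> R) x v : differentiable (f : _ -> R^o) x ->
  'D_v (f : _ -> R^o) x = lform (fun i => partial i f x) v.
Proof.
move=> df; rewrite deriveE// {1}(row_sum_delta v) linear_sum /lform.
by apply: eq_bigr => i _; rewrite linearZ/= /partial deriveE.
Qed.

Lemma is_derive_line (f : 'rV[R]_d -> R) x v (r : R) : differentiable (f : _ -> R^o) (x + r *: v) ->
  is_derive r 1 (fun r => f (x + r *: v) : R^o) (lform (fun i => partial i f (x + r *: v)) v).
Proof.
move=> df; rewrite -derive_lform//.
have dv : derivable (f : _ -> R^o) (x + r *: v) v by exact: diff_derivable.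
have E : (fun h : R => h^-1 *: ((fun r => f (x + r *: v) : R^o) (h *: 1 + r) - f (x + r *: v))) =
  (fun h : R => h^-1 *: ((f : _ -> R^o) (h *: v + (x + r *: v)) - f (x + r *: v))).
  apply/funext => h; congr (_ *: (f _ - _)).
  by rewrite scalerDl addrCA [h%:A]mulr1.
by split; [rewrite /derivable E|rewrite /derive E].
Qed.

Lemma line_mvt (f : 'rV[R]_d -> R) x v :
  (forall r, 0 <= r <= 1 -> differentiable (f : _ -> R^o) (x + r *: v)) ->
  exists2 c, 0 <= c <= 1 & f (x + v) - f x = lform (fun i => partial i f (x + c *: v)) v.
Proof.
move=> df.
have der (r : R) : 0 <= r <= 1 -> is_derive r 1 (fun r => f (x + r *: v) : R^o)
    (lform (fun i => partial i f (x + r *: v)) v).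
  by move=> r01; apply: is_derive_line; exact: df.
have [| |c] := @MVT_segment R (fun r => f (x + r *: v)) (fun r => lform (fun i => partial i f (x + r *: v)) v) 0 1 ler01.
- by move=> r; rewrite in_itv/= => /andP[r0 r1]; apply: der; rewrite !ltW.
- apply: derivable_within_continuous => r; rewrite in_itv/= => r01.
  by have [] := der r r01.
- rewrite in_itv/= => c01; rewrite scale1r scale0r addr0 subr0 mulr1 => E.
  by exists c.
Qed.

Lemma lform_bound a v b : (forall i, `|a i| <= b) -> `|lform a v| <= d%:R * b * `|v|.
Proof.
move=> ab; apply: le_trans (lform_le a v) _; rewrite mulrC ler_wpM2r//.
apply: (@le_trans _ _ (\sum_(i < d) b)); first exact: ler_sum.
by rewrite sumr_const card_ord mulr_natl.
Qed.

Lemma lformB (a a' : 'I_d -> R) v : lform a v - lform a' v = lform (fun i => a i - a' i) v.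
Proof. by rewrite /lform -sumrB; apply: eq_bigr => i _; rewrite mulrBr. Qed.

Lemma mvt_bound (f : 'rV[R]_d -> R) x v b :
  (forall r, 0 <= r <= 1 -> differentiable (f : _ -> R^o) (x + r *: v)) ->
  (forall r i, 0 <= r <= 1 -> `|partial i f (x + r *: v)| <= b) ->
  `|f (x + v) - f x| <= d%:R * b * `|v|.
Proof. by move=> df fb; have [c c01 ->] := line_mvt df; apply: lform_bound => i; exact: fb. Qed.

Lemma rem_holder (f : 'rV[R]_d -> R) x v b :
  (forall r, 0 <= r <= 1 -> differentiable (f : _ -> R^o) (x + r *: v)) ->
  (forall r i, 0 <= r <= 1 -> `|partial i f (x + r *: v) - partial i f x| <= b) ->
  `|f (x + v) - f x - lform (fun i => partial i f x) v| <= d%:R * b * `|v|.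
Proof.
move=> df fb; have [c c01 ->] := line_mvt df.
by rewrite lformB; apply: lform_bound => i; exact: fb.
Qed.

Lemma rem_taylor (f : 'rV[R]_d -> R) x v b : 0 <= b ->
  (forall r, 0 <= r <= 1 -> differentiable (f : _ -> R^o) (x + r *: v)) ->
  (forall r i, 0 <= r <= 1 -> differentiable (partial i f : _ -> R^o) (x + r *: v)) ->
  (forall r i j, 0 <= r <= 1 -> `|partial j (partial i f) (x + r *: v)| <= b) ->
  `|f (x + v) - f x - lform (fun i => partial i f x) v| <= d%:R ^+ 2 * b * `|v| ^+ 2.
Proof.
move=> b0 df ddf fb.
have H r i : 0 <= r <= 1 -> `|partial i f (x + r *: v) - partial i f x| <= d%:R * b * `|v|.
  move=> /andP[r0 r1].
  have rr s : 0 <= s <= 1 -> 0 <= s * r <= 1.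
    by move=> /andP[s0 s1]; rewrite mulr_ge0//= mulr_ile1.
  apply: le_trans (@mvt_bound (partial i f) x (r *: v) b _ _) _.
  - by move=> s s01; rewrite scalerA; apply: ddf; exact: rr.
  - by move=> s j s01; rewrite scalerA; apply: fb; exact: rr.
  - rewrite ler_wpM2l ?mulr_ge0// normrZ ger0_norm// ler_piMl//.
apply: le_trans (rem_holder df H) _.
by rewrite le_eqVlt; apply/orP; left; apply/eqP; ring.
Qed.

(** With z = |v| / rho, both the mean value bound (z <= 1) and the triangle inequality (z > 1) are
    at most a multiple of z^th; the constant adds the d of the former to the 2 of the latter. Here
    rho is the length on which g varies: one derivative costs 1 / rho. *)
Lemma interp_holder (g : 'rV[R]_d -> R) (A rho th : R) x v : 0 <= A -> 0 < rho -> 0 <= th <= 1 ->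
  (forall y, `|g y| <= A) ->
  (forall y, differentiable (g : _ -> R^o) y) ->
  (forall y i, `|partial i g y| <= A / rho) ->
  `|g (x + v) - g x| <= (d%:R + 2) * A * (`|v| / rho) `^ th.
Proof.
move=> A0 rho0 /andP[th0 th1] gA dg dgA.
have z0 : 0 <= `|v| / rho by rewrite divr_ge0// ltW.
have [z1|z1] := lerP (`|v| / rho) 1.
  apply: le_trans (@mvt_bound g x v (A / rho) _ _) _ => //.
  have -> : d%:R * (A / rho) * `|v| = d%:R * A * (`|v| / rho) by ring.
  have zz : `|v| / rho <= (`|v| / rho) `^ th.
    move: z0; rewrite le_eqVlt => /predU1P[<-|z0]; first exact: powR_ge0.
    by apply: ger1_powR => //; rewrite z0.
  apply: ler_pM => //; first by rewrite mulr_ge0.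
  by rewrite ler_wpM2r// lerDl.
apply: le_trans (ler_normB _ _) _.
apply: (@le_trans _ _ (2 * A)); first by rewrite mulr_natl mulr2n lerD.
have : 1 <= (`|v| / rho) `^ th.
  by rewrite -[leLHS](powRr0 (`|v| / rho)); apply: ler_powR => //; exact: ltW.
move=> h; apply: le_trans (ler_peMr _ h); rewrite ?mulr_ge0 ?addr_ge0//.
by rewrite ler_wpM2r// lerDr.
Qed.

(** A first-order remainder with an integrable constant passes to the integral by linearity. It is
    applied to the frequency integral of the kernel and to the convolution, with eta = |v|^2, and to
    the time integral, with eta = |v|^(1+th). *)
Lemma rem_integral dT (T : measurableType dT) (m : {measure set T -> \bar R}) (D : set T)
    (f : T -> 'rV[R]_d -> R) (g : T -> 'I_d -> R) (b : T -> R) x v (eta : R) :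
  measurable D ->
  (forall y, m.-integrable D (EFin \o f ^~ y)) ->
  (forall i, m.-integrable D (EFin \o g ^~ i)) ->
  m.-integrable D (EFin \o b) ->
  (forall w, D w -> `|f w (x + v) - f w x - lform (g w) v| <= b w * eta) ->
  `|\int[m]_(w in D) f w (x + v) - \int[m]_(w in D) f w x - lform (fun i => \int[m]_(w in D) g w i) v|
    <= (\int[m]_(w in D) b w) * eta.
Proof.
move=> mD fi gi bi H.
have [li lE'] : m.-integrable D (EFin \o (fun w => lform (g w) v)) /\
    \int[m]_(w in D) lform (g w) v = lform (fun i => \int[m]_(w in D) g w i) v.
  have [h1 h2] := @Rintegral_sum _ _ _ m D _ (index_enum 'I_d) (fun i w => v 0 i * g w i) mD (fun i => integrable_Zl (v 0 i) mD (gi i)).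
  by split => //; rewrite h2; apply: eq_bigr => i _; rewrite RintegralZl.
have fB : m.-integrable D (EFin \o (fun w => f w (x + v) - f w x)).
  by apply: (eq_integrable mD) (integrableB mD (fi (x + v)) (fi x)).
rewrite -lE' -RintegralB// -RintegralB//.
have fBB : m.-integrable D (EFin \o (fun w => f w (x + v) - f w x - lform (g w) v)).
  by apply: (eq_integrable mD) (integrableB mD fB li).
apply: le_trans (le_normr_Rintegral _ _) _ => //.
rewrite -RintegralZr//; apply: le_Rintegral => //.
- exact: integrable_norm.
- by apply: (eq_integrable mD) (integrableZr mD eta bi).
Qed.

End row_norm.

(** * Differentiation under the integral, and integrals of rapidly decreasing functions *)

Lemma is_derive_Rintegral (R : realType) dT (T : measurableType dT) (m : {measure set T -> \bar R})
    (f df : R -> T -> R) (G : T -> R) (a : R) :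
  (forall r, m.-integrable setT (EFin \o f r)) ->
  (forall (r : R) w, is_derive r 1 (f ^~ w : R -> R^o) (df r w)) ->
  m.-integrable setT (EFin \o G) ->
  (forall r w, `|r - a| < 1 -> `|df r w| <= G w) ->
  is_derive a 1 (fun r => \int[m]_w f r w : R^o) (\int[m]_w df a w).
Proof.
move=> fi fd Gi dG.
have Ia : `]a - 1, a + 1[%classic a by rewrite /= in_itv/= ltrBlDr ltrDl ltr01.
have G0 w : 0 <= G w by apply: le_trans (dG a w _); rewrite ?subrr ?normr0.
have dE r w : partial1of2 f r w = df r w.
  by rewrite partial1of2E; have [_ ->] := fd r w.
have H1 (r : R) (w : T) : `]a - 1, a + 1[%classic r -> setT w -> derivable (f ^~ w) r 1.
  by move=> _ _; have [] := fd r w.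
have H2 (r : R) (w : T) : `]a - 1, a + 1[%classic r -> setT w -> `|partial1of2 f r w| <= G w.
  move=> /=; rewrite in_itv/= => /andP[h1 h2] _; rewrite dE; apply: dG.
  by rewrite ltr_distl h1 h2.
have H0 (r : R) : `]a - 1, a + 1[%classic r -> m.-integrable setT (EFin \o f r) by [].
split.
  exact: (derivable_under_integral measurableT Ia H0 H1 G0 Gi H2).
have := differentiation_under_integral measurableT Ia H0 H1 G0 Gi H2.
rewrite derive1E => ->; congr fine; apply: eq_integral => w _.
by rewrite dE.
Qed.

Section rapid_calculus.
Context {R : realType} {d : nat}.
Local Notation mu := (@lebesgue_rV R d).
Implicit Types (x y v e : 'rV[R]_d) (f g : 'rV[R]_d -> R).

Lemma enormZ (r : R) v : enorm (r *: v) = `|r| * enorm v.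
Proof.
rewrite /enorm (_ : dot _ _ = r ^+ 2 * dot v v); last first.
  by rewrite /dot mulr_sumr; apply: eq_bigr => i _; rewrite !mxE; ring.
by rewrite sqrtrM ?sqr_ge0// sqrtr_sqr.
Qed.

Lemma pen_scale_le (r : R) v : `|r| <= 1 -> pen (r *: v) <= pen v.
Proof.
move=> r1; apply: ge0_ler_powR; rewrite ?nnegrE ?enorm_ge0// ?divr_ge0//.
by rewrite enormZ ler_piMl// enorm_ge0.
Qed.

Lemma rap_locally_dominated f e : rap f -> exists G : 'rV[R]_d -> R,
  [/\ mu.-integrable setT (EFin \o G), rap G & forall r x, `|r| <= 1 -> `|f (x + r *: e)| <= G x].
Proof.
move=> [mf [C [c [C0 c0 fC]]]].
have rG : rap (fun x : 'rV[R]_d => C * expR (c * pen e) * wt (c / 4) x).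
  split; first by apply: measurable_funM => //; exact: measurable_wt.
  exists (C * expR (c * pen e)), (c / 4); split; [by rewrite mulr_ge0// expR_ge0|by rewrite divr_gt0|].
  by move=> x; rewrite ger0_norm// !mulr_ge0 ?expR_ge0// ltW// wt_gt0.
exists (fun x => C * expR (c * pen e) * wt (c / 4) x); split; [exact: rap_integrable rG|exact: rG|].
move=> r x r1; apply: le_trans (fC _) _; rewrite -mulrA ler_wpM2l//.
apply: le_trans (wt_shift _ _ (ltW c0)) _.
apply: ler_wpM2r; first exact: ltW (wt_gt0 _ _).
rewrite ler_expR; apply: ler_wpM2l; [exact: ltW|exact: pen_scale_le].
Qed.

Lemma Rintegral_translate f v : mu.-integrable setT (EFin \o f) ->
  mu.-integrable setT (EFin \o (fun x => f (x + v))) /\ \int[mu]_x f (x + v) = \int[mu]_x f x.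
Proof.
move=> fi; have [h1 h2] := integrable_affine v (oner_neq0 R) fi; split.
  by under eq_fun do rewrite -[X in f (X + _)]scale1r.
by under eq_Rintegral do rewrite -[X in f (X + _)]scale1r; rewrite h2 normr1 expr1n invr1 mul1r.
Qed.

(** The integral of a translate does not depend on the translation; differentiating it under the
    integral sign at 0 gives the claim. Every integration by parts below, and the contour shift, is
    an instance of this. *)
Lemma rap_integral_derivative f f' e : rap f -> rap f' ->
  (forall x (r : R), is_derive r 1 (fun r => f (x + r *: e) : R^o) (f' (x + r *: e))) ->
  \int[mu]_x f' x = 0.
Proof.
move=> rf rf' fd.
have [G [Gi _ dG]] := rap_locally_dominated e rf'.
have fi := rap_integrable rf.
pose F (r : R) (x : 'rV[R]_d) := f (x + r *: e).
have Fi r : mu.-integrable setT (EFin \o F r) /\ \int[mu]_x F r x = \int[mu]_x f x.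
  exact: Rintegral_translate.
have := @is_derive_Rintegral R _ _ mu F (fun r x => f' (x + r *: e)) G 0 (fun r => (Fi r).1) _ Gi _.
case.
- by move=> r x; rewrite subr0 => /ltW r1; exact: dG.
rewrite (_ : (fun r => _) = cst (\int[mu]_x f x)); last by apply/funext => r; exact: (Fi r).2.
move=> _; rewrite derive_cst => /esym.
by under eq_Rintegral do rewrite scale0r addr0.
Qed.

Lemma Rintegral_reflect f v : mu.-integrable setT (EFin \o f) ->
  mu.-integrable setT (EFin \o (fun x => f (v - x))) /\ \int[mu]_x f (v - x) = \int[mu]_x f x.
Proof.
have m10 : (-1 : R) != 0 by rewrite oppr_eq0 oner_neq0.
move=> fi; have [h1 h2] := integrable_affine v m10 fi; split.
  by under eq_fun do rewrite addrC -scaleN1r.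
under eq_Rintegral do rewrite addrC -scaleN1r.
by rewrite h2 normrN normr1 expr1n invr1 mul1r.
Qed.

End rapid_calculus.

(** * Successive derivatives of the cosine *)

Section trig.
Context {R : realType}.
Implicit Types (a b r : R) (k : nat).

(* The k-th derivative of cos, so that iterated derivatives of the kernel are
   again cosine integrals. *)
Definition trig k a : R := cos (a + k%:R * (pi / 2)).

Lemma trig_le1 k a : `|trig k a| <= 1. Proof. by rewrite ler_norml cos_geN1 cos_le1. Qed.

Lemma measurable_trig k : measurable_fun setT (trig k).
Proof.
apply: measurableT_comp; last exact: measurable_funD.
by apply: continuous_measurable_fun; exact: continuous_cos.
Qed.

Lemma is_derive_trig k a : is_derive a 1 (trig k : R -> R^o) (trig k.+1 a).
Proof.
apply: is_derive_eq.
rewrite addr0 mulr1 /trig (_ : k.+1%:R * (pi / 2) = k%:R * (pi / 2) + pi / 2); last by rewrite -natr1; ring.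
rewrite addrA.
by rewrite [in RHS]cosD sin_pihalf cos_pihalf; ring.
Qed.

Lemma trig_taylor k a b : `|trig k (a + b) - trig k a - b * trig k.+1 a| <= b ^+ 2.
Proof.
have mvt j x y : exists2 c, `|c| <= `|y| & trig j (x + y) - trig j x = trig j.+1 (x + c) * y.
  have der (r : R) : is_derive r 1 (fun r => trig j (x + r * y) : R^o) (trig j.+1 (x + r * y) * y).
    have d1 : is_derive r 1 (fun r => x + r * y : R^o) y.
      by apply: is_derive_eq; rewrite /GRing.scale/=; ring.
    apply: is_derive_eq (is_derive1_comp (f := trig j : R -> R^o) (is_derive_trig _ _) d1) _.
    by [].
  have [|c] := @MVT_segment R (fun r => trig j (x + r * y)) (fun r => trig j.+1 (x + r * y) * y) 0 1 ler01 (fun r _ => der r).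
  - by apply: derivable_within_continuous => r _; have [] := der r.
  - rewrite in_itv/= => /andP[c0 c1]; rewrite mul1r mul0r addr0 subr0 mulr1 => E.
    by exists (c * y) => //; rewrite normrM ger0_norm// ler_piMl.
have [c cb ->] := mvt k a b.
have [c' _ E] := mvt k.+1 a c.
have -> : trig k.+1 (a + c) * b - b * trig k.+1 a = (trig k.+1 (a + c) - trig k.+1 a) * b by ring.
rewrite E !normrM -[leRHS]ger0_norm ?sqr_ge0// normrX expr2 ler_wpM2r//.
by rewrite -[leRHS]mul1r ler_pM// trig_le1.
Qed.

End trig.

(** * The kernel and its derivatives *)

Section kernel.
Context {R : realType} {d : nat}.
Local Notation mu := (@lebesgue_rV R d).
Implicit Types (x y v e xi : 'rV[R]_d) (t : R) (s : seq 'I_d) (i : 'I_d).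

Definition mono s xi : R := \prod_(i <- s) xi 0 i.
Definition gk t xi : R := expR (- t * enorm xi ^+ 4).
Definition cK : R := ((2 * pi) ^+ d)^-1.
(* K s t is the iterated partial derivative of kernel_G t along the word s
   (partial_K), as a real integral. *)
Definition K s t x : R := cK * \int[mu]_xi (mono s xi * gk t xi * trig (size s) (dot x xi)).

Lemma cK_gt0 : 0 < cK. Proof. by rewrite invr_gt0 exprn_gt0// mulr_gt0// pi_gt0. Qed.

Lemma kernel_GE t : kernel_G t = K [::] t.
Proof.
apply/funext => x; rewrite /kernel_G /K; congr (_ * _); apply: eq_Rintegral => xi _.
by rewrite /mono big_nil mul1r /trig mul0r addr0.
Qed.

Lemma mono_cons i s xi : mono (i :: s) xi = xi 0 i * mono s xi.
Proof. by rewrite /mono big_cons. Qed.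

Lemma measurable_mono s : measurable_fun setT (mono s).
Proof.
elim: s => [|i s IH].
  by rewrite (_ : mono _ = cst 1)//; apply/funext => x; rewrite /mono big_nil.
rewrite (_ : mono _ = fun xi => xi 0 i * mono s xi); last by apply/funext => x; rewrite mono_cons.
by apply: measurable_funM => //; exact: measurable_coord.
Qed.

Lemma mono_le s xi : `|mono s xi| <= 1 * expR ((size s)%:R * enorm xi).
Proof.
rewrite mul1r; elim: s => [|i s IH]; first by rewrite /mono big_nil mul0r expR0 normr1.
rewrite mono_cons normrM /= -natr1 mulrDl mul1r expRD mulrC ler_pM//.
apply: le_trans (coord_le_enorm xi i) _; apply: le_trans (expR_ge1Dx _).
by rewrite lerDr.
Qed.

Lemma gk_gt0 t xi : 0 < gk t xi. Proof. exact: expR_gt0. Qed.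

Lemma measurable_gk t : measurable_fun setT (gk t).
Proof.
apply: measurableT_comp => //; apply: measurable_funM => //.
by apply: measurable_funX; exact: measurable_enorm.
Qed.

Lemma rap_gk t : 0 < t -> rap (gk t).
Proof.
move=> t0; split; first exact: measurable_gk.
exists (expR t), t; split => //.
by move=> x; rewrite ger0_norm ?expR_ge0//; apply: expR4_wt; exact: ltW.
Qed.

Lemma rap_mono_gk s t : 0 < t -> rap (fun xi => mono s xi * gk t xi).
Proof.
move=> t0; under eq_fun do rewrite mulrC.
apply: rapM; [exact: rap_gk|exact: measurable_mono|].
by exists 1, (size s)%:R; split => // x; exact: mono_le.
Qed.

Lemma rap_K_integrand s t (k : nat) x (b : R) : 0 < t ->
  rap (fun xi => mono s xi * gk t xi * trig k (dot x xi + b)).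
Proof.
move=> t0; apply: (@rap_bounded _ _ (fun xi => mono s xi * gk t xi)).
- exact: rap_mono_gk.
- apply: measurableT_comp; first exact: measurable_trig.
  by apply: measurable_funD => //; exact: measurable_dot.
- by exists 1; split => // xi; exact: trig_le1.
Qed.

Lemma rap_K_integrand0 s t (k : nat) x : 0 < t ->
  rap (fun xi => mono s xi * gk t xi * trig k (dot x xi)).
Proof. by move=> t0; have := rap_K_integrand s k x 0 t0; under eq_fun do rewrite addr0. Qed.

Lemma dotDl x y xi : dot (x + y) xi = dot x xi + dot y xi.
Proof. by rewrite /dot -big_split/=; apply: eq_bigr => i _; rewrite mxE mulrDl. Qed.

Lemma dotDr x y xi : dot xi (x + y) = dot xi x + dot xi y.
Proof. by rewrite /dot -big_split/=; apply: eq_bigr => i _; rewrite mxE mulrDr. Qed.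

Lemma dotZl (r : R) x xi : dot (r *: x) xi = r * dot x xi.
Proof. by rewrite /dot mulr_sumr; apply: eq_bigr => i _; rewrite mxE mulrA. Qed.

Lemma dotC x y : dot x y = dot y x.
Proof. by apply: eq_bigr => i _; rewrite mulrC. Qed.

Lemma dot_le x xi : `|dot x xi| <= d%:R * enorm xi * `|x|.
Proof.
have -> : dot x xi = lform (fun i => xi 0 i) x by [].
by apply: lform_bound => i; exact: coord_le_enorm.
Qed.

(** Uniformity in x is the point: [rap_K] compares a derivative with a difference quotient whose
    step depends on x, and needs the same constant everywhere. *)
Lemma K_rem s t : 0 < t -> exists2 C, 0 <= C & forall x v,
  `|K s t (x + v) - K s t x - lform (fun i => K (i :: s) t x) v| <= C * `|v| ^+ 2.
Proof.
move=> t0.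
pose b xi : R := `|mono s xi| * gk t xi * (d%:R * enorm xi) ^+ 2.
have bi : mu.-integrable setT (EFin \o b).
  apply: rap_integrable; apply: rapM.
  - have -> : (fun xi => `|mono s xi| * gk t xi) = (fun xi => `|mono s xi * gk t xi|).
      by apply/funext => xi; rewrite normrM [`|gk _ _|]gtr0_norm// gk_gt0.
    have [m1 [C [c [C0 c0 h]]]] := rap_mono_gk s t0; split; first exact: measurableT_comp.
    by exists C, c; split => // x; rewrite normr_id.
  - by apply: measurable_funX; apply: measurable_funM => //; exact: measurable_enorm.
  - exists (d%:R ^+ 2), 2; split => // xi.
    rewrite exprMn normrM [`|d%:R ^+ 2|]ger0_norm ?exprn_ge0// ler_wpM2l ?exprn_ge0//.
    rewrite ger0_norm ?exprn_ge0 ?enorm_ge0// mulr_natl mulr2n expRD expr2.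
    have e1 : enorm xi <= expR (enorm xi) by apply: le_trans (expR_ge1Dx _); rewrite lerDr.
    by apply: ler_pM => //; exact: enorm_ge0.
exists (cK * \int[mu]_xi b xi) => [|x v].
  apply: mulr_ge0; first exact: ltW cK_gt0.
  by apply: Rintegral_ge0 => xi _; rewrite /b !mulr_ge0 ?expR_ge0// ?enorm_ge0.
have := @rem_integral R d _ _ mu setT (fun xi x => mono s xi * gk t xi * trig (size s) (dot x xi))
  (fun xi i => mono (i :: s) xi * gk t xi * trig (size s).+1 (dot x xi)) b x v (`|v| ^+ 2) measurableT.
move=> /(_ _ _ bi _) H.
have -> : K s t (x + v) - K s t x - lform (fun i => K (i :: s) t x) v = cK *
   (\int[mu]_w (mono s w * gk t w * trig (size s) (dot (x + v) w)) - \int[mu]_w (mono s w * gk t w * trig (size s) (dot x w)) -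
    lform (fun i => \int[mu]_w (mono (i :: s) w * gk t w * trig (size s).+1 (dot x w))) v).
  rewrite /K !mulrBr; congr (_ - _ - _); rewrite /lform mulr_sumr; apply: eq_bigr => i _.
  by rewrite mulrCA.
rewrite normrM (gtr0_norm cK_gt0) -mulrA ler_pM2l ?cK_gt0//; apply: H.
- by move=> y; apply: rap_integrable; exact: rap_K_integrand0.
- by move=> i; apply: rap_integrable; exact: rap_K_integrand0.
- move=> xi _.
  have -> : lform (fun i => mono (i :: s) xi * gk t xi * trig (size s).+1 (dot x xi)) v =
      mono s xi * gk t xi * (dot v xi * trig (size s).+1 (dot x xi)).
    rewrite /lform /dot mulr_suml mulr_sumr; apply: eq_bigr => i _; rewrite mono_cons; ring.
  rewrite -!mulrBr normrM /b normrM [`|gk _ _|]gtr0_norm ?gk_gt0//.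
  rewrite -[leRHS]mulrA.
  apply: ler_wpM2l; first by rewrite mulr_ge0// ltW// gk_gt0.
  rewrite dotDl; apply: le_trans (trig_taylor _ _ _) _.
  rewrite -exprMn -[leLHS]ger0_norm ?sqr_ge0// normrX ler_pXn2r ?nnegrE// ?mulr_ge0 ?enorm_ge0//.
  exact: dot_le.
Qed.

Lemma K_diff s t x : 0 < t -> differentiable (K s t : _ -> R^o) x /\
  forall i, partial i (K s t) x = K (i :: s) t x.
Proof.
move=> t0; have [C C0 H] := K_rem s t0.
apply: (@rem_differentiable _ _ _ _ _ C 1 1) => // v _.
by rewrite powRr1// -mulrA -expr2; exact: H.
Qed.

Lemma partial_K i s t : 0 < t -> partial i (K s t) = K (i :: s) t.
Proof. by move=> t0; apply/funext => x; have [_ ->] := K_diff s x t0. Qed.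

(** The arbitrary parameter space gives joint measurability in time and space, required for the
    Duhamel integrand. *)
Lemma measurable_K dT (T : measurableType dT) s (tau : T -> R) (z : T -> 'rV[R]_d) :
  measurable_fun setT tau -> measurable_fun setT z ->
  measurable_fun setT (fun w => K s (tau w) (z w)).
Proof.
move=> mtau mz; apply: measurable_funM => //.
apply: (@measurable_Rintegral _ _ _ _ _ _ (fun p : T * 'rV[R]_d => mono s p.2 * gk (tau p.1) p.2 * trig (size s) (dot (z p.1) p.2))).
apply: measurable_funM; first apply: measurable_funM.
- exact: measurableT_comp (measurable_mono s) measurable_snd.
- apply: measurableT_comp => //; apply: measurable_funM.
    apply: measurableT_comp => //; exact: measurableT_comp mtau measurable_fst.
  by apply: measurable_funX; exact: measurableT_comp measurable_enorm measurable_snd.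
- apply: measurableT_comp; first exact: measurable_trig.
  apply: measurable_sum => i; apply: measurable_funM.
    exact: (measurableT_comp (measurable_coord i) (measurableT_comp mz measurable_fst)).
  exact: (measurableT_comp (measurable_coord i) measurable_snd).
Qed.

(** The substitution of r xi for xi. Writing the time as r^4 avoids fourth roots and keeps all
    powers integral. *)
Lemma K_scale s x (r : R) : 0 < r -> K s (r ^+ 4) x = r ^- (d + size s) * K s 1 (r^-1 *: x).
Proof.
move=> r0; rewrite /K mulrCA; congr (_ * _).
have rn0 : r != 0 by rewrite gt_eqF.
have := @integrable_affine R d r 0 (fun xi => mono s xi * gk 1 xi * trig (size s) (dot (r^-1 *: x) xi)) rn0.
case; first by apply: rap_integrable; exact: rap_K_integrand0.
move=> _; rewrite (gtr0_norm r0) => H.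
have sc : forall s xi, mono s (r *: xi) = r ^+ size s * mono s xi.
  elim=> [|i s' IH] xi; first by rewrite /mono !big_nil mulr1.
  by rewrite !mono_cons IH mxE /= exprS; ring.
transitivity (r ^- size s * (r ^- d * \int[mu]_xi (mono s xi * gk 1 xi * trig (size s) (dot (r^-1 *: x) xi)))).
  rewrite -H -RintegralZl//; last first.
    have := @integrable_affine R d r 0 (fun xi => mono s xi * gk 1 xi * trig (size s) (dot (r^-1 *: x) xi)) rn0.
    by case => //; apply: rap_integrable; exact: rap_K_integrand0.
  apply: eq_Rintegral => xi _; rewrite addr0 sc /gk enormZ (gtr0_norm r0) exprMn.
  rewrite dotZl -[dot x (r *: xi)]dotC dotZl mulKf// dotC mulN1r mulNr -!mulrA mulKf// expf_neq0//.
by rewrite mulrA -invfM -exprD addnC.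
Qed.

End kernel.

(** * Decay of the kernel *)

Section contour_real.
Context {R : realType}.
Implicit Types (q y c X h t r : R).

(* With q = xi.xi and y = xi_i, cA + i cB is |xi|^4 at the shifted frequency
   xi + i h e_i, and cU + i cV below is exp (- t |xi|^4 + i x.xi) there. *)
Definition cA q y h := (q - h * h) * (q - h * h) - 4 * (y * y) * (h * h).
Definition cB q y h := 4 * (y * h) * (q - h * h).

(** Completing the square gives 17: with k = h^2, the bound y^2 <= q yields cA >= q^2 - 6 q k + k^2
    = q^2/2 + (q - 6 k)^2/2 - 17 k^2. *)
Lemma cA_ge q y h : 0 <= q -> y * y <= q -> q ^+ 2 / 2 - 17 * h ^+ 4 <= cA q y h.
Proof.
move=> q0 yq; rewrite /cA.
have h2 : 0 <= h * h by rewrite -expr2 sqr_ge0.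
have -> : h ^+ 4 = (h * h) * (h * h) by ring.
rewrite expr2; set k := h * h in h2 *.
have : 0 <= (q - 6 * k) * (q - 6 * k) by rewrite -expr2 sqr_ge0.
have : (y * y) * k <= q * k by rewrite ler_wpM2r.
nra.
Qed.

(** Together with [is_derive_cV], a Cauchy-Riemann equation: the derivative of the real part in the
    shift h is minus that of the imaginary part in the frequency coordinate. *)
Lemma is_derive_cU q y c X t h :
  is_derive h 1 (fun h => expR (- t * cA q y h - X * h) * cos (c - t * cB q y h) : R^o)
   (- (expR (- t * cA q y h - X * h) *
     (- t * (4 * y * (q - 3 * h * h)) * sin (c - t * cB q y h) +
      (X - t * (4 * h * (q + 2 * y * y - h * h))) * cos (c - t * cB q y h)))).
Proof. by rewrite /cA /cB; apply: is_derive_eq; rewrite /GRing.scale/=; ring. Qed.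

Lemma is_derive_cV q y c X t h r :
  is_derive r 1 (fun r => expR (- t * cA (q + 2 * r * y + r * r) (y + r) h - X * h) * sin (c + r * X - t * cB (q + 2 * r * y + r * r) (y + r) h) : R^o)
   (expR (- t * cA (q + 2 * r * y + r * r) (y + r) h - X * h) *
     (- t * (4 * (y + r) * ((q + 2 * r * y + r * r) - 3 * h * h)) * sin (c + r * X - t * cB (q + 2 * r * y + r * r) (y + r) h) +
      (X - t * (4 * h * ((q + 2 * r * y + r * r) + 2 * (y + r) * (y + r) - h * h))) * cos (c + r * X - t * cB (q + 2 * r * y + r * r) (y + r) h))).
Proof. by rewrite /cA /cB; apply: is_derive_eq; rewrite /GRing.scale/=; ring. Qed.

End contour_real.

Section decay.
Context {R : realType} {d : nat}.
Local Notation mu := (@lebesgue_rV R d).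
Implicit Types (x y v e xi : 'rV[R]_d) (t h N : R) (s : seq 'I_d) (i : 'I_d).

Definition cphase t x i h xi : R := - t * cA (dot xi xi) (xi 0 i) h - x 0 i * h.
Definition cangle t x i h xi : R := dot x xi - t * cB (dot xi xi) (xi 0 i) h.
Definition cU t x i h xi : R := expR (cphase t x i h xi) * cos (cangle t x i h xi).
Definition cV t x i h xi : R := expR (cphase t x i h xi) * sin (cangle t x i h xi).
Definition cV' t x i h xi : R := expR (cphase t x i h xi) *
  (- t * (4 * xi 0 i * (dot xi xi - 3 * h * h)) * sin (cangle t x i h xi) +
   (x 0 i - t * (4 * h * (dot xi xi + 2 * xi 0 i * xi 0 i - h * h))) * cos (cangle t x i h xi)).

Lemma sqr_coord_le xi i : xi 0 i * xi 0 i <= dot xi xi.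
Proof.
rewrite -expr2 -sqr_enorm -[leLHS]ger0_norm ?sqr_ge0// normrX.
by rewrite ler_pXn2r ?nnegrE ?enorm_ge0// coord_le_enorm.
Qed.

Lemma expR_cphase_le t x i h xi : 0 <= t ->
  expR (cphase t x i h xi) <= expR (- (x 0 i * h) + 17 * t * h ^+ 4) * gk (t / 2) xi.
Proof.
move=> t0; rewrite /gk -expRD ler_expR /cphase enorm4.
have := cA_ge h (dot_ge0 xi) (sqr_coord_le xi i).
set A := cA _ _ _; set q := dot xi xi => hA.
have : t * (q ^+ 2 / 2 - 17 * h ^+ 4) <= t * A by rewrite ler_wpM2l.
lra.
Qed.

Lemma measurable_coordR i : measurable_fun setT (fun xi : 'rV[R]_d => xi 0 i).
Proof. exact: measurable_coord. Qed.

Lemma measurable_cphase t x i h : measurable_fun setT (cphase t x i h).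
Proof.
have mc := measurable_coordR i; have md := @measurable_dotxx R d.
apply: measurable_funB => //; apply: measurable_funM => //; apply: measurable_funB.
  by apply: measurable_funM; apply: measurable_funB.
by apply: measurable_funM => //; apply: measurable_funM => //; apply: measurable_funM.
Qed.

Lemma measurable_cangle t x i h : measurable_fun setT (cangle t x i h).
Proof.
have mc := measurable_coordR i; have md := @measurable_dotxx R d.
apply: measurable_funB; first exact: measurable_dot.
apply: measurable_funM => //; apply: measurable_funM; last exact: measurable_funB.
by apply: measurable_funM => //; apply: measurable_funM.
Qed.

Lemma measurable_sin_cangle t x i h : measurable_fun setT (fun xi => sin (cangle t x i h xi)).
Proof.
apply: measurableT_comp; last exact: measurable_cangle.
by apply: continuous_measurable_fun; exact: continuous_sin.
Qed.

Lemma measurable_cos_cangle t x i h : measurable_fun setT (fun xi => cos (cangle t x i h xi)).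
Proof.
apply: measurableT_comp; last exact: measurable_cangle.
by apply: continuous_measurable_fun; exact: continuous_cos.
Qed.

(** A majorant valid for all |h| <= N, as differentiation under the integral in h demands. The
    polynomial factor is cubic in |xi|, whence expR (3 |xi|). *)
Lemma cV'_bound t x i N xi h : 0 <= t -> 0 <= N -> `|h| <= N ->
  `|cV' t x i h xi| <= (expR (`|x 0 i| * N + 17 * t * N ^+ 4) * (`|x 0 i| + 4 * t * (1 + N) ^+ 3)) * (gk (t / 2) xi * expR (3 * enorm xi)).
Proof.
move=> t0 N0 hN; rewrite /cV' normrM [`|expR _|]gtr0_norm ?expR_gt0//.
set P := expR (cphase _ _ _ _ _).
have PE : P <= expR (`|x 0 i| * N + 17 * t * N ^+ 4) * gk (t / 2) xi.
  apply: le_trans (expR_cphase_le _ _ _ _ t0) _; rewrite ler_wpM2r ?expR_ge0// ler_expR.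
  apply: lerD.
    by rewrite -mulNr; apply: le_trans (ler_norm _) _; rewrite normrM normrN ler_wpM2l.
  rewrite ler_wpM2l ?mulr_ge0// -[leLHS]ger0_norm; last by rewrite exprn_even_ge0.
  by rewrite normrX; apply: lerXn2r; rewrite ?nnegrE.
set r := enorm xi; have r0 : 0 <= r := enorm_ge0 xi.
have E : (1 + r) ^+ 3 <= expR (3 * r).
  by rewrite expRM_natl; apply: lerXn2r; rewrite ?nnegrE ?addr_ge0 ?expR_ge0// expR_ge1Dx.
set y := xi 0 i; have yr : `|y| <= r := coord_le_enorm xi i.
have -> : dot xi xi = r * r by rewrite -sqr_enorm.
have y2 : `|y * y| <= r * r by rewrite normrM ler_pM.
have h2 : `|h * h| <= N * N by rewrite normrM ler_pM.
(* The bounds in [Z1] and [Z2] add up to the binomial expansion of 4 (r + N)^3. *)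
have Z1 : `|4 * y * (r * r - 3 * h * h)| <= 4 * r * (r * r + 3 * (N * N)).
  rewrite normrM; apply: ler_pM => //; first by rewrite normrM ger0_norm// ler_wpM2l.
  apply: le_trans (ler_normB _ _) _; rewrite ger0_norm ?mulr_ge0// lerD2l.
  by rewrite -mulrA normrM ger0_norm// ler_wpM2l.
have Z2 : `|4 * h * (r * r + 2 * y * y - h * h)| <= 4 * N * (3 * (r * r) + N * N).
  rewrite normrM; apply: ler_pM => //; first by rewrite normrM ger0_norm// ler_wpM2l.
  apply: le_trans (ler_normB _ _) _; apply: lerD => //.
  apply: le_trans (ler_normD _ _) _; rewrite ger0_norm ?mulr_ge0//.
  rewrite -mulrA normrM ger0_norm//; lra.
set Z := - t * _ * _ + _.
have rN : (r + N) ^+ 3 <= ((1 + N) * (1 + r)) ^+ 3.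
  by apply: lerXn2r; rewrite ?nnegrE ?addr_ge0 ?mulr_ge0 ?addr_ge0//; nra.
have ZE : `|Z| <= (`|x 0 i| + 4 * t * (1 + N) ^+ 3) * (1 + r) ^+ 3.
  apply: (@le_trans _ _ (`|x 0 i| + t * (4 * (r + N) ^+ 3))).
    apply: le_trans (ler_normD _ _) _; rewrite !normrM normrN (ger0_norm t0).
    have S : `|sin (cangle t x i h xi)| <= 1 by rewrite ler_norml sin_geN1 sin_le1.
    have C : `|cos (cangle t x i h xi)| <= 1 by rewrite ler_norml cos_geN1 cos_le1.
    rewrite -!normrM.
    apply: (@le_trans _ _ (t * `|4 * y * (r * r - 3 * h * h)| * 1 + `|x 0 i - t * (4 * h * (r * r + 2 * y * y - h * h))| * 1)).
      by rewrite [`|(_ - _) * _|]normrM; apply: lerD; apply: ler_pM => //; rewrite mulr_ge0.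
    rewrite !mulr1.
    have : `|x 0 i - t * (4 * h * (r * r + 2 * y * y - h * h))| <= `|x 0 i| + t * `|4 * h * (r * r + 2 * y * y - h * h)|.
      by apply: le_trans (ler_normB _ _) _; rewrite normrM (ger0_norm t0).
    have : t * `|4 * y * (r * r - 3 * h * h)| <= t * (4 * r * (r * r + 3 * (N * N))) by rewrite ler_wpM2l.
    have : t * `|4 * h * (r * r + 2 * y * y - h * h)| <= t * (4 * N * (3 * (r * r) + N * N)) by rewrite ler_wpM2l.
    have -> : t * (4 * (r + N) ^+ 3) = t * (4 * r * (r * r + 3 * (N * N))) + t * (4 * N * (3 * (r * r) + N * N)) by ring.
    lra.
  rewrite [leRHS]mulrDl; apply: lerD.
    by rewrite ler_peMr// -[leLHS](expr1n _ 3); apply: lerXn2r; rewrite ?nnegrE ?addr_ge0// lerDl.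
  rewrite -[leRHS]mulrA -exprMn [4 * t]mulrC -[leRHS]mulrA; apply: ler_wpM2l => //; exact: ler_wpM2l.
apply: (@le_trans _ _ ((expR (`|x 0 i| * N + 17 * t * N ^+ 4) * gk (t / 2) xi) * ((`|x 0 i| + 4 * t * (1 + N) ^+ 3) * expR (3 * r)))).
  apply: ler_pM => //; first exact: expR_ge0.
  by apply: le_trans ZE _; rewrite ler_wpM2l// addr_ge0// mulr_ge0 ?mulr_ge0// ?exprn_ge0// addr_ge0.
by rewrite le_eqVlt; apply/orP; left; apply/eqP; ring.
Qed.

Lemma rap_gk_expR t (M : R) : 0 < t -> 0 <= M -> rap (fun xi => gk t xi * expR (M * enorm xi)).
Proof.
move=> t0 M0; apply: rapM; [exact: rap_gk| |].
  by apply: measurableT_comp => //; apply: measurable_funM => //; exact: measurable_enorm.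
by exists 1, M; split => // x; rewrite mul1r ger0_norm ?expR_ge0.
Qed.

Lemma rap_le (f g : 'rV[R]_d -> R) (C : R) : 0 <= C -> measurable_fun setT f ->
  (forall x, `|f x| <= C * g x) -> rap g -> rap f.
Proof.
move=> C0 mf fg [mg [A [c [A0 c0 gA]]]]; split => //.
exists (C * A), c; split => //; first exact: mulr_ge0.
move=> x; apply: le_trans (fg x) _; rewrite -mulrA ler_wpM2l//.
by apply: le_trans (gA x); exact: ler_norm.
Qed.

Lemma rap_expR_cphase t x i h (g : 'rV[R]_d -> R) : 0 < t -> measurable_fun setT g -> (forall xi, `|g xi| <= 1) ->
  rap (fun xi => expR (cphase t x i h xi) * g xi).
Proof.
move=> t0 mg g1.
apply: (@rap_le _ (gk (t / 2)) (expR (- (x 0 i * h) + 17 * t * h ^+ 4))).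
- exact: ltW (expR_gt0 _).
- by apply: measurable_funM => //; apply: measurableT_comp => //; exact: measurable_cphase.
- move=> xi; rewrite normrM [`|expR _|]gtr0_norm ?expR_gt0//.
  apply: (@le_trans _ _ (expR (cphase t x i h xi) * 1)); first by rewrite ler_wpM2l// expR_ge0.
  by rewrite mulr1; apply: expR_cphase_le; exact: ltW.
- by apply: rap_gk; rewrite divr_gt0.
Qed.

Lemma rap_cU t x i h : 0 < t -> rap (cU t x i h).
Proof.
by move=> t0; apply: rap_expR_cphase => //; [exact: measurable_cos_cangle|move=> xi; rewrite ler_norml cos_geN1 cos_le1].
Qed.

Lemma rap_cV t x i h : 0 < t -> rap (cV t x i h).
Proof.
by move=> t0; apply: rap_expR_cphase => //; [exact: measurable_sin_cangle|move=> xi; rewrite ler_norml sin_geN1 sin_le1].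
Qed.

Lemma measurable_cV' t x i h : measurable_fun setT (cV' t x i h).
Proof.
have mc := measurable_coordR i; have md := @measurable_dotxx R d.
have ms := measurable_sin_cangle t x i h; have mco := measurable_cos_cangle t x i h.
apply: measurable_funM; first by apply: measurableT_comp => //; exact: measurable_cphase.
apply: measurable_funD; apply: measurable_funM => //.
  by apply: measurable_funM => //; apply: measurable_funM; [exact: measurable_funM|exact: measurable_funB].
apply: measurable_funB => //; apply: measurable_funM => //; apply: measurable_funM => //.
apply: measurable_funB => //; apply: measurable_funD => //; apply: measurable_funM => //.
exact: measurable_funM.
Qed.

Lemma rap_cV' t x i h : 0 < t -> rap (cV' t x i h).
Proof.
move=> t0; apply: (@rap_le _ _ _ _ _ (fun xi => @cV'_bound t x i `|h| xi h (ltW t0) (normr_ge0 h) (lexx _))).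
- by rewrite mulr_ge0 ?expR_ge0// addr_ge0// mulr_ge0 ?mulr_ge0 ?(ltW t0)// ?exprn_ge0// addr_ge0.
- exact: measurable_cV'.
- by apply: rap_gk_expR => //; rewrite divr_gt0.
Qed.

Lemma dot_delta x i : dot x (delta_mx 0 i) = x 0 i.
Proof.
rewrite /dot (bigD1 i)//= mxE !eqxx mulr1 big1 ?addr0// => j ji.
by rewrite mxE (negbTE ji) andbF mulr0.
Qed.

Lemma is_derive_cV_line t x i h xi (r : R) :
  is_derive r 1 (fun r => cV t x i h (xi + r *: delta_mx 0 i) : R^o) (cV' t x i h (xi + r *: delta_mx 0 i)).
Proof.
have E0 (r' : R) : dot (xi + r' *: delta_mx 0 i) (xi + r' *: delta_mx 0 i) = dot xi xi + 2 * r' * xi 0 i + r' * r'.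
  rewrite dotDl !dotDr dotZl dotZl ![dot _ (r' *: _)]dotC !dotZl dot_delta [dot (delta_mx _ _) xi]dotC dot_delta.
  by rewrite mxE !eqxx /=; ring.
have E1 (r' : R) : (xi + r' *: delta_mx 0 i) 0 i = xi 0 i + r'.
  by rewrite !mxE !eqxx mulr1.
have E2 (r' : R) : dot x (xi + r' *: delta_mx 0 i) = dot x xi + r' * x 0 i.
  by rewrite dotDr [dot _ (r' *: _)]dotC dotZl dotC dotC [dot (delta_mx _ _) x]dotC dot_delta dotC.
have := is_derive_cV (dot xi xi) (xi 0 i) (dot x xi) (x 0 i) t h r.
rewrite /cV /cV' /cphase /cangle E0 E1 E2.
by under [X in is_derive _ _ X _ -> _]eq_fun do rewrite -E0 -E1 -E2.
Qed.

(** Cauchy's theorem in real form: by the Cauchy-Riemann equation the derivative in h is the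
    integral of a derivative in the direction i of a rapidly decreasing function, which vanishes. *)
Lemma contour_integral_const t x i h : 0 < t ->
  \int[mu]_xi cU t x i h xi = \int[mu]_xi cU t x i 0 xi.
Proof.
move=> t0; apply: (@is_derive_0_is_cst _ (fun h => \int[mu]_xi cU t x i h xi)) => {}h.
have IV : \int[mu]_xi (- cV' t x i h xi) = 0.
  under eq_Rintegral do rewrite -mulN1r.
  rewrite RintegralZl//; last by apply: rap_integrable; exact: rap_cV'.
  rewrite (_ : \int[mu]_xi cV' t x i h xi = 0) ?mulr0//.
  apply: (@rap_integral_derivative _ _ (cV t x i h) _ (delta_mx 0 i)).
  - exact: rap_cV.
  - exact: rap_cV'.
  - by move=> y r; exact: is_derive_cV_line.
rewrite -IV; pose N := `|h| + 1.
apply: (@is_derive_Rintegral R _ _ mu (fun h => cU t x i h) (fun h xi => - cV' t x i h xi)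
  (fun xi => (expR (`|x 0 i| * N + 17 * t * N ^+ 4) * (`|x 0 i| + 4 * t * (1 + N) ^+ 3)) * (gk (t / 2) xi * expR (3 * enorm xi)))).
- by move=> r; apply: rap_integrable; exact: rap_cU.
- by move=> r xi; exact: is_derive_cU.
- by apply: rap_integrable; apply: rapZ; apply: rap_gk_expR => //; rewrite divr_gt0.
- move=> r xi rh; rewrite normrN; apply: cV'_bound; rewrite ?(ltW t0) ?addr_ge0//.
  rewrite -[r](subrK h) addrC; apply: le_trans (ler_normD _ _) _; rewrite lerD2l; exact: ltW.
Qed.

Lemma K_contour_bound t x i h : 0 < t ->
  `|K [::] t x| <= @cK R d * (\int[mu]_xi gk (t / 2) xi) * expR (- (x 0 i * h) + 17 * t * h ^+ 4).
Proof.
move=> t0; have t20 : 0 < t / 2 by rewrite divr_gt0.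
have -> : K [::] t x = @cK R d * \int[mu]_xi cU t x i h xi.
  rewrite contour_integral_const// /K; congr (_ * _); apply: eq_Rintegral => xi _.
  rewrite /mono big_nil mul1r /trig mul0r addr0 /cU /cphase /cangle /gk enorm4 /cA /cB.
  by congr (expR _ * cos _); ring.
rewrite normrM (gtr0_norm cK_gt0) -mulrA ler_pM2l ?cK_gt0//.
have Ui := rap_integrable (rap_cU x i h t0).
apply: le_trans (le_normr_Rintegral _ Ui) _ => //.
rewrite -RintegralZr//; last exact: rap_integrable (rap_gk t20).
apply: le_Rintegral => //.
- exact: integrable_norm.
- by have := integrable_Zl (expR (- (x 0 i * h) + 17 * t * h ^+ 4)) measurableT (rap_integrable (rap_gk t20)); under eq_fun do rewrite mulrC.
- move=> xi _; rewrite /cU normrM [`|expR _|]gtr0_norm ?expR_gt0//.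
  apply: (@le_trans _ _ (expR (cphase t x i h xi) * 1)).
    by rewrite ler_wpM2l ?expR_ge0// ler_norml cos_geN1 cos_le1.
  by rewrite mulr1 mulrC; apply: expR_cphase_le; exact: ltW.
Qed.

Lemma lformZ (a : 'I_d -> R) (r : R) v : lform a (r *: v) = r * lform a v.
Proof. by rewrite /lform mulr_sumr; apply: eq_bigr => i _; rewrite mxE mulrA. Qed.

Lemma K0_coord_decay t : 0 < t -> exists I c, [/\ 0 <= I, 0 < c & forall x i, `|K [::] t x| <= I * expR (- c * `|x 0 i| `^ (4 / 3))].
Proof.
(* The shift has modulus a with a^3 = X / (34 t) and the sign of x 0 i. Then 17 t a^4 is half of X
   a, and the exponent that remains is - X a / 2 = - X^(4/3) / (2 k). *)
move=> t0; pose k := (34 * t) `^ (3^-1).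
have t34 : 0 < 34 * t by rewrite mulr_gt0.
have k0 : 0 < k by rewrite powR_gt0.
have cube (z : R) : 0 <= z -> (z `^ (3^-1)) ^+ 3 = z.
  by move=> z0; rewrite -powR_mulrn ?powR_ge0// -powRrM mulVf ?pnatr_eq0// powRr1.
exists (@cK R d * \int[mu]_xi gk (t / 2) xi), (2 * k)^-1; split.
- by rewrite mulr_ge0 ?(ltW cK_gt0)// Rintegral_ge0// => xi _; exact: expR_ge0.
- by rewrite invr_gt0 mulr_gt0.
move=> x i; set X := `|x 0 i|; pose a := X `^ (3^-1) / k.
have X0 : 0 <= X := normr_ge0 _.
have a3 : a ^+ 3 = X / (34 * t) by rewrite /a expr_div_n !cube// ltW.
pose h := if 0 <= x 0 i then a else - a.
apply: le_trans (K_contour_bound x i h t0) _; rewrite ler_wpM2l//.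
  by rewrite mulr_ge0 ?(ltW cK_gt0)// Rintegral_ge0// => xi _; exact: expR_ge0.
have xh : x 0 i * h = X * a.
  by rewrite /h /X; case: (lerP 0 (x 0 i)) => h0; rewrite ?(ger0_norm h0) ?(ltr0_norm h0) ?mulrN ?mulNr.
have h4 : h ^+ 4 = a * a ^+ 3 by rewrite /h; case: ifP => _; ring.
rewrite ler_expR xh h4 a3 le_eqVlt; apply/orP; left; apply/eqP.
have -> : X `^ (4 / 3) = X * X `^ (3^-1).
  have -> : (4 / 3 : R) = 1 + 3^-1 by field.
  by rewrite powRD ?powRr1// gt_eqF// addr_gt0.
rewrite /a; field; rewrite !gt_eqF//.
Qed.

Lemma rap_K0 t : 0 < t -> rap (K [::] t : 'rV[R]_d -> R).
Proof.
move=> t0; split; first by apply: measurable_K => //; exact: measurable_cst.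
have [I [c [I0 c0 H]]] := K0_coord_decay t0.
pose D : R := (d%:R + 1) `^ (4 / 3).
have D0 : 0 < D by rewrite powR_gt0// ltr_wpDl.
exists (I + `|K [::] t (0 : 'rV[R]_d)|), (c / D); split; [by rewrite addr_ge0|by rewrite divr_gt0|].
(* Away from the origin the coordinate of largest modulus carries the decay; the term [|K [::] t 0|]
   in the constant takes care of the origin. *)
move=> x; have [->|x0] := eqVneq x 0.
  rewrite wtE /pen (_ : enorm 0 = 0) ?powR0 ?gt_eqF// ?mulr0 ?expR0 ?mulr1 ?lerDr//.
  by rewrite -(scale0r 0) enormZ normr0 mul0r.
have xn : mx_norm x != 0 by rewrite -[mx_norm x]/(`|x|) normr_eq0.
have [[j i]] := mx_norm_neq0 xn.
rewrite (ord1 j) /= => xE.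
apply: (@le_trans _ _ (I * wt (c / D) x)); last first.
  by rewrite ler_wpM2r ?lerDl// ltW// wt_gt0.
apply: le_trans (H x i) _; rewrite ler_wpM2l// ler_expR !mulNr lerN2.
rewrite mulrAC -mulrA ler_wpM2l ?(ltW c0)// ler_pdivrMr// -powRM ?addr_ge0//.
apply: ge0_ler_powR; rewrite ?nnegrE ?enorm_ge0 ?mulr_ge0 ?addr_ge0 ?divr_ge0//.
apply: le_trans (enorm_le_norm x) _; rewrite mulrC -xE -[mx_norm x]/(`|x|).
by rewrite ler_wpM2l// lerDl.
Qed.

(** Decay passes to derivatives by an inequality of Landau type: del |f'| is at most |f(x + del e)|
    + |f(x)| + B del^2. The choice del = wt (c / 8) x is the square root of the decay of f and its
    translates, so f' decays like del. Only the kernel itself goes through the contour shift. *)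
Lemma rap_K s t : 0 < t -> rap (K s t : 'rV[R]_d -> R).
Proof.
move=> t0; elim: s => [|i s [_ [C [c [C0 c0 IH]]]]]; first exact: rap_K0.
split; first by apply: measurable_K => //; exact: measurable_cst.
have [B B0 HB] := K_rem s t0.
pose E := expR (c * pen (delta_mx 0 i : 'rV[R]_d)).
exists (C * E + C + B), (c / 8); split; [by rewrite !addr_ge0// mulr_ge0// expR_ge0|by rewrite divr_gt0|].
move=> x.
have [del [del0 del1 -> dd]] : exists del : R, [/\ 0 < del, del <= 1, wt (c / 8) x = del & wt (c / 4) x = del * del].
  exists (wt (c / 8) x); split => //; first exact: wt_gt0.
    by apply: wt_le1; rewrite divr_ge0// ltW.
  by rewrite -wtD -mulrDr; congr (wt (c * _) x); field.
have cx : wt c x <= del * del by rewrite -dd; apply: wt_mono; rewrite ler_pdivrMr// ler_peMr ?(ltW c0)//; lra.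
have cxv : wt c (x + del *: delta_mx 0 i) <= E * (del * del).
  apply: (@le_trans _ _ (E * wt (c / 4) x)); last by rewrite dd.
  apply: (le_trans (wt_shift _ _ (ltW c0))).
  apply: ler_wpM2r; first exact: ltW (wt_gt0 _ _).
  rewrite ler_expR; apply: ler_wpM2l; first exact: ltW.
  by apply: pen_scale_le; rewrite gtr0_norm.
have nv : `|del *: delta_mx 0 i : 'rV[R]_d| = del by rewrite normrZ norm_delta mulr1 gtr0_norm.
have := HB x (del *: delta_mx 0 i); rewrite nv lformZ lform_delta.
set g := K (i :: s) t x => Hrem.
rewrite -(ler_pM2l del0) -{1}(gtr0_norm del0) -normrM.
have -> : del * g = (K s t (x + del *: delta_mx 0 i) - K s t x) - (K s t (x + del *: delta_mx 0 i) - K s t x - del *: g).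
  by rewrite opprB addrCA subrr addr0.
apply: le_trans (ler_normB _ _) _; apply: (@le_trans _ _ (C * (E * (del * del)) + C * (del * del) + B * del ^+ 2)); last first.
  by rewrite le_eqVlt; apply/orP; left; apply/eqP; ring.
apply: lerD => //; apply: le_trans (ler_normB _ _) _; apply: lerD.
  by apply: le_trans (IH _) _; rewrite ler_wpM2l.
by apply: le_trans (IH _) _; rewrite ler_wpM2l.
Qed.

End decay.

(** * Convolution with the kernel *)

Section convolution.
Context {R : realType} {d : nat}.
Local Notation mu := (@lebesgue_rV R d).
Implicit Types (x y v e : 'rV[R]_d) (f g k : 'rV[R]_d -> R) (t : R) (s : seq 'I_d) (i : 'I_d).

Lemma conv_defined_integrable k c : conv_defined k -> 0 < c ->
  mu.-integrable setT (EFin \o (fun y => wt c y * k y)).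
Proof. by move=> kd c0; exact: kd. Qed.

Lemma conv_defined_measurable k : conv_defined k -> measurable_fun setT k.
Proof.
move=> kd.
have -> : k = fun y => (wt 1 y)^-1 * (wt 1 y * k y).
  by apply/funext => y; rewrite mulKf// gt_eqF// wt_gt0.
apply: measurable_funM; last first.
  by apply/measurable_EFinP; apply: measurable_int (kd 1 ltr01).
have -> : (fun y : 'rV[R]_d => (wt 1 y)^-1) = wt (-1).
  by apply/funext => y; rewrite /wt -expRN; congr expR; ring.
exact: measurable_wt.
Qed.

Lemma conv_definedP k (A M : R) : 0 <= A -> 0 <= M -> measurable_fun setT k ->
  (forall y, `|k y| <= A * expR (M * enorm y)) -> conv_defined k.
Proof.
move=> A0 M0 mk kA eps eps0; apply: (@rap_integrable _ _ (fun y => wt eps y * k y)).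
apply: rapM => //; last by exists A, M.
split; first exact: measurable_wt.
by exists 1, eps; split => // x; rewrite mul1r ger0_norm// ltW// wt_gt0.
Qed.

Lemma wt_sub c x y : 0 <= c -> wt c (x - y) <= expR (c * pen x) * wt (c / 4) y.
Proof. by move=> c0; rewrite addrC -[wt (c / 4) y]wtN; exact: wt_shift. Qed.

Lemma conv_dominated f k x : rap f -> conv_defined k ->
  mu.-integrable setT (EFin \o (fun y => f (x - y) * k y)).
Proof.
move=> [mf [C [c [C0 c0 fC]]]] kd.
have c40 : 0 < c / 4 by rewrite divr_gt0.
have mk := conv_defined_measurable kd.
apply: (@integrable_le _ _ _ _ _ _ (fun y => (C * expR (c * pen x)) * `|wt (c / 4) y * k y|)) => //.
- apply: measurable_funM => //; apply: measurableT_comp => //.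
  have -> : (fun y => x - y) = (fun y => -1 *: y + x) by apply/funext => y; rewrite scaleN1r addrC.
  exact: measurable_affine_rV.
- move=> y _; rewrite !normrM (gtr0_norm (wt_gt0 (c / 4) y)) mulrA; apply: ler_wpM2r; first exact: normr_ge0.
  apply: le_trans (fC _) _; rewrite -mulrA; apply: (ler_wpM2l C0).
  by apply: wt_sub; exact: ltW.
- by apply: integrable_Zl => //; apply: integrable_norm; exact: conv_defined_integrable.
Qed.

Lemma rap_abs f : rap f -> rap (fun x => `|f x|).
Proof.
move=> [mf [C [c [C0 c0 fC]]]]; split; first exact: measurableT_comp.
by exists C, c; split => // x; rewrite normr_id.
Qed.

Lemma rap_ball f : rap f -> exists C c, [/\ 0 <= C, 0 < c & forall x v, `|v| <= 1 -> `|f (x + v)| <= C * wt c x].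
Proof.
move=> [mf [C [c [C0 c0 fC]]]]; pose p0 : R := d%:R `^ (4 / 3).
exists (C * expR (c * p0)), (c / 4); split; [by rewrite mulr_ge0// expR_ge0|by rewrite divr_gt0|].
move=> x v v1; apply: le_trans (fC _) _; rewrite -mulrA; apply: ler_wpM2l => //.
apply: le_trans (wt_shift _ _ (ltW c0)) _; apply: ler_wpM2r; first exact: ltW (wt_gt0 _ _).
rewrite ler_expR; apply: ler_wpM2l; first exact: ltW.
apply: ge0_ler_powR; rewrite ?nnegrE ?enorm_ge0 ?divr_ge0//.
by apply: le_trans (enorm_le_norm v) _; rewrite ler_piMr.
Qed.

Lemma conv_diff s t k x : 0 < t -> conv_defined k ->
  differentiable (Defs.conv (K s t) k : _ -> R^o) x /\ forall i, partial i (Defs.conv (K s t) k) x = Defs.conv (K (i :: s) t) k x.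
Proof.
move=> t0 kd.
(* [F] dominates all second derivatives of the kernel at once, so that a single weight controls the
   Taylor remainder for all |v| <= 1. *)
pose F z := \sum_(i <- index_enum 'I_d) \sum_(j <- index_enum 'I_d) `|K (j :: i :: s) t z|.
have rF : rap F by apply: rap_sum => i; apply: rap_sum => j; apply: rap_abs; exact: rap_K.
have [C [c [C0 c0 HF]]] := rap_ball rF.
have c40 : 0 < c / 4 by rewrite divr_gt0.
pose b y := (d%:R ^+ 2 * (C * expR (c * pen x))) * `|wt (c / 4) y * k y|.
have bi : mu.-integrable setT (EFin \o b).
  by apply: integrable_Zl => //; apply: integrable_norm; exact: conv_defined_integrable.
have H v : `|v| <= 1 -> `|Defs.conv (K s t) k (x + v) - Defs.conv (K s t) k x - lform (fun i => Defs.conv (K (i :: s) t) k x) v|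
    <= (\int[mu]_y b y) * `|v| ^+ 2.
  move=> v1.
  apply: (@rem_integral R d _ _ mu setT (fun y x => K s t (x - y) * k y) (fun y i => K (i :: s) t (x - y) * k y) b x v (`|v| ^+ 2)) => //.
  - by move=> y; apply: conv_dominated => //; exact: rap_K.
  - by move=> i; apply: conv_dominated => //; exact: rap_K.
  move=> y _; have -> : lform (fun i => K (i :: s) t (x - y) * k y) v = lform (fun i => K (i :: s) t (x - y)) v * k y.
    by rewrite /lform mulr_suml; apply: eq_bigr => i _; rewrite mulrA.
  rewrite -mulrBl -mulrBl normrM.
  have -> : b y * `|v| ^+ 2 = (d%:R ^+ 2 * (C * (expR (c * pen x) * wt (c / 4) y)) * `|v| ^+ 2) * `|k y|.
    by rewrite /b normrM (gtr0_norm (wt_gt0 (c / 4) y)); ring.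
  apply: ler_wpM2r => //.
  rewrite [x + v - y]addrAC.
  have := @rem_taylor R d (K s t) (x - y) v (C * (expR (c * pen x) * wt (c / 4) y)).
  rewrite (_ : (fun i => partial i (K s t) (x - y)) = fun i => K (i :: s) t (x - y)); last first.
    by apply/funext => i; rewrite partial_K.
  apply.
  - by apply: mulr_ge0 => //; apply: mulr_ge0; [exact: expR_ge0|exact: ltW (wt_gt0 _ _)].
  - by move=> r _; have [] := K_diff s (x - y + r *: v) t0.
  - by move=> r i _; rewrite partial_K//; have [] := K_diff (i :: s) (x - y + r *: v) t0.
  - move=> r i j /andP[r0 r1]; rewrite !partial_K//.
    apply: (@le_trans _ _ `|F (x - y + r *: v)|).
      rewrite [leRHS]ger0_norm; last by rewrite /F; apply: sumr_ge0 => i' _; apply: sumr_ge0.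
      rewrite /F (bigD1_seq i) ?mem_index_enum ?index_enum_uniq//=.
      rewrite (bigD1_seq j) ?mem_index_enum ?index_enum_uniq//=.
      rewrite -[leRHS]addrA lerDl addr_ge0 ?sumr_ge0// => i' _; exact: sumr_ge0.
    apply: le_trans (HF _ _ _) _; first by rewrite normrZ ger0_norm// mulr_ile1.
    by apply: ler_wpM2l => //; apply: wt_sub; exact: ltW.
apply: (@rem_differentiable _ _ _ _ _ (\int[mu]_y b y) 1 1) => // v v1.
by rewrite powRr1// -mulrA -expr2; exact: H.
Qed.

Lemma partial_conv s t k i : 0 < t -> conv_defined k -> partial i (Defs.conv (K s t) k) = Defs.conv (K (i :: s) t) k.
Proof. by move=> t0 kd; apply/funext => x; have [_ ->] := conv_diff s x t0 kd. Qed.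

(** A pointwise limit of difference quotients with the steps 1 / (n + 1). *)
Lemma measurable_partial f i : measurable_fun setT f -> (forall x, differentiable (f : _ -> R^o) x) ->
  measurable_fun setT (partial i f).
Proof.
move=> mf df.
pose h (n : nat) x := n.+1%:R * (f (1 *: x + n.+1%:R^-1 *: delta_mx 0 i) - f x).
apply: (@measurable_fun_cvg _ _ _ _ h) => //.
  move=> n; apply: measurable_funM => //; apply: measurable_funB => //.
  by apply: measurableT_comp => //; exact: measurable_affine_rV.
move=> x _.
have dv : derivable (f : _ -> R^o) x (delta_mx 0 i) by exact: diff_derivable.
have /cvg_ex[l Hl] := dv.
have -> : partial i f x = l by rewrite /partial /derive; exact: cvg_lim Hl.
have /cvgr_dnbhsP /(_ (@harmonic R)) := Hl.
have hn0 n : @harmonic R n != 0 by rewrite /harmonic /= invr_eq0 pnatr_eq0.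
move=> /(_ (conj hn0 cvg_harmonic)); apply: cvg_trans; apply: near_eq_cvg.
by apply: nearW => n /=; rewrite /h /harmonic /= invrK scale1r [x + _]addrC.
Qed.

Lemma rap_reflect f x : rap f -> rap (fun y => f (x - y)).
Proof.
move=> rf; have := @rap_affine _ _ f (-1) x _ rf; rewrite eqxx orbT => /(_ isT).
by under eq_fun do rewrite scaleN1r addrC.
Qed.

Lemma lformN (a : 'I_d -> R) v : lform a (- v) = - lform a v.
Proof. by rewrite -scaleN1r lformZ mulN1r. Qed.

(** Integration by parts: the derivative in y of [K s t (x - y) * f y] has integral zero, and the
    reflection in the argument of the kernel accounts for the sign. *)
Lemma conv_partial s t f i (B : R) : 0 < t -> measurable_fun setT f -> (forall x, `|f x| <= B) ->
  (forall x, differentiable (f : _ -> R^o) x) -> (forall x, `|partial i f x| <= B) ->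
  Defs.conv (K (i :: s) t) f = Defs.conv (K s t) (partial i f).
Proof.
move=> t0 mf fB df dfB; apply/funext => x.
have B0 : 0 <= B by apply: le_trans (fB 0).
have mdf := measurable_partial i mf df.
have r1 : rap (fun y => K (i :: s) t (x - y) * f y).
  by apply: rap_bounded => //; [apply: rap_reflect; exact: rap_K|exists B].
have r2 : rap (fun y => K s t (x - y) * partial i f y).
  by apply: rap_bounded => //; [apply: rap_reflect; exact: rap_K|exists B].
have r0 : rap (fun y => K s t (x - y) * f y).
  by apply: rap_bounded => //; [apply: rap_reflect; exact: rap_K|exists B].
have r3 : rap (fun y => -1 * (K (i :: s) t (x - y) * f y) + K s t (x - y) * partial i f y).
  by apply: rapD => //; exact: rapZ.
have := @rap_integral_derivative _ _ _ _ (delta_mx 0 i) r0 r3.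
rewrite RintegralD//; last 2 first.
- by apply: rap_integrable; exact: rapZ.
- exact: rap_integrable.
rewrite RintegralZl//; last exact: rap_integrable.
move=> H; apply/eqP; rewrite eq_sym -subr_eq0 addrC -mulN1r; apply/eqP; apply: H.
move=> y r.
have d1 : is_derive r 1 (fun r => f (y + r *: delta_mx 0 i) : R^o) (partial i f (y + r *: delta_mx 0 i)).
  by have := is_derive_line (df (y + r *: delta_mx 0 i)); rewrite lform_delta.
have d2 : is_derive r 1 (fun r => K s t (x - (y + r *: delta_mx 0 i)) : R^o) (- K (i :: s) t (x - (y + r *: delta_mx 0 i))).
  have [dK pK] := K_diff s (x - (y + r *: delta_mx 0 i)) t0.
  have E (r' : R) : x - (y + r' *: delta_mx 0 i) = (x - y) + r' *: (- delta_mx 0 i).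
    by rewrite opprD addrA scalerN.
  have := @is_derive_line _ _ (K s t) (x - y) (- delta_mx 0 i) r; rewrite -E => /(_ dK).
  rewrite lformN lform_delta pK.
  by under [X in is_derive _ _ X _ -> _]eq_fun do rewrite -E.
apply: is_derive_eq; rewrite /GRing.scale/=; ring.
Qed.

Lemma conv_reflect f k x : rap f -> conv_defined k ->
  mu.-integrable setT (EFin \o (fun y => f y * k (x - y))) /\
  Defs.conv f k x = \int[mu]_y (f y * k (x - y)).
Proof.
move=> rf kd; have [h1 h2] := Rintegral_reflect x (conv_dominated x rf kd).
split; first by under eq_fun do rewrite -[X in f X](subKr x).
by rewrite /Defs.conv -h2; apply: eq_Rintegral => y _; rewrite subKr.
Qed.

Lemma integral_K_cons i s t : 0 < t -> \int[mu]_y K (i :: s) t y = 0.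
Proof.
move=> t0; apply: (@rap_integral_derivative _ _ (K s t) _ (delta_mx 0 i)); [exact: rap_K|exact: rap_K|].
move=> x r; have [dK pK] := K_diff s (x + r *: delta_mx 0 i) t0.
by have := is_derive_line dK; rewrite lform_delta pK.
Qed.

Lemma norm_powR_le (al : R) v : 0 <= al <= 1 -> `|v| `^ al <= 1 * expR (1 * enorm v).
Proof.
move=> /andP[al0 al1]; rewrite !mul1r; apply: (@le_trans _ _ (1 + enorm v)); last exact: expR_ge1Dx.
apply: (@le_trans _ _ (1 + `|v|)); last by rewrite lerD2l norm_le_enorm.
have [v1|v1] := lerP `|v| 1.
  apply: ler_wpDr => //; have := @ge0_ler_powR R al al0 `|v| 1.
  by rewrite powR1; apply; rewrite ?nnegrE.
apply: ler_wpDl => //; rewrite -[leRHS]powRr1//; apply: ler_powR => //; exact: ltW.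
Qed.

Lemma measurable_norm_rV : measurable_fun setT (fun y : 'rV[R]_d => `|y|).
Proof.
rewrite (_ : (fun y => _) = fun y : 'rV[R]_d => \big[Order.max/0]_(i <- index_enum 'I_d) `|y 0 i|); last first.
  apply/funext => y; rewrite [LHS]mx_normrE; apply/le_anti/andP; split.
    apply: bigmax_le => [|[a i] _ /=]; first by rewrite bigmax_ge_id.
    by rewrite (ord1 a); exact: (@le_bigmax_cond _ _ _ _ i _ (fun i => `|y 0 i|)).
  apply: bigmax_le => [|i _]; first by rewrite bigmax_ge_id.
  exact: (@le_bigmax_cond _ _ _ _ (0, i) _ (fun ij : 'I_1 * 'I_d => `|y ij.1 ij.2|)).
elim: (index_enum 'I_d) => [|i r IH].
  by rewrite (_ : (fun y => _) = cst 0)//; apply/funext => y; rewrite big_nil.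
rewrite (_ : (fun y => _) = fun y : 'rV[R]_d => Order.max `|y 0 i| (\big[Order.max/0]_(i <- r) `|y 0 i|)); last first.
  by apply/funext => y; rewrite big_cons.
by apply: measurable_maxr => //; apply: measurableT_comp => //; exact: measurable_coord.
Qed.

Definition Kmoment s (al : R) : R := \int[mu]_y (`|K s 1 y| * `|y| `^ al).

Lemma rap_Kmoment s t (al : R) : 0 < t -> 0 <= al <= 1 -> rap (fun y : 'rV[R]_d => `|K s t y| * `|y| `^ al).
Proof.
move=> t0 al01; apply: rapM.
- by apply: rap_abs; exact: rap_K.
- by apply: (measurableT_comp (measurable_powR al)); exact: measurable_norm_rV.
- by exists 1, 1; split => // x; rewrite ger0_norm ?powR_ge0//; exact: norm_powR_le.
Qed.

(** The Jacobian r^d cancels the factor r^-d of [K_scale], which is why the dimension does not enter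
    the smoothing exponents. *)
Lemma Kmoment_scale s (al r : R) : 0 < r -> 0 <= al <= 1 ->
  \int[mu]_y (`|K s (r ^+ 4) y| * `|y| `^ al) = r ^- size s * r `^ al * Kmoment s al.
Proof.
move=> r0 al01; have rn0 : r^-1 != 0 by rewrite invr_eq0 gt_eqF.
have Hi := rap_integrable (rap_Kmoment s ltr01 al01).
have [h1 h2] := integrable_affine 0 rn0 Hi.
have rE : `|r^-1| ^- d = r ^+ d by rewrite gtr0_norm ?invr_gt0// exprVn invrK.
transitivity (r ^- (d + size s) * r `^ al * \int[mu]_y (`|K s 1 (r^-1 *: y + 0)| * `|r^-1 *: y + 0| `^ al)).
  rewrite -RintegralZl//; apply: eq_Rintegral => y _.
  rewrite K_scale// normrM ger0_norm ?invr_ge0 ?exprn_ge0 ?(ltW r0)// !addr0.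
  rewrite [`|r^-1 *: y|]normrZ [`|r^-1|]gtr0_norm ?invr_gt0// powRM ?invr_ge0 ?(ltW r0)//.
  have -> : r^-1 `^ al = (r `^ al)^-1 by rewrite -powR_inv1 ?(ltW r0)// -powRrM mulN1r powRN.
  field; rewrite !gt_eqF ?powR_gt0 ?exprn_gt0//.
rewrite h2 rE exprD /Kmoment; field; rewrite !gt_eqF ?exprn_gt0//.
Qed.

(* The integral of K (i :: s) t vanishes, so f may be replaced by f - f x. *)
Lemma conv_holder_bound i s t f (al B : R) x : 0 < t -> 0 <= al <= 1 -> 0 <= B -> conv_defined f ->
  (forall y v, `|f (y + v) - f y| <= B * `|v| `^ al) ->
  `|Defs.conv (K (i :: s) t) f x| <= B * Kmoment (i :: s) al * t `^ ((al - (size s).+1%:R) / 4).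
Proof.
move=> t0 al01 B0 fd fH.
have rK := rap_K (i :: s) t0 : rap (K (i :: s) t : 'rV[R]_d -> R).
have [h1 ->] := conv_reflect x rK fd.
have -> : \int[mu]_y (K (i :: s) t y * f (x - y)) = \int[mu]_y (K (i :: s) t y * (f (x - y) - f x)).
  under [RHS]eq_Rintegral do rewrite mulrBr.
  have iK := rap_integrable rK.
  have hZ : mu.-integrable setT (EFin \o (fun y => K (i :: s) t y * f x)).
    by have := integrable_Zl (f x) measurableT iK; under eq_fun do rewrite mulrC.
  by rewrite RintegralB// RintegralZr// integral_K_cons// mul0r subr0.
have iD : mu.-integrable setT (EFin \o (fun y => K (i :: s) t y * (f (x - y) - f x))).
  apply: rap_integrable; apply: rapM => //.
    apply: measurable_funB => //; apply: measurableT_comp; first exact: conv_defined_measurable.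
    have -> : (fun y => x - y) = (fun y => -1 *: y + x) by apply/funext => y; rewrite scaleN1r addrC.
    exact: measurable_affine_rV.
  exists B, 1; split => // y; apply: le_trans (fH _ _) _; apply: ler_wpM2l => //.
  by rewrite normrN -[leRHS]mul1r; exact: norm_powR_le.
apply: le_trans (le_normr_Rintegral measurableT iD) _.
pose r := t `^ (4^-1).
have r0 : 0 < r by rewrite powR_gt0.
have r4 : r ^+ 4 = t by rewrite -powR_mulrn ?powR_ge0// -powRrM mulVf ?pnatr_eq0// powRr1// ltW.
apply: (@le_trans _ _ (\int[mu]_y (B * (`|K (i :: s) t y| * `|y| `^ al)))).
  apply: le_Rintegral => //.
  - exact: integrable_norm.
  - by apply: integrable_Zl => //; apply: rap_integrable; exact: rap_Kmoment.
  - move=> y _; rewrite normrM mulrCA; apply: ler_wpM2l => //.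
    by apply: le_trans (fH _ _) _; rewrite normrN.
rewrite RintegralZl//; last by apply: rap_integrable; exact: rap_Kmoment.
rewrite -{1}r4 Kmoment_scale// -[leRHS]mulrA; apply: ler_wpM2l => //.
rewrite mulrC; apply: ler_wpM2l; first by apply: Rintegral_ge0 => y _; rewrite mulr_ge0 ?powR_ge0.
rewrite le_eqVlt; apply/orP; left; apply/eqP.
rewrite -powR_invn ?(ltW r0)// -powRD; last by rewrite (gt_eqF r0) implybT.
by rewrite /r -powRrM; congr (_ `^ _); rewrite addrC mulrC.
Qed.

(* All partial derivatives of f up to order n are bounded and al-Hoelder, with
   constant B; al = 0 adds nothing. *)
Fixpoint Ck (al B : R) (n : nat) f : Prop :=
  [/\ measurable_fun setT f, forall x, `|f x| <= B & forall x v, `|f (x + v) - f x| <= B * `|v| `^ al] /\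
  (if n is n'.+1 then (forall x, differentiable (f : _ -> R^o) x) /\ forall i, Ck al B n' (partial i f) else True).

Lemma Ck_base al B n f : Ck al B n f -> Ck al B 0 f.
Proof. by case: n => // n [h _]. Qed.

(* The derivatives in s1 fall on f, the others remain on the kernel. *)
Lemma Ck_conv_bound al B n f i s1 s2 t x : 0 < t -> 0 <= al <= 1 -> (size s1 <= n)%N -> Ck al B n f ->
  `|Defs.conv (K (s1 ++ i :: s2) t) f x| <= B * Kmoment (i :: s2) al * t `^ ((al - (size s2).+1%:R) / 4).
Proof.
move=> t0 al01; elim: s1 n f => [|j s1 IH] n f sn Cf.
  have [[mf fB fH] _] := Ck_base Cf.
  have B0 : 0 <= B by apply: le_trans (fB 0).
  apply: conv_holder_bound => //.
  by apply: (@conv_definedP _ B 0) => // y; rewrite mul0r expR0 mulr1.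
case: n sn Cf => // n sn [[mf fB fH] [df Cdf]].
have [[_ dfB _] _] := Ck_base (Cdf j).
rewrite (_ : (j :: s1) ++ i :: s2 = j :: (s1 ++ i :: s2))// (conv_partial _ t0 mf fB df dfB).
by apply: (IH n) => //; exact: Cdf.
Qed.

End convolution.

Lemma trig_add4 (R : realType) k (a : R) : trig k.+4 a = trig k a.
Proof.
rewrite /trig (_ : a + k.+4%:R * (pi / 2) = a + k%:R * (pi / 2) + pi *+ 2).
  by rewrite cosD2pi.
by rewrite mulr2n -[k.+4]addn4 natrD; field.
Qed.

(** * The semigroup property *)

Section semigroup.
Context {R : realType} {d : nat}.
Local Notation mu := (@lebesgue_rV R d).
Implicit Types (x y v e xi zt : 'rV[R]_d) (f g k : 'rV[R]_d -> R) (t b r : R) (s : seq 'I_d) (i j : 'I_d).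

Lemma dot_line xi i r :
  dot (xi + r *: delta_mx 0 i) (xi + r *: delta_mx 0 i) = dot xi xi + 2 * r * xi 0 i + r * r.
Proof.
rewrite dotDl !dotDr dotZl dotZl ![dot _ (r *: _)]dotC !dotZl dot_delta [dot (delta_mx _ _) xi]dotC dot_delta.
by rewrite mxE !eqxx /=; ring.
Qed.

Lemma dot_lineR x xi i r : dot x (xi + r *: delta_mx 0 i) = dot x xi + r * x 0 i.
Proof. by rewrite dotDr [dot _ (r *: _)]dotC dotZl [dot (delta_mx _ _) x]dotC dot_delta. Qed.

Lemma coord_line xi i r : (xi + r *: delta_mx 0 i) 0 i = xi 0 i + r.
Proof. by rewrite !mxE !eqxx mulr1. Qed.

(* The Fourier image of grad exp (- t |xi|^4) = - 4 t |xi|^2 xi exp (- t |xi|^4). *)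
Lemma coord_mul_K0 t x i : 0 < t ->
  x 0 i * K [::] t x = 4 * t * \sum_(j <- index_enum 'I_d) K [:: i; j; j] t x.
Proof.
move=> t0.
pose A (j : 'I_d) xi : R := mono [:: i; j; j] xi * gk t xi * trig 3 (dot x xi).
pose f xi : R := mono [::] xi * gk t xi * trig 3 (dot x xi).
pose f4 xi : R := mono [::] xi * gk t xi * trig 4 (dot x xi).
have rA j : rap (A j) by exact: rap_K_integrand0.
have rS : rap (fun xi => \sum_(j <- index_enum 'I_d) A j xi) by exact: rap_sum.
have r4 : rap f4 by exact: rap_K_integrand0.
have rf : rap f by exact: rap_K_integrand0.
have rf' : rap (fun xi => - (4 * t) * (\sum_(j <- index_enum 'I_d) A j xi) + x 0 i * f4 xi).
  by apply: rapD; exact: rapZ.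
have := @rap_integral_derivative _ _ _ _ (delta_mx 0 i) rf rf'.
rewrite RintegralD//; last 2 first.
- by apply: rap_integrable; exact: rapZ.
- by apply: rap_integrable; exact: rapZ.
rewrite !RintegralZl//; last 2 first.
- exact: rap_integrable.
- exact: rap_integrable.
have [_ ->] := @Rintegral_sum _ _ _ mu setT _ (index_enum 'I_d) A measurableT (fun j => rap_integrable (rA j)).
move=> H.
have {}H : - (4 * t) * (\sum_(j <- index_enum 'I_d) \int[mu]_w A j w) + x 0 i * \int[mu]_w f4 w = 0.
  apply: H => xi r.
  have SA xi' : \sum_(j <- index_enum 'I_d) A j xi' = xi' 0 i * dot xi' xi' * (gk t xi' * trig 3 (dot x xi')).
    rewrite /A /dot mulr_sumr mulr_suml; apply: eq_bigr => j _.
    by rewrite !mono_cons /mono big_nil; ring.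
  rewrite SA /f4 /f /mono big_nil !mul1r.
  have gE r' : gk t (xi + r' *: delta_mx 0 i) = expR (- t * ((dot xi xi + 2 * r' * xi 0 i + r' * r') * (dot xi xi + 2 * r' * xi 0 i + r' * r'))).
    by rewrite /gk enorm4 dot_line expr2.
  have fE : (fun r' : R => 1 * gk t (xi + r' *: delta_mx 0 i) * trig 3 (dot x (xi + r' *: delta_mx 0 i))) =
     fun r' => expR (- t * ((dot xi xi + 2 * r' * xi 0 i + r' * r') * (dot xi xi + 2 * r' * xi 0 i + r' * r'))) *
        trig 3 (dot x xi + r' * x 0 i).
    by apply/funext => r'; rewrite gE dot_lineR mul1r.
  under [X in is_derive _ _ X]eq_fun do rewrite big_nil.
  rewrite fE gE dot_line dot_lineR coord_line.
  have d1 : is_derive r 1 (fun r' => trig 3 (dot x xi + r' * x 0 i) : R^o) (trig 4 (dot x xi + r * x 0 i) * x 0 i).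
    have d0 : is_derive r 1 (fun r' => dot x xi + r' * x 0 i : R^o) (x 0 i).
      by apply: is_derive_eq; rewrite /GRing.scale/=; ring.
    exact: is_derive_eq (is_derive1_comp (f := trig 3 : R -> R^o) (is_derive_trig _ _) d0) _.
  by apply: is_derive_eq; rewrite /GRing.scale/=; ring.
have -> : K [::] t x = @cK R d * \int[mu]_w f4 w.
  by rewrite /K; congr (_ * _); apply: eq_Rintegral => xi _; rewrite /f4 (trig_add4 0).
rewrite mulrCA; have -> : x 0 i * \int[mu]_w f4 w = 4 * t * (\sum_(j <- index_enum 'I_d) \int[mu]_w A j w) by lra.
rewrite mulrCA; congr (_ * _); rewrite mulr_sumr; apply: eq_bigr => j _; by [].
Qed.

Lemma rap_K_trig s t (n : nat) zt b : 0 < t -> rap (fun y => K s t y * trig n (dot zt y + b)).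
Proof.
move=> t0; apply: rap_bounded; first exact: rap_K.
  apply: measurableT_comp; first exact: measurable_trig.
  by apply: measurable_funD => //; exact: measurable_dot.
by exists 1; split => // y; exact: trig_le1.
Qed.

(** Integration by parts moves a derivative from the kernel to the cosine, which produces a
    frequency factor and a quarter turn of the phase. *)
Lemma integral_K_trig_cons i s t (n : nat) zt b : 0 < t ->
  \int[mu]_y (K (i :: s) t y * trig n (dot zt y + b)) = - zt 0 i * \int[mu]_y (K s t y * trig n.+1 (dot zt y + b)).
Proof.
move=> t0.
have r1 := rap_K_trig (i :: s) n zt b t0.
have r2 := rap_K_trig s n.+1 zt b t0.
have r0 := rap_K_trig s n zt b t0.
have r3 := rapD r1 (rapZ (zt 0 i) r2).
have := @rap_integral_derivative _ _ _ _ (delta_mx 0 i) r0 r3.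
rewrite RintegralD//; last 2 first.
- exact: rap_integrable.
- by apply: rap_integrable; exact: rapZ.
rewrite RintegralZl//; last exact: rap_integrable.
move=> H; apply/eqP; rewrite mulNr -subr_eq0 opprK; apply/eqP; apply: H => y r.
have [dK pK] := K_diff s (y + r *: delta_mx 0 i) t0.
have d1 : is_derive r 1 (fun r => K s t (y + r *: delta_mx 0 i) : R^o) (K (i :: s) t (y + r *: delta_mx 0 i)).
  by have := is_derive_line dK; rewrite lform_delta pK.
have d2 : is_derive r 1 (fun r => trig n (dot zt (y + r *: delta_mx 0 i) + b) : R^o) (trig n.+1 (dot zt (y + r *: delta_mx 0 i) + b) * zt 0 i).
  have d0 : is_derive r 1 (fun r => dot zt (y + r *: delta_mx 0 i) + b : R^o) (zt 0 i).
    under [X in is_derive _ _ X]eq_fun do rewrite dot_lineR.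
    by apply: is_derive_eq; rewrite /GRing.scale/=; ring.
  exact: is_derive_eq (is_derive1_comp (f := trig n : R -> R^o) (is_derive_trig _ _) d0) _.
by apply: is_derive_eq; rewrite /GRing.scale/=; ring.
Qed.

Lemma rap_bound f : rap f -> exists A, 0 <= A /\ forall x, `|f x| <= A.
Proof.
move=> [_ [C [c [C0 c0 HC]]]]; exists C; split => // y.
by apply: le_trans (HC y) _; rewrite ler_piMr// wt_le1// ltW.
Qed.

Lemma rap_coord_K s t i : 0 < t -> rap (fun y => y 0 i * K s t y).
Proof.
move=> t0; have := @rapM _ _ (K s t) (fun y => y 0 i) (rap_K s t0) (measurable_coordR i).
rewrite (_ : (fun x => K s t x * x 0 i) = fun y => y 0 i * K s t y); last by apply/funext => y; exact: mulrC.
apply.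
exists 1, 1; split => // x; rewrite !mul1r; apply: le_trans (coord_le_enorm _ _) _.
by apply: le_trans (expR_ge1Dx _); rewrite lerDr.
Qed.

Lemma rap_dot_K s t xi : 0 < t -> rap (fun y => dot xi y * K s t y).
Proof.
move=> t0; have := @rap_sum _ _ _ (index_enum 'I_d) (fun i y => xi 0 i * (y 0 i * K s t y)) (fun i => rapZ _ (rap_coord_K s i t0)).
by under eq_fun do (under eq_bigr do rewrite mulrA; rewrite -mulr_suml).
Qed.

(** Differentiating along the ray brings down xi.y; [coord_mul_K0] turns each y_i K into third
    derivatives of K, and three integrations by parts give - r^3 xi_i xi_j^2. The phase has then
    advanced by four quarter turns, so the equation closes up: psi' = - 4 t r^3 |xi|^4 psi. *)
Lemma is_derive_integral_K_trig t (n : nat) xi b r : 0 < t ->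
  is_derive r 1 (fun r => \int[mu]_y (K [::] t y * trig n (dot (r *: xi) y + b)) : R^o)
    (- (4 * t) * r ^+ 3 * dot xi xi ^+ 2 * \int[mu]_y (K [::] t y * trig n (dot (r *: xi) y + b))).
Proof.
move=> t0.
pose df r y := (dot xi y * K [::] t y) * trig n.+1 (dot (r *: xi) y + b).
have -> : - (4 * t) * r ^+ 3 * dot xi xi ^+ 2 * \int[mu]_y (K [::] t y * trig n (dot (r *: xi) y + b)) = \int[mu]_y df r y.
  pose T i j y := (K [:: i; j; j] t y * trig n.+1 (dot (r *: xi) y + b)).
  have iT i j : mu.-integrable setT (EFin \o T i j) by apply: rap_integrable; exact: rap_K_trig.
  pose A i y := (4 * t * xi 0 i) * \sum_(j <- index_enum 'I_d) T i j y.
  have iA i : mu.-integrable setT (EFin \o A i).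
    apply: integrable_Zl => //.
    by have [] := @Rintegral_sum _ _ _ mu setT _ (index_enum 'I_d) (T i) measurableT (iT i).
  transitivity (\int[mu]_y \sum_(i <- index_enum 'I_d) A i y); last first.
    apply: eq_Rintegral => y _; rewrite /df {1}/dot !mulr_suml; apply: eq_bigr => i _.
    by rewrite -[xi 0 i * _ * _]mulrA coord_mul_K0// /A -mulr_suml; ring.
  have [_ ->] := @Rintegral_sum _ _ _ mu setT _ (index_enum 'I_d) A measurableT iA.
  rewrite expr2 {1}/dot !(mulr_sumr, mulr_suml); apply: eq_bigr => i _.
  have [iS iE] := @Rintegral_sum _ _ _ mu setT _ (index_enum 'I_d) (T i) measurableT (iT i).
  rewrite /A RintegralZl// iE /dot !(mulr_sumr, mulr_suml); apply: eq_bigr => j _.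
  rewrite /T; do 3 (rewrite integral_K_trig_cons; last exact: t0).
  rewrite ![(r *: xi) _ _]mxE.
  under [X in _ = _ * (_ * (_ * (_ * X)))]eq_Rintegral do rewrite trig_add4.
  ring.
apply: (@is_derive_Rintegral R _ _ mu (fun r y => K [::] t y * trig n (dot (r *: xi) y + b)) df (fun y => `|dot xi y * K [::] t y|)).
- by move=> r'; apply: rap_integrable; exact: rap_K_trig.
- move=> r' y; have d0 : is_derive r' 1 (fun r => dot (r *: xi) y + b : R^o) (dot xi y).
    under [X in is_derive _ _ X]eq_fun do rewrite dotZl.
    by apply: is_derive_eq; rewrite /GRing.scale/=; ring.
  have d2 : is_derive r' 1 (fun r => trig n (dot (r *: xi) y + b) : R^o) (trig n.+1 (dot (r' *: xi) y + b) * dot xi y).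
    exact: is_derive_eq (is_derive1_comp (f := trig n : R -> R^o) (is_derive_trig _ _) d0) _.
  by apply: is_derive_eq; rewrite /df /GRing.scale/=; ring.
- by apply: rap_integrable; apply: rap_abs; exact: rap_dot_K.
- by move=> r' y _; rewrite /df normrM ler_piMr// trig_le1.
Qed.

(* Its value is 1 by Fourier inversion, but only mass_neq0 is needed. *)
Definition mass t : R := \int[mu]_y K [::] t y.

(** With the integrating factor exp (t r^4 |xi|^4), the solution along the ray is constant between r
    = 0, where it gives the mass, and r = 1. *)
Lemma integral_K_trig t (n : nat) xi b : 0 < t ->
  \int[mu]_y (K [::] t y * trig n (dot xi y + b)) = mass t * gk t xi * trig n b.
Proof.
move=> t0.
pose psi (r : R) := \int[mu]_y (K [::] t y * trig n (dot (r *: xi) y + b)).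
pose Q (r : R) := psi r * expR (t * r ^+ 4 * dot xi xi ^+ 2).
have Q01 : Q 1 = Q 0.
  apply: is_derive_0_is_cst => r.
  have d1 : is_derive r 1 (psi : R -> R^o) (- (4 * t) * r ^+ 3 * dot xi xi ^+ 2 * psi r) by exact: is_derive_integral_K_trig.
  by apply: is_derive_eq; rewrite /GRing.scale/=; ring.
have psi0 : psi 0 = mass t * trig n b.
  rewrite /psi /mass -RintegralZr//; last by apply: rap_integrable; exact: rap_K.
  by apply: eq_Rintegral => y _; rewrite dotZl mul0r add0r.
have -> : \int[mu]_y (K [::] t y * trig n (dot xi y + b)) = psi 1 by rewrite /psi scale1r.
move: Q01; rewrite /Q psi0 expr1n mulr1 expr0n/= mulr0 mul0r expR0 mulr1 => H.
rewrite mulrAC -H -mulrA /gk enorm4 -expRD.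
by rewrite (_ : _ + _ = 0) ?expR0 ?mulr1//; ring.
Qed.

(** Insert the frequency integral for the first kernel and exchange: the inner integral is then the
    transform of the second kernel at - xi with phase x.xi, and the two exponentials multiply. *)
Lemma conv_K_K s t tau x : 0 < t -> 0 < tau ->
  Defs.conv (K s t) (K [::] tau) x = mass tau * K s (t + tau) x.
Proof.
move=> t0 tau0.
pose f (p : 'rV[R]_d * 'rV[R]_d) := mono s p.2 * gk t p.2 * trig (size s) (dot (x - p.1) p.2) * K [::] tau p.1.
have mtr : measurable_fun setT (fun p : 'rV[R]_d * 'rV[R]_d => dot (x - p.1) p.2).
  apply: measurable_sum => i; apply: measurable_funM.
    apply: (measurableT_comp (measurable_coordR i)).
    apply: (measurableT_comp (f := fun y => x - y)); last exact: measurable_fst.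
    have -> : (fun y => x - y) = (fun y => -1 *: y + x) by apply/funext => y; rewrite scaleN1r addrC.
    exact: measurable_affine_rV.
  by apply: (measurableT_comp (measurable_coordR i)); exact: measurable_snd.
have mf : measurable_fun setT f.
  apply: measurable_funM; last first.
    by apply: measurable_K; [exact: measurable_cst|exact: measurable_fst].
  apply: measurable_funM.
    apply: measurable_funM; first exact: (measurableT_comp (measurable_mono s) measurable_snd).
    exact: (measurableT_comp (measurable_gk t) measurable_snd).
  exact: (measurableT_comp (measurable_trig _) mtr).
have rg := rap_mono_gk s t0 : rap (fun xi : 'rV[R]_d => mono s xi * gk t xi).
have rK := rap_K [::] tau0 : rap (K [::] tau : 'rV[R]_d -> R).
have fub := @Rfubini_dom _ _ _ _ _ mu mu f (fun y => `|K [::] tau y|) (fun xi => `|mono s xi * gk t xi|) mf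
  (rap_integrable (rap_abs rK)) (rap_integrable (rap_abs rg)) _.
transitivity (@cK R d * \int[mu]_y \int[mu]_xi f (y, xi)).
  have E y : \int[mu]_xi f (y, xi) = (@cK R d)^-1 * (K s t (x - y) * K [::] tau y).
    rewrite [K s t (x - y)]/K mulrA mulKf; last exact: lt0r_neq0 cK_gt0.
    rewrite -RintegralZr; last 2 first.
    - exact: measurableT.
    - by apply: rap_integrable; exact: rap_K_integrand0.
    by [].
  transitivity (@cK R d * \int[mu]_y ((@cK R d)^-1 * (K s t (x - y) * K [::] tau y))); last first.
    by congr (_ * _); apply: eq_Rintegral => y _; rewrite E.
  rewrite RintegralZl; last 2 first.
  - exact: measurableT.
  - apply: rap_integrable; apply: rap_bounded; first by apply: rap_reflect; exact: rap_K.
      exact: rK.1.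
    exact: rap_bound.
  by rewrite mulVKf; last exact: lt0r_neq0 cK_gt0.
rewrite fub; last first.
  move=> y xi; rewrite /f/= [leLHS]normrM [leRHS]mulrC; apply: ler_wpM2r; first exact: normr_ge0.
  by rewrite [leLHS]normrM ler_piMr ?trig_le1// normr_ge0.
rewrite {1}/K mulrCA; congr (_ * _).
rewrite -[RHS]RintegralZl; last 2 first.
- exact: measurableT.
- by apply: rap_integrable; apply: rap_K_integrand0; exact: addr_gt0.
apply: eq_Rintegral => xi _.
transitivity (mono s xi * gk t xi * \int[mu]_y (K [::] tau y * trig (size s) (dot (- xi) y + dot x xi))).
  rewrite -[RHS]RintegralZl; last 2 first.
  - exact: measurableT.
  - by apply: rap_integrable; exact: rap_K_trig.
  apply: eq_Rintegral => y _; rewrite /f/= dotDl -[- y]scaleN1r dotZl -[- xi]scaleN1r dotZl [dot y xi]dotC.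
  by rewrite [-1 * _ + _]addrC; ring.
rewrite (integral_K_trig _ _ _ tau0).
have -> : gk tau (- xi) = gk tau xi by rewrite /gk enormN.
have -> : gk (t + tau) xi = gk t xi * gk tau xi by rewrite /gk -expRD; congr expR; ring.
ring.
Qed.

Lemma Rintegral_eq0_negligible f : mu.-integrable setT (EFin \o f) -> (forall x, 0 <= f x) -> \int[mu]_x f x = 0 ->
  mu.-negligible [set x | f x != 0].
Proof.
move=> fi f0 fI.
have mf : measurable_fun setT (EFin \o f) by exact: measurable_int fi.
have [+ _] := ae_eq_integral_abs mu measurableT mf.
have -> : (\int[mu]_x `|(EFin \o f) x| = 0)%E.
  rewrite -[RHS]/(0%:E) -fI /Rintegral fineK ?integrable_fin_num//.
  by apply: eq_integral => x _ /=; rewrite ger0_norm.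
move=> /(_ erefl); apply: negligibleS => x /= /eqP fx H; apply: fx.
by have [] := H I.
Qed.

Lemma setT_not_negligible : ~ mu.-negligible setT.
Proof. by move/(negligibleP _ measurableT) => H; have := @measure_rV_setT_gt0 R d; rewrite H ltxx. Qed.

Lemma K0_gt0 t : 0 < t -> 0 < K [::] t (0 : 'rV[R]_d).
Proof.
move=> t0; rewrite /K; apply: mulr_gt0; first exact: cK_gt0.
have -> : \int[mu]_xi (mono [::] xi * gk t xi * trig (size ([::] : seq 'I_d)) (dot 0 xi)) = \int[mu]_xi gk t xi.
  apply: eq_Rintegral => xi _; rewrite -[0 in X in dot X _](scale0r 0) dotZl mul0r /trig /mono big_nil /= mul0r addr0 cos0.
  by rewrite mulr1 mul1r.
have g0 (xi : 'rV[R]_d) : 0 <= gk t xi := ltW (gk_gt0 _ _).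
rewrite lt0r Rintegral_ge0// andbT; apply/negP => /eqP /(Rintegral_eq0_negligible (rap_integrable (rap_gk t0)) g0) H.
apply: setT_not_negligible; apply: negligibleS H => xi _ /=.
exact: lt0r_neq0 (gk_gt0 _ _).
Qed.

Lemma negligible_scale (A : set 'rV[R]_d) (a : R) : a != 0 -> mu.-negligible A -> mu.-negligible [set x | A (a *: x)].
Proof.
move=> a0 [B [mB B0 AB]].
have H := lebesgue_rV_affine 0 a0 mB.
exists [set x | B (a *: x + 0)]; split.
- rewrite -[X in measurable X]setTI; exact: (@measurable_affine_rV R d a 0 measurableT _ mB).
- have : ((`|a| ^+ d)%:E * pushforward mu (fun x => (a *: x + 0)%R) B = 0)%E by rewrite -H.
  move=> /eqP; rewrite mule_eq0 eqe expf_eq0 normr_eq0 (negbTE a0) andbF /= => /eqP.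
  by [].
- by move=> x /= /AB; rewrite addr0.
Qed.

(* If the mass vanished, then so would \int K^2 = conv K K 0, although K is even,
   continuous and positive at 0. *)
Lemma mass_neq0 t : 0 < t -> mass t != 0.
Proof.
move=> t0; apply/negP => /eqP m0.
have rK := rap_K [::] t0 : rap (K [::] t : 'rV[R]_d -> R).
have C0 := conv_K_K [::] 0 t0 t0; rewrite m0 mul0r in C0.
have rKK : rap (fun y => K [::] t y * K [::] t y : R).
  exact: rap_bounded rK rK.1 (rap_bound rK).
have KN y : K [::] t (0 - y) = K [::] t y.
  rewrite sub0r /K; congr (_ * _); apply: eq_Rintegral => xi _.
  by rewrite -scaleN1r dotZl mulN1r /trig /= mul0r !addr0 cosN.
have I0 : \int[mu]_y (K [::] t y * K [::] t y) = 0.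
  by rewrite -[RHS]C0 /Defs.conv; apply: eq_Rintegral => y _; rewrite KN.
have N1 := Rintegral_eq0_negligible (rap_integrable rKK) (fun y => sqr_ge0 (K [::] t y)) I0.
have dK (x : 'rV[R]_d) := (K_diff [::] x t0).1.
apply: setT_not_negligible.
(* By continuity at 0 every x has some x / (n + 1) at which the kernel is positive, so these dilates
   of a negligible set would cover the space. *)
pose F (n : nat) := [set x : 'rV[R]_d | [set x | K [::] t x * K [::] t x != 0] (n.+1%:R^-1 *: x)].
apply: (negligibleS (A := \bigcup_n F n)); last first.
  by apply: negligible_bigcup => n; apply: negligible_scale N1; rewrite invr_eq0 pnatr_eq0.
move=> x _.
have cK0 : {for (0 : 'rV[R]_d), continuous (K [::] t : 'rV[R]_d -> R^o)} by exact: differentiable_continuous.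
have c1 : (fun n : nat => n.+1%:R^-1 *: x) @ \oo --> (0 : 'rV[R]_d).
  rewrite -[X in _ --> X](scale0r x); apply: cvgZr_tmp; exact: (@cvg_harmonic R).
have c2 : (K [::] t \o (fun n : nat => n.+1%:R^-1 *: x)) @ \oo --> K [::] t (0 : 'rV[R]_d).
  by apply: continuous_cvg c1.
have [N _ HN] : \forall n \near \oo, 0 < (K [::] t \o (fun n : nat => n.+1%:R^-1 *: x)) n.
  by apply: cvgr_gt c2 _ _; exact: K0_gt0.
exists N => //; have /lt0r_neq0 H := HN N (leqnn N); exact: mulf_neq0.
Qed.

Lemma measurable_sub2 : measurable_fun setT (fun p : 'rV[R]_d * 'rV[R]_d => p.1 - p.2).
Proof.
apply: measurable_fun_rV => i; under eq_fun do rewrite mxE.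
apply: measurable_funD; first exact: (measurableT_comp (measurable_coord i) measurable_fst).
under eq_fun do rewrite mxE; apply: measurableT_comp => //.
exact: (measurableT_comp (measurable_coord i) measurable_snd).
Qed.

Lemma measurable_conv s t k : measurable_fun setT k -> measurable_fun setT (Defs.conv (K s t) k).
Proof.
move=> mk; apply: (@measurable_Rintegral _ _ _ _ _ mu (fun p : 'rV[R]_d * 'rV[R]_d => K s t (p.1 - p.2) * k p.2)).
apply: measurable_funM; last exact: (measurableT_comp mk measurable_snd).
by apply: measurable_K; [exact: measurable_cst|exact: measurable_sub2].
Qed.

Lemma conv_K_conv s t tau k x : 0 < t -> 0 < tau -> conv_defined k ->
  Defs.conv (K s t) (Defs.conv (K [::] tau) k) x = mass tau * Defs.conv (K s (t + tau)) k x.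
Proof.
move=> t0 tau0 kd; have mk := conv_defined_measurable kd.
have rs := rap_K s t0 : rap (K s t : 'rV[R]_d -> R).
have rK := rap_K [::] tau0 : rap (K [::] tau : 'rV[R]_d -> R).
have [_ [C1 [c1 [C10 c10 H1]]]] := rs.
have [_ [C2 [c2 [C20 c20 H2]]]] := rK.
pose c := Num.min c1 c2; have c0 : 0 < c by rewrite lt_min c10.
have cc1 : c <= c1 by rewrite ge_min lexx.
have cc2 : c <= c2 by rewrite ge_min lexx orbT.
pose f (p : 'rV[R]_d * 'rV[R]_d) := K s t (x - p.1) * (K [::] tau (p.1 - p.2) * k p.2).
have mxy : measurable_fun setT (fun y : 'rV[R]_d => x - y).
  have -> : (fun y => x - y) = (fun y => -1 *: y + x) by apply/funext => y; rewrite scaleN1r addrC.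
  exact: measurable_affine_rV.
have mf : measurable_fun setT f.
  apply: measurable_funM.
    by apply: measurable_K; [exact: measurable_cst|exact: (measurableT_comp mxy measurable_fst)].
  apply: measurable_funM; last exact: (measurableT_comp mk measurable_snd).
  by apply: measurable_K; [exact: measurable_cst|exact: measurable_sub2].
have c20' : 0 < c / 2 by rewrite divr_gt0.
have c80 : 0 < c / 2 / 4 by rewrite divr_gt0.
have c320 : 0 < c / 2 / 4 / 4 by rewrite divr_gt0.
(* Half of the decay in x - y is kept for the integral in y. The other half, joined to the decay in
   y - z, becomes decay in x - z at rate c / 8 and then in z at rate c / 32, at the price of a
   factor in x. *)
pose g y := (C1 * C2 * expR (c / 2 / 4 * pen x)) * wt (c / 2) (x - y).
pose h z := `|wt (c / 2 / 4 / 4) z * k z|.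
have rg : rap g.
  apply: rapZ; apply: (@rap_reflect _ _ (wt (c / 2))).
  by split; [exact: measurable_wt|exists 1, (c / 2); split => // y; rewrite mul1r (gtr0_norm (wt_gt0 _ _))].
have ih : mu.-integrable setT (EFin \o h) by apply: integrable_norm; exact: conv_defined_integrable.
have fgh y z : `|f (y, z)| <= g y * h z.
  rewrite /f /g /h/= [leLHS]normrM [X in _ * X <= _]normrM [`|wt _ z * _|]normrM (gtr0_norm (wt_gt0 _ z)) mulrA [leRHS]mulrA.
  apply: ler_wpM2r; first exact: normr_ge0.
  apply: (@le_trans _ _ ((C1 * wt c (x - y)) * (C2 * wt c (y - z)))).
    apply: ler_pM; [exact: normr_ge0|exact: normr_ge0| |].
      by apply: le_trans (H1 _) _; apply: ler_wpM2l => //; exact: wt_mono.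
    by apply: le_trans (H2 _) _; apply: ler_wpM2l => //; exact: wt_mono.
  have W : wt c (x - y) * wt c (y - z) <= expR (c / 2 / 4 * pen x) * wt (c / 2) (x - y) * wt (c / 2 / 4 / 4) z.
    rewrite [in X in X * _ <= _](_ : c = c / 2 + c / 2); last by rewrite -splitr.
    have aux (a b e w p : R) : 0 <= a -> b * p <= e * w -> a * b * p <= e * a * w.
      by move=> a0 /(ler_wpM2l a0); rewrite mulrA mulrCA mulrA.
    rewrite wtD; apply: aux; first exact: ltW (wt_gt0 _ _).
    apply: (@le_trans _ _ (wt (c / 2) (x - y) * wt (c / 2) (y - z))).
      by apply: ler_wpM2l; [exact: ltW (wt_gt0 _ _)|apply: wt_mono; rewrite ler_pdivrMr// ler_pMr// ler1n].
    apply: le_trans (wt_split _ _ (ltW c20')) _; rewrite addrA subrK.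
    exact: wt_sub (ltW c80).
  have aux (a b p q e w z' : R) : 0 <= a * b -> p * q <= e * w * z' -> a * p * (b * q) <= a * b * e * w * z'.
    by move=> ab0 /(ler_wpM2l ab0); rewrite mulrACA !mulrA.
  exact: aux (mulr_ge0 C10 C20) W.
have fub := Rfubini_dom mf (rap_integrable rg) ih fgh.
transitivity (\int[mu]_y \int[mu]_z f (y, z)).
  apply: eq_Rintegral => y _; rewrite -RintegralZl//; exact: conv_dominated.
rewrite fub /Defs.conv -[RHS]RintegralZl; last 2 first.
- exact: measurableT.
- by apply: conv_dominated; [apply: rap_K; exact: addr_gt0|exact: kd].
apply: eq_Rintegral => z _.
have rc : rap (fun y => K s t (x - y) * K [::] tau (y - z)).
  apply: rap_bounded; first exact: rap_reflect.
    have := @rap_affine _ _ _ 1 (- z) _ rK; rewrite eqxx => /(_ isT) [+ _].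
    by under eq_fun do rewrite scale1r.
  have [A [A0 HA]] := rap_bound rK; exists A; split => // y; exact: HA.
rewrite /f/=; under eq_Rintegral do rewrite mulrA.
rewrite RintegralZr//; last exact: rap_integrable.
rewrite [RHS]mulrA; congr (_ * _); rewrite -(conv_K_K _ _ t0 tau0).
have [_ <-] := Rintegral_translate z (rap_integrable rc).
by apply: eq_Rintegral => y _; rewrite addrK opprD addrA addrAC.
Qed.

(** A Lipschitz bound at the single time tau suffices for all later times: evolving from tau,
    [conv_holder_bound] with exponent 1 gives (t - tau)^(-|s|/4), which is largest at t = tau'. *)
Lemma conv_bounded s i tau tau' k (L : R) : 0 < tau -> tau < tau' -> conv_defined k -> 0 <= L ->
  (forall x v, `|Defs.conv (K [::] tau) k (x + v) - Defs.conv (K [::] tau) k x| <= L * `|v|) ->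
  exists B, 0 <= B /\ forall t x, tau' <= t -> `|Defs.conv (K (i :: s) t) k x| <= B.
Proof.
move=> tau0 ttau kd L0 uL; pose u := Defs.conv (K [::] tau) k.
have tt0 : 0 < tau' - tau by rewrite subr_gt0.
have ud : conv_defined u.
  apply: (@conv_definedP _ _ u (`|u 0| + L) 1) => //.
  - by rewrite addr_ge0.
  - by apply: measurable_conv; exact: conv_defined_measurable.
  move=> y; rewrite mul1r.
  apply: (@le_trans _ _ (`|u 0| + L * `|y|)).
    have := uL 0 y; rewrite add0r -/u => H; rewrite -[u y](subrK (u 0)) [leRHS]addrC.
    by apply: le_trans (ler_normD _ _) _; rewrite lerD2r.
  have e1 : 1 <= expR (enorm y) by rewrite -expR0 ler_expR enorm_ge0.
  rewrite mulrDl; apply: lerD; first by rewrite ler_peMr.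
  apply: ler_wpM2l => //; apply: le_trans (norm_le_enorm _) _; apply: le_trans (expR_ge1Dx _).
  by rewrite lerDr.
exists (`|(mass tau)^-1| * (L * `|Kmoment (i :: s) 1| * (tau' - tau) `^ ((1 - (size s).+1%:R) / 4))); split.
  by rewrite !mulr_ge0// powR_ge0.
move=> t x tt'; have m0 := mass_neq0 tau0.
have tt : 0 < t - tau by rewrite subr_gt0; exact: lt_le_trans tt'.
have -> : Defs.conv (K (i :: s) t) k x = (mass tau)^-1 * Defs.conv (K (i :: s) (t - tau)) u x.
  by rewrite /u conv_K_conv// subrK mulKf.
rewrite normrM; apply: ler_wpM2l => //.
apply: le_trans (@conv_holder_bound _ _ i s (t - tau) u 1 L x tt _ L0 ud _) _.
- by rewrite ler01 lexx.
- by move=> y v; rewrite powRr1.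
apply: ler_pM; rewrite ?powR_ge0//.
- by rewrite mulr_ge0//; apply: Rintegral_ge0 => y _; rewrite mulr_ge0 ?powR_ge0.
- by apply: ler_wpM2l => //; exact: ler_norm.
have -> : (1 - (size s).+1%:R) / 4 = - ((size s)%:R / 4) :> R by rewrite -natr1; field.
rewrite !powRN lef_pV2 ?posrE ?powR_gt0//.
by apply: ge0_ler_powR; rewrite ?nnegrE ?divr_ge0 ?(ltW tt0) ?(ltW tt)// lerD2r.
Qed.

End semigroup.

(** * Time integrals and Hoelder classes *)

Section time_integrals.
Context {R : realType}.
Local Notation leb := (@lebesgue_measure R).
Implicit Types (f F : R -> R) (a b C e t T : R).

(* An improper integral: f may blow up at both ends, F stays bounded. *)
Lemma integrable_primitive f F a b C : a < b -> measurable_fun `]a, b[ f ->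
  (forall x, a < x < b -> [/\ 0 <= f x, {for x, continuous f}, is_derive x 1 (F : R -> R^o) (f x) & `|F x| <= C]) ->
  leb.-integrable `]a, b[ (EFin \o f) /\ \int[leb]_(x in `]a, b[) f x <= 2 * C.
Proof.
(* The 3 ensures e n <= (b - a) / 3, so that already the first of the exhausting intervals is
   nondegenerate. *)
move=> ab mf H; pose e (n : nat) : R := (b - a) / n.+3%:R.
have ba0 : 0 < b - a by rewrite subr_gt0.
have e0 n : 0 < e n by rewrite divr_gt0.
have e3 n : e n <= (b - a) / 3.
  by rewrite ler_pM2l// lef_pV2 ?posrE ?ltr0n// ler_nat.
pose A n := [set` `[a + e n, b - e n]] : set R.
have Asub n x : A n x -> a < x < b.
  by rewrite /A/= in_itv/= => /andP[x1 x2]; have := e0 n; lra.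
have abn n : a + e n < b - e n by have := e3 n; lra.
have AU : \bigcup_n A n = [set` `]a, b[].
  apply/seteqP; split => x /=; first by move=> [n _ /Asub]; rewrite in_itv.
  rewrite in_itv/= => /andP[x1 x2].
  pose m := Num.min (x - a) (b - x); have m0 : 0 < m by rewrite lt_min !subr_gt0 x1.
  exists (Num.truncn ((b - a) / m)) => //; rewrite /A/= in_itv/=.
  have : e (Num.truncn ((b - a) / m)) <= m.
    rewrite /e ler_pdivrMr// mulrC -ler_pdivrMr//.
    by apply: le_trans (ltW (truncnS_gt _)) _; rewrite ler_nat; do 2 apply: leqW.
  by rewrite le_min => /andP[h1 h2]; apply/andP; split; lra.
have In n : (\int[leb]_(x in A n) (f x)%:E = (F (b - e n))%:E - (F (a + e n))%:E)%E.
  have Hc (x : R) : a < x < b -> {for x, continuous F}.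
    by move=> /H[_ _ dF _]; apply/differentiable_continuous/derivable1_diffP.
  apply: continuous_FTC2 => //.
  - apply: continuous_in_subspaceT => x; rewrite inE => Ax; by have [] := H x (Asub n x Ax).
  - split.
    + move=> x; rewrite in_itv/= => /andP[x1 x2].
      have /H[_ _ dF _] : a < x < b by have := e0 n; lra.
      exact: ex_derive.
    + by apply: cvg_at_right_filter; apply: Hc; have := e0 n; have := abn n; lra.
    + by apply: cvg_at_left_filter; apply: Hc; have := e0 n; have := abn n; lra.
  - move=> x; rewrite in_itv/= => /andP[x1 x2].
    have /H[_ _ dF _] : a < x < b by have := e0 n; lra.
    by rewrite derive1E; exact: derive_val.
have Bn n : (\int[leb]_(x in A n) (f x)%:E <= (2 * C)%:E)%E.
  rewrite In -EFinB lee_fin.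
  have /H[_ _ _ h1] : a < a + e n < b by have := e0 n; have := abn n; lra.
  have /H[_ _ _ h2] : a < b - e n < b by have := e0 n; have := abn n; lra.
  by move: h1 h2; rewrite !ler_norml; lra.
have mA n : measurable (A n : set (measurableTypeR R)) by exact: measurable_itv.
have IB : (\int[leb]_(x in `]a, b[) (f x)%:E <= (2 * C)%:E)%E.
  have ndA : nondecreasing_seq A.
    move=> n m nm; apply/subsetPset => x; rewrite /A/= !in_itv/= => /andP[x1 x2].
    have : e m <= e n by rewrite ler_pM2l// lef_pV2 ?posrE ?ltr0n// ler_nat.
    by move=> h; apply/andP; split; lra.
  have mfA n : measurable_fun (A n) (EFin \o f).
    apply/measurable_EFinP; apply: measurable_funS mf => //.
    by move=> x /Asub; rewrite /= in_itv.
  have fA0 n x : A n x -> (0 <= (EFin \o f) x)%E.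
    by move=> /Asub /H[f0 _ _ _]; rewrite lee_fin.
  have := @ge0_nondecreasing_set_cvg_integral _ (measurableTypeR R) R A (EFin \o f) leb ndA mA mfA fA0.
  by rewrite AU; apply: cvge_le; exact: nearW.
have f0 x : `]a, b[%classic x -> 0 <= f x.
  by rewrite /= in_itv/= => /H[].
have Ii : leb.-integrable `]a, b[ (EFin \o f).
  apply/integrableP; split; first exact/measurable_EFinP.
  apply: le_lt_trans (ltry (2 * C)); apply: le_trans IB; rewrite le_eqVlt; apply/orP; left; apply/eqP.
  by apply: eq_integral => x; rewrite inE => Dx /=; rewrite ger0_norm// f0.
split => //; rewrite /Rintegral -lee_fin fineK//.
exact: integrable_fin_num.
Qed.

Lemma integrable_powR_itv e t T : e < 1 -> 0 < t <= T ->
  [/\ leb.-integrable `]0, t[ (EFin \o (fun s => s `^ (- e))),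
      leb.-integrable `]0, t[ (EFin \o (fun s => (t - s) `^ (- e))),
      \int[leb]_(s in `]0, t[) s `^ (- e) <= 2 * (T `^ (1 - e) / (1 - e))
    & \int[leb]_(s in `]0, t[) (t - s) `^ (- e) <= 2 * (T `^ (1 - e) / (1 - e)) ].
Proof.
move=> e1 /andP[t0 tT].
have e10 : 0 < 1 - e by rewrite subr_gt0.
pose F (s : R) := s `^ (1 - e) / (1 - e).
have dP (x : R) : 0 < x -> is_derive x 1 (F : R -> R^o) (x `^ (- e)).
  move=> x0; rewrite /F.
  have H := is_derive1_powR (1 - e) x0.
  rewrite (_ : (fun s : R => _) = fun s => (1 - e)^-1 *: (s `^ (1 - e) : R^o)); last first.
    by apply/funext => s; rewrite /GRing.scale/= mulrC.
  apply: is_derive_eq; rewrite /GRing.scale/= mulKf ?gt_eqF//.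
  by congr (_ `^ _); ring.
have cP (x : R) : 0 < x -> {for x, continuous (fun s : R => s `^ (- e))}.
  move=> x0; apply/differentiable_continuous/derivable1_diffP.
  have H := is_derive1_powR (- e) x0; exact: ex_derive.
have FT (x : R) : 0 < x -> x <= T -> `|F x| <= T `^ (1 - e) / (1 - e).
  move=> x0 xT; rewrite ger0_norm ?divr_ge0 ?powR_ge0 ?(ltW e10)//.
  rewrite ler_pM2r ?invr_gt0//.
  by apply: ge0_ler_powR; rewrite ?nnegrE ?(ltW e10) ?(ltW x0)//; exact: le_trans (ltW x0) xT.
have [h1 h2] : leb.-integrable `]0, t[ (EFin \o (fun s => s `^ (- e))) /\
    \int[leb]_(s in `]0, t[) s `^ (- e) <= 2 * (T `^ (1 - e) / (1 - e)).
  apply: (@integrable_primitive _ F) => //.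
    by apply: measurable_funTS; exact: measurable_powR.
  move=> x /andP[x0 xt]; split; [exact: powR_ge0|exact: cP|exact: dP|].
  by apply: FT => //; exact: le_trans (ltW xt) tT.
have [h3 h4] : leb.-integrable `]0, t[ (EFin \o (fun s => (t - s) `^ (- e))) /\
    \int[leb]_(s in `]0, t[) (t - s) `^ (- e) <= 2 * (T `^ (1 - e) / (1 - e)).
  apply: (@integrable_primitive _ (fun s => - F (t - s))) => //.
    apply: measurable_funTS; apply: (measurableT_comp (measurable_powR _)).
    exact: measurable_funB.
  move=> x /andP[x0 xt]; have tx0 : 0 < t - x by rewrite subr_gt0.
  have d0 : is_derive x 1 (fun s => t - s : R) (-1 : R).
    by have H := is_deriveB (is_derive_cst (t : R^o) x (1 : R^o)) (is_derive_id x (1 : R^o)); rewrite sub0r in H.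
  split; [exact: powR_ge0| | |].
  - apply: (@continuous_comp _ _ _ (fun s => t - s) (fun s : R => s `^ (- e))); last exact: cP.
    by apply/differentiable_continuous/derivable1_diffP; exact: ex_derive.
  - have d1 := is_derive1_comp (f := F : R -> R^o) (g := fun s : R => t - s) (dP _ tx0) d0.
    have -> : (t - x) `^ (- e) = - ((t - x) `^ (- e) * -1) by rewrite mulrN1 opprK.
    exact: is_deriveN d1.
  - by rewrite normrN; apply: FT => //; apply: le_trans tT; rewrite gerBl ltW.
by split.
Qed.

End time_integrals.

Section words.
Context {R : realType} {d : nat}.
Implicit Types (s : seq 'I_d).

(** Finitely many letters make finitely many words of length at most n, so constants chosen word by
    word become uniform. *)
Lemma bounded_words (B : seq 'I_d -> R) (n : nat) : exists C, 0 <= C /\ forall s, (size s <= n)%N -> B s <= C.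
Proof.
elim: n B => [|n IH] B.
  by exists `|B [::]|; split => // -[] // _; exact: ler_norm.
have /choice[C HC] : forall i, exists C, 0 <= C /\ forall s, (size s <= n)%N -> B (i :: s) <= C.
  by move=> i; exact: IH.
exists (`|B [::]| + \sum_i C i); split.
  by rewrite addr_ge0// sumr_ge0// => i _; have [] := HC i.
move=> [|i s] ss.
  by apply: le_trans (ler_norm _) _; rewrite lerDl sumr_ge0// => i _; have [] := HC i.
apply: le_trans ((HC i).2 s ss) _; rewrite (bigD1 i)//= addrCA lerDl addr_ge0//.
by rewrite sumr_ge0// => j _; have [] := HC j.
Qed.

End words.

(** * Sums, products and changes of exponent in the classes [Ck] *)

Section Ck_algebra.
Context {R : realType} {d : nat}.
Local Notation mu := (@lebesgue_rV R d).
Implicit Types (x y v : 'rV[R]_d) (f g k : 'rV[R]_d -> R) (B al : R) (n : nat) (i : 'I_d) (s : seq 'I_d).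

Lemma CkS al B n f : Ck al B n.+1 f -> Ck al B n f.
Proof.
elim: n f => [|n IH] f; first by move=> [h _].
by move=> [h [df Cf]]; split => //; split => // i; apply: IH; exact: Cf.
Qed.

Lemma Ck_mono al B B' n f : B <= B' -> Ck al B n f -> Ck al B' n f.
Proof.
move=> BB; elim: n f => [|n IH] f [[mf fB fH] Cf]; split.
- split => // [x|x v]; first exact: le_trans (fB x) BB.
  by apply: le_trans (fH x v) _; apply: ler_wpM2r BB; exact: powR_ge0.
- by [].
- split => // [x|x v]; first exact: le_trans (fB x) BB.
  by apply: le_trans (fH x v) _; apply: ler_wpM2r BB; exact: powR_ge0.
- by case: Cf => df Cf; split => // i; apply: IH; exact: Cf.
Qed.

Lemma Ck_bound al B n f x : Ck al B n f -> `|f x| <= B.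
Proof. by move/Ck_base => [[]]. Qed.

Lemma Ck_bound_ge0 al B n f : Ck al B n f -> 0 <= B.
Proof. by move=> /Ck_bound H; exact: le_trans (H 0). Qed.

Lemma Ck_zero al n : Ck al 0 n (fun _ : 'rV[R]_d => 0).
Proof.
elim: n => [|n IH]; split => //.
- by split => [|x|x v] //; rewrite ?normr0// subrr normr0 mul0r.
- by split => [|x|x v] //; rewrite ?normr0// subrr normr0 mul0r.
- split => [x|i]; first exact: differentiable_cst.
  by rewrite (_ : partial i (fun=> 0) = fun=> 0)//; apply/funext => x; rewrite /partial derive_cst.
Qed.

Lemma partialD i f g : (forall x, differentiable (f : _ -> R^o) x) -> (forall x, differentiable (g : _ -> R^o) x) ->
  partial i (fun x => f x + g x) = fun x => partial i f x + partial i g x.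
Proof.
move=> df dg; apply/funext => x; rewrite /partial.
have := @deriveD _ _ _ (f : _ -> R^o) (g : _ -> R^o) x (delta_mx 0 i).
by apply; exact: diff_derivable.
Qed.

Lemma partialM i f g : (forall x, differentiable (f : _ -> R^o) x) -> (forall x, differentiable (g : _ -> R^o) x) ->
  partial i (fun x => f x * g x) = fun x => f x * partial i g x + partial i f x * g x.
Proof.
move=> df dg; apply/funext => x; rewrite /partial.
have := @deriveM _ _ (f : _ -> R^o) (g : _ -> R^o) x (delta_mx 0 i).
move=> -> //; try exact: diff_derivable.
by rewrite /GRing.scale/= [g x * _]mulrC.
Qed.

Lemma Ck_add al B B' n f g : Ck al B n f -> Ck al B' n g -> Ck al (B + B') n (fun x => f x + g x).
Proof.
have base f' g' : Ck al B 0 f' -> Ck al B' 0 g' -> Ck al (B + B') 0 (fun x => f' x + g' x).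
  move=> [[mf fB fH] _] [[mg gB gH] _]; split => //; split.
  - exact: measurable_funD.
  - by move=> x; apply: le_trans (ler_normD _ _) _; apply: lerD.
  - move=> x v; rewrite opprD addrACA mulrDl.
    by apply: le_trans (ler_normD _ _) _; apply: lerD.
elim: n f g => [|n IH] f g Cf Cg; first exact: base.
have [h _] := base _ _ (Ck_base Cf) (Ck_base Cg); split => //.
case: Cf => _ [df Cf]; case: Cg => _ [dg Cg]; split.
  by move=> x; have := differentiableD (df x) (dg x).
by move=> i; rewrite partialD//; apply: IH; [exact: Cf|exact: Cg].
Qed.

(** Leibniz rule: each differentiation yields two products, hence one factor 2 per order, besides
    the one for the Hoelder bound of a product. *)
Lemma Ck_mul al B B' n f g : Ck al B n f -> Ck al B' n g -> Ck al (2 ^+ n.+1 * (B * B')) n (fun x => f x * g x).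
Proof.
have base f' g' : Ck al B 0 f' -> Ck al B' 0 g' -> Ck al (2 * (B * B')) 0 (fun x => f' x * g' x).
  move=> Cf Cg; have B0 := Ck_bound_ge0 Cf; have B0' := Ck_bound_ge0 Cg.
  have BB0 : 0 <= B * B' by exact: mulr_ge0.
  move: Cf Cg => [[mf fB fH] _] [[mg gB gH] _]; split => //; split.
  - exact: measurable_funM.
  - by move=> x; rewrite normrM; apply: (@le_trans _ _ (B * B')); [apply: ler_pM|rewrite ler_peMl// ler1n].
  - move=> x v.
    have -> : f' (x + v) * g' (x + v) - f' x * g' x = f' (x + v) * (g' (x + v) - g' x) + g' x * (f' (x + v) - f' x) by ring.
    apply: le_trans (ler_normD _ _) _; rewrite !normrM.
    have -> : 2 * (B * B') * `|v| `^ al = B * (B' * `|v| `^ al) + B' * (B * `|v| `^ al) by ring.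
    by apply: lerD; apply: ler_pM.
elim: n f g => [|n IH] f g Cf Cg.
  by rewrite expr1; exact: base.
have B0 := Ck_bound_ge0 Cf; have B0' := Ck_bound_ge0 Cg.
have BB0 : 0 <= B * B' by exact: mulr_ge0.
have le2 : 2 * (B * B') <= 2 ^+ n.+2 * (B * B').
  by apply: ler_wpM2r => //; rewrite exprS ler_peMr// exprn_ege1// ler1n.
have [h _] := Ck_mono le2 (base _ _ (Ck_base Cf) (Ck_base Cg)); split => //.
have Cf0 := CkS Cf; have Cg0 := CkS Cg.
case: Cf => _ [df Cf]; case: Cg => _ [dg Cg]; split.
  by move=> x; have := differentiableM (df x) (dg x).
move=> i; rewrite partialM//.
have -> : 2 ^+ n.+2 * (B * B') = 2 ^+ n.+1 * (B * B') + 2 ^+ n.+1 * (B * B') by rewrite [2 ^+ n.+2]exprS; ring.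
by apply: Ck_add; apply: IH => //; [exact: Cg|exact: Cf].
Qed.

(** The order of quantifiers matters: the bound serves for the gradients at all times of an interval
    simultaneously. *)
Lemma Ck_sqr_sum al B n : exists B', forall g : 'I_d -> 'rV[R]_d -> R, (forall i, Ck al B n (g i)) ->
  Ck al B' n (fun x => \sum_i g i x * g i x).
Proof.
pose B2 := 2 ^+ n.+1 * (B * B); exists (\sum_(i <- index_enum 'I_d) B2) => g Cg.
elim: (index_enum 'I_d) => [|i r IH].
  by rewrite big_nil (_ : (fun x => _) = fun=> 0); [exact: Ck_zero|apply/funext => x; rewrite big_nil].
rewrite big_cons (_ : (fun x => _) = fun x => g i x * g i x + \sum_(j <- r) g j x * g j x).
  by apply: Ck_add IH; apply: Ck_mul.
by apply/funext => x; rewrite big_cons.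
Qed.

(** Only nonempty words are constrained, because the solution itself need not be bounded while its
    derivatives are. *)
Lemma Ck_family (G : seq 'I_d -> 'rV[R]_d -> R) al B N n s :
  (forall s', (0 < size s' <= N)%N -> [/\ measurable_fun setT (G s'), forall x, `|G s' x| <= B &
     forall x v, `|G s' (x + v) - G s' x| <= B * `|v| `^ al]) ->
  (forall s' x, (0 < size s' < N)%N -> differentiable (G s' : _ -> R^o) x /\ forall i, partial i (G s') x = G (i :: s') x) ->
  (0 < size s)%N -> (size s + n <= N)%N -> Ck al B n (G s).
Proof.
move=> HG dG; elim: n s => [|n IH] s s0 sn; split => //.
- by apply: HG; lia.
- by apply: HG; lia.
- split => [x|i]; first by have [] := dG s x _; first by lia.
  have -> : partial i (G s) = G (i :: s).
    by apply/funext => x; apply: (dG s x _).2; lia.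
  by apply: IH => //=; lia.
Qed.

(** A Hoelder bound of exponent 0 is a bound on the oscillation, at most twice the supremum. It
    restarts the induction of [source_regular_all]. *)
Lemma Ck_lower al B n f : 0 <= al -> Ck al B n f -> Ck 0 (2 * B) n f.
Proof.
move=> al0; elim: n f => [|n IH] f Cf.
  have B0 := Ck_bound_ge0 Cf; have [[mf fB fH] _] := Cf; split => //; split => //.
    by move=> x; apply: le_trans (fB x) _; rewrite ler_peMl// ler1n.
  move=> x v; rewrite powRr0 mulr1 mulr2n mulrDl mul1r.
  by apply: le_trans (ler_normB _ _) _; exact: lerD.
have B0 := Ck_bound_ge0 Cf.
have [[mf fB fH] [df Cdf]] := Cf; split; last by split => // i; apply: IH; exact: Cdf.
split => //; first by move=> x; apply: le_trans (fB x) _; rewrite ler_peMl// ler1n.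
move=> x v; rewrite powRr0 mulr1 mulr2n mulrDl mul1r.
by apply: le_trans (ler_normB _ _) _; exact: lerD.
Qed.

Lemma conv_ae (f k k' : 'rV[R]_d -> R) : measurable_fun setT f -> measurable_fun setT k -> measurable_fun setT k' ->
  (\forall y \ae mu, k y = k' y) -> Defs.conv f k = Defs.conv f k'.
Proof.
move=> mf mk mk' kk; apply/funext => x; rewrite /Defs.conv /Rintegral; congr fine.
have mfx : measurable_fun setT (fun y => f (x - y)).
  apply: measurableT_comp => //.
  have -> : (fun y => x - y) = (fun y => -1 *: y + x) by apply/funext => y; rewrite scaleN1r addrC.
  exact: measurable_affine_rV.
apply: ae_eq_integral => //.
- by apply/measurable_EFinP; exact: measurable_funM.
- by apply/measurable_EFinP; exact: measurable_funM.
- by apply: filterS kk => y /= -> _.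
Qed.

End Ck_algebra.

(** * Regularity of the Duhamel term *)

Section duhamel_regularity.
Context {R : realType} {d : nat}.
Local Notation mu := (@lebesgue_rV R d).
Local Notation leb := (@lebesgue_measure R).
Implicit Types (x y v : 'rV[R]_d) (f g k : 'rV[R]_d -> R) (B C al th s t T tau : R) (m J p : nat) (i : 'I_d) (w gm : seq 'I_d).

Lemma Ck_conv_word al B n f w p t x : 0 < t -> 0 <= al <= 1 -> (p <= n)%N -> (p < size w)%N -> Ck al B n f ->
  `|Defs.conv (K w t) f x| <= B * Kmoment (drop p w) al * t `^ ((al - (size w - p)%:R) / 4).
Proof.
move=> t0 al01 pn pw Cf; have := @Ck_conv_bound _ _ al B n f _ (take p w) _ t x t0 al01 _ Cf.
rewrite size_take_min => H.
case E : (drop p w) => [|i s2]; first by have := size_drop p w; rewrite E/=; lia.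
have := H i s2; rewrite -E cat_take_drop -(_ : size (drop p w) = (size s2).+1); last by rewrite E.
by rewrite size_drop E; apply; lia.
Qed.

Lemma diff_sum (I : Type) (r : seq I) (f : I -> 'rV[R]_d -> R) x : (forall j, differentiable (f j : _ -> R^o) x) ->
  differentiable (fun x => \sum_(j <- r) f j x : R^o) x /\
  forall i, partial i (fun x => \sum_(j <- r) f j x) x = \sum_(j <- r) partial i (f j) x.
Proof.
move=> df; elim: r => [|j r [IH1 IH2]].
  rewrite (_ : (fun x => _) = fun=> 0); last by apply/funext => y; rewrite big_nil.
  split => [|i]; first exact: differentiable_cst.
  by rewrite big_nil /partial derive_cst.
rewrite (_ : (fun x => _) = (f j : _ -> R^o) + (fun x => \sum_(j <- r) f j x)); last first.
  by apply/funext => y; rewrite big_cons.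
split => [|i]; first exact: differentiableD.
rewrite big_cons -IH2 /partial; apply: deriveD; exact: diff_derivable.
Qed.

Variables (F : R -> 'rV[R]_d -> R) (M : R).

Definition duhamel_integrand gm t s x : R := \sum_i Defs.conv (K (gm ++ [:: i; i]) (t - s)) (F s) x.
Local Notation W := duhamel_integrand.
Definition duhamel_partial gm t x : R := \int[leb]_(s in `]0, t[) W gm t s x.
Local Notation Dh := duhamel_partial.

Hypothesis M0 : 0 <= M.
Hypothesis mF : measurable_fun setT (fun q : measurableTypeR R * 'rV[R]_d => F q.1 q.2).
Hypothesis FM : forall s x, 0 < s -> `|F s x| <= M * s `^ (- (1 / 2)).

Lemma measurable_Fs s : measurable_fun setT (F s).
Proof. exact: (measurableT_comp mF (measurable_pair1 s)). Qed.

Lemma Fs_defined s : 0 < s -> conv_defined (F s).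
Proof.
move=> s0; apply: (@conv_definedP _ _ _ (M * s `^ (- (1 / 2))) 0) => //.
- by rewrite mulr_ge0// powR_ge0.
- exact: measurable_Fs.
- by move=> y; rewrite mul0r expR0 mulr1; exact: FM.
Qed.

Lemma measurable_duhamel_integrand gm t :
  measurable_fun setT (fun q : measurableTypeR R * 'rV[R]_d => W gm t q.1 q.2).
Proof.
apply: measurable_sum => i.
apply: (@measurable_Rintegral _ _ _ _ _ mu
  (fun q : (measurableTypeR R * 'rV[R]_d) * 'rV[R]_d => K (gm ++ [:: i; i]) (t - q.1.1) (q.1.2 - q.2) * F q.1.1 q.2)).
apply: measurable_funM.
  apply: measurable_K.
    apply: measurable_funB => //.
    exact: (measurableT_comp measurable_fst measurable_fst).
  apply: (measurableT_comp measurable_sub2 (f := fun q : 'rV[R]_d * 'rV[R]_d => q.1 - q.2)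
    (g := fun q : (measurableTypeR R * 'rV[R]_d) * 'rV[R]_d => (q.1.2, q.2))).
  apply: measurable_fun_pair; last exact: measurable_snd.
  exact: (measurableT_comp measurable_snd measurable_fst).
apply: (measurableT_comp mF (g := fun q : (measurableTypeR R * 'rV[R]_d) * 'rV[R]_d => (q.1.1, q.2))).
apply: measurable_fun_pair; last exact: measurable_snd.
exact: (measurableT_comp measurable_fst measurable_fst).
Qed.

Lemma measurable_duhamel_integrand1 gm t x (D : set (measurableTypeR R)) : measurable_fun D (fun s : measurableTypeR R => W gm t s x).
Proof.
apply: measurable_funTS.
exact: (measurableT_comp (measurable_duhamel_integrand gm t) (measurable_pair2 x)).
Qed.

Lemma measurable_duhamel_partial gm t : measurable_fun setT (Dh gm t).
Proof.
have -> : Dh gm t = fun x => \int[leb]_s (\1_(`]0, t[) s * W gm t s x).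
  apply/funext => x; rewrite /Dh Rintegral_mkcond; apply: eq_Rintegral => s _.
  by rewrite patchE indicE; case: ifP => _; rewrite ?mul1r ?mul0r.
apply: (@measurable_Rintegral _ _ _ _ _ leb (fun q : 'rV[R]_d * measurableTypeR R => \1_(`]0, t[) q.2 * W gm t q.2 q.1)).
apply: measurable_funM.
  by apply: (measurableT_comp _ measurable_snd); exact: measurable_indic.
apply: (measurableT_comp (measurable_duhamel_integrand gm t) (g := fun q : 'rV[R]_d * measurableTypeR R => (q.2, q.1))).
by apply: measurable_fun_pair; [exact: measurable_snd|exact: measurable_fst].
Qed.

Lemma duhamel_integrand_diff gm t s x : 0 < s < t ->
  differentiable (W gm t s : _ -> R^o) x /\ forall i, partial i (W gm t s) x = W (i :: gm) t s x.
Proof.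
move=> /andP[s0 st]; have ts0 : 0 < t - s by rewrite subr_gt0.
have dc i := conv_diff (gm ++ [:: i; i]) x ts0 (Fs_defined s0).
have [h1 h2] := @diff_sum _ (index_enum 'I_d) (fun i => Defs.conv (K (gm ++ [:: i; i]) (t - s)) (F s)) x (fun i => (dc i).1).
split; first exact: h1.
by move=> i; rewrite h2; apply: eq_bigr => j _; rewrite (dc j).2.
Qed.

(* The size of the Duhamel integrand at time s: before tau only the source is
   singular, after tau only the kernel. *)
Definition early_late tau e t s : R := if s < tau then s `^ (- (1 / 2)) else (t - s) `^ (- e).

Lemma Kmoment_ge0 w al : 0 <= Kmoment w al :> R.
Proof. by apply: Rintegral_ge0 => y _; rewrite mulr_ge0 ?powR_ge0. Qed.

(** A regular representative is all that is asked of the source: its values on a null set are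
    invisible to the convolution. *)
Definition ae_Ck al B m s := exists2 f, Ck al B m f & \forall y \ae mu, F s y = f y.

(** The source takes as many derivatives as needed to leave at most J on the kernel, which gives the
    exponent (al - J) / 4 near s = t. At early times all derivatives stay on the kernel. *)
Lemma duhamel_integrand_bound gm al m J tau T B : 0 <= al <= 1 -> (0 < J)%N -> (size gm + 2 <= m + J)%N -> 0 < tau -> 0 <= B ->
  (forall s, tau <= s <= T -> ae_Ck al B m s) ->
  exists2 C, 0 <= C & forall t s x, 2 * tau <= t <= T -> 0 < s < t -> `|W gm t s x| <= C * early_late tau ((J%:R - al) / 4) t s.
Proof.
move=> al01 J0 gJ tau0 B0 HF.
have nats (N' : nat) : (0 < N')%N -> (N' <= m + J)%N -> [/\ (N' - J <= m)%N, (N' - (N' - J) <= J)%N & (N' - J < N')%N].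
  by clear -J0 => *; split; lia.
pose w i := gm ++ [:: i; i].
have sw i : size (w i) = (size gm + 2)%N by rewrite size_cat.
pose N := (size gm + 2)%N.
pose C1 : R := \sum_i (2 * M * Kmoment (w i) 0 * tau `^ (- (N%:R / 4))).
(* The subtraction is truncated: for N <= J no derivative falls on the source and j may be less than
   J. The surplus power (t - s)^((J - j) / 4) is then bounded through T. *)
pose p := (N - J)%N; pose j := (N - p)%N.
have N0 : (0 < N)%N by rewrite /N addn2.
have [pm jJ pN] : [/\ (p <= m)%N, (j <= J)%N & (p < N)%N] by exact: nats.
pose C2 : R := \sum_i (B * Kmoment (drop p (w i)) al * `|T| `^ ((J - j)%:R / 4)).
have C10 : 0 <= C1 by apply: sumr_ge0 => i _; rewrite !mulr_ge0 ?powR_ge0 ?Kmoment_ge0.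
have C20 : 0 <= C2 by apply: sumr_ge0 => i _; rewrite !mulr_ge0 ?powR_ge0 ?Kmoment_ge0.
exists (C1 + C2); first exact: addr_ge0.
move=> t s x /andP[tt tT] /andP[s0 st]; have ts0 : 0 < t - s by rewrite subr_gt0.
apply: le_trans (ler_norm_sum _ _ _) _; rewrite /early_late; case: ifPn => [stau|].
  apply: (@le_trans _ _ (C1 * s `^ (- (1 / 2)))); last by rewrite ler_wpM2r ?powR_ge0// lerDl.
  rewrite mulr_suml; apply: ler_sum => i _.
  (* Since t >= 2 tau, s < tau implies t - s > tau, and the kernel is harmless. The bound on F
     enters as a Hoelder bound of exponent 0, which doubles it. *)
  pose B1 := 2 * (M * s `^ (- (1 / 2))).
  have Mb : 0 <= M * s `^ (- (1 / 2)) by rewrite mulr_ge0 ?powR_ge0.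
  have CF : Ck 0 B1 0 (F s).
    split => //; split; first exact: measurable_Fs.
      by move=> y; apply: le_trans (FM _ s0) _; rewrite ler_peMl// ler1n.
    move=> y v; rewrite powRr0 mulr1 /B1 mulr2n mulrDl mul1r.
    by apply: le_trans (ler_normB _ _) _; apply: lerD; exact: FM.
  have H : (0 < size (w i))%N by rewrite sw addn2.
  have := @Ck_conv_word 0 B1 0 (F s) (w i) 0 (t - s) x ts0 _ (leqnn 0) H CF.
  rewrite lexx ler01 => /(_ isT) => {}H; apply: le_trans H _.
  rewrite drop0 subn0 sw -/N sub0r mulNr.
  have -> : 2 * M * Kmoment (w i) 0 * tau `^ (- (N%:R / 4)) * s `^ (- (1 / 2)) = B1 * Kmoment (w i) 0 * tau `^ (- (N%:R / 4)) by rewrite /B1; ring.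
  apply: ler_wpM2l; first by rewrite !mulr_ge0 ?powR_ge0 ?Kmoment_ge0.
  rewrite !powRN lef_pV2 ?posrE ?powR_gt0//.
  apply: ge0_ler_powR; rewrite ?nnegrE ?divr_ge0 ?(ltW tau0) ?(ltW ts0)//.
  lra.
rewrite -leNgt => taus.
apply: (@le_trans _ _ (C2 * (t - s) `^ (- ((J%:R - al) / 4)))); last by rewrite ler_wpM2r ?powR_ge0// lerDr.
rewrite mulr_suml; apply: ler_sum => i _.
have [f Cf Ff] : ae_Ck al B m s by apply: HF; rewrite taus (le_trans (ltW st)).
have -> : Defs.conv (K (w i) (t - s)) (F s) = Defs.conv (K (w i) (t - s)) f.
  apply: conv_ae => //; [exact: (rap_K _ ts0).1|exact: measurable_Fs|by have [[]] := Ck_base Cf].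
have pw : (p < size (w i))%N by rewrite sw.
apply: le_trans (Ck_conv_word _ ts0 al01 pm pw Cf) _.
rewrite sw -/N -/j -[leRHS]mulrA; apply: ler_wpM2l; first by rewrite mulr_ge0 ?Kmoment_ge0.
have -> : (al - j%:R) / 4 = (J - j)%:R / 4 + - ((J%:R - al) / 4) by rewrite (natrB _ jJ); field.
rewrite powRD; last by rewrite (gt_eqF ts0) implybT.
apply: ler_wpM2r; first exact: powR_ge0.
have T0 : 0 < T by apply: lt_le_trans tT; apply: lt_trans st.
rewrite gtr0_norm//; apply: ge0_ler_powR; rewrite ?nnegrE ?divr_ge0 ?(ltW ts0) ?(ltW T0)//; lra.
Qed.

Definition singular_weight e t s : R := s `^ (- (1 / 2)) + (t - s) `^ (- e).

Lemma singular_weight_ge0 e t s : 0 <= singular_weight e t s.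
Proof. by rewrite addr_ge0 ?powR_ge0. Qed.

Lemma integrable_singular_weight e T : e < 1 -> exists2 C, 0 <= C & forall t, 0 < t <= T ->
  leb.-integrable `]0, t[ (EFin \o singular_weight e t) /\ \int[leb]_(s in `]0, t[) singular_weight e t s <= C.
Proof.
move=> e1; have h12 : 1 / 2 < 1 :> R by lra.
exists (2 * (T `^ (1 - 1 / 2) / (1 - 1 / 2)) + 2 * (T `^ (1 - e) / (1 - e))).
  by rewrite addr_ge0// mulr_ge0// divr_ge0 ?powR_ge0 ?subr_ge0// ltW.
move=> t tT; have [i1 _ b1 _] := integrable_powR_itv h12 tT; have [_ i2 _ b2] := integrable_powR_itv e1 tT.
have mD : measurable (`]0, t[%classic : set (measurableTypeR R)) by exact: measurable_itv.
split; last by rewrite /singular_weight RintegralD//; exact: lerD.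
by apply: eq_integrable (integrableD mD i1 i2).
Qed.

Lemma duhamel_integrand_holder gm al th m J tau T B : 0 <= al <= 1 -> 0 <= th <= 1 -> (0 < J)%N ->
  (size gm + 2 <= m + J)%N -> 0 < tau -> 0 <= B ->
  (forall s, tau <= s <= T -> ae_Ck al B m s) ->
  exists2 C, 0 <= C & forall t s, 2 * tau <= t <= T -> 0 < s < t ->
    (forall x, `|W gm t s x| <= C * singular_weight ((J%:R + th - al) / 4) t s) /\
    (forall x v, `|W gm t s (x + v) - W gm t s x| <= C * singular_weight ((J%:R + th - al) / 4) t s * `|v| `^ th).
Proof.
move=> al01 th01 J0 gJ tau0 B0 HF; pose e := (J%:R + th - al) / 4.
have [Ca Ca0 Ha] := duhamel_integrand_bound al01 J0 gJ tau0 B0 HF.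
have /choice[Cb Hb] : forall i, exists C, 0 <= C /\ forall t s x, 2 * tau <= t <= T -> 0 < s < t ->
    `|W (i :: gm) t s x| <= C * early_late tau ((J.+1%:R - al) / 4) t s.
  move=> i; have gJ' : (size (i :: gm) + 2 <= m + J.+1)%N by rewrite [(m + _)%N]addnS /= addSn ltnS.
  have [C C0 H] := duhamel_integrand_bound al01 (ltn0Sn J) gJ' tau0 B0 HF; by exists C.
pose C1 := Ca + \sum_i Cb i.
have Cb0 i : 0 <= Cb i := (Hb i).1.
have CaC : Ca <= C1 by rewrite lerDl sumr_ge0.
have CbC i : Cb i <= C1 by rewrite /C1 (bigD1 i)//= addrCA lerDl addr_ge0// sumr_ge0.
have C10 : 0 <= C1 by exact: le_trans CaC.
(* The middle term converts the exponent (J - al) / 4 of the sup bound into the larger (J + th - al)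
   / 4, at the cost of a factor T^(th/4). *)
pose C2 := Ca + Ca * `|T| `^ (th / 4) + (d%:R + 2) * C1.
have CaT0 : 0 <= Ca * `|T| `^ (th / 4) by rewrite mulr_ge0 ?powR_ge0.
have d2 : 0 <= d%:R + 2 :> R by rewrite addr_ge0.
have C20 : 0 <= C2 by apply: addr_ge0; [exact: addr_ge0|exact: mulr_ge0].
exists C2 => // t s tt st; have /andP[s0 st'] := st; have ts0 : 0 < t - s by rewrite subr_gt0.
have T0 : 0 < T by have /andP[_ tT] := tt; apply: lt_le_trans tT; exact: lt_trans st'.
have /andP[th0 th1] := th01.
split.
  move=> x; apply: le_trans (Ha t s x tt st) _.
  apply: (@le_trans _ _ ((Ca + Ca * `|T| `^ (th / 4)) * singular_weight e t s)); last first.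
    by apply: ler_wpM2r; [exact: singular_weight_ge0|rewrite lerDl mulr_ge0// addr_ge0].
  rewrite [leRHS]mulrDl /early_late; case: ifP => _.
    by apply: ler_wpDr; [rewrite !mulr_ge0 ?powR_ge0 ?singular_weight_ge0|rewrite ler_wpM2l// lerDl powR_ge0].
  apply: ler_wpDl; first by rewrite mulr_ge0 ?singular_weight_ge0.
  rewrite -mulrA ler_wpM2l// /singular_weight [leRHS]mulrDr; apply: ler_wpDl; first by rewrite mulr_ge0 ?powR_ge0.
  have -> : - ((J%:R - al) / 4) = th / 4 + - e by rewrite /e; field.
  rewrite powRD; last by rewrite (gt_eqF ts0) implybT.
  apply: ler_wpM2r; first exact: powR_ge0.
  rewrite gtr0_norm//; apply: ge0_ler_powR; rewrite ?nnegrE ?divr_ge0 ?(ltW ts0) ?(ltW T0)//.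
  by have /andP[_ tT] := tt; lra.
move=> x v.
have dW y := duhamel_integrand_diff gm y st.
apply: (@le_trans _ _ ((d%:R + 2) * C1 * singular_weight e t s * `|v| `^ th)); last first.
  apply: ler_wpM2r; first exact: powR_ge0.
  apply: ler_wpM2r; first exact: singular_weight_ge0.
  by rewrite /C2 lerDr addr_ge0// mulr_ge0 ?powR_ge0.
case: (ltP s tau) => stau.
  have := @interp_holder _ _ (W gm t s) (C1 * s `^ (- (1 / 2))) 1 th x v _ ltr01 th01 _ (fun y => (dW y).1) _.
  move=> H; apply: le_trans (H _ _ _) _.
  - by rewrite mulr_ge0 ?powR_ge0.
  - move=> y; apply: le_trans (Ha t s y tt st) _; rewrite /early_late stau.
    by apply: ler_wpM2r; [exact: powR_ge0|exact: CaC].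
  - move=> y i; rewrite (dW y).2 divr1; apply: le_trans ((Hb i).2 t s y tt st) _; rewrite /early_late stau.
    by apply: ler_wpM2r; [exact: powR_ge0|exact: CbC].
  rewrite divr1; apply: ler_wpM2r; first exact: powR_ge0.
  by rewrite -[leRHS]mulrA; apply: (ler_wpM2l d2); apply: (ler_wpM2l C10); rewrite lerDl powR_ge0.
(* (t - s)^(1/4) is the length scale of the kernel: a derivative costs its inverse, so a Hoelder
   bound of exponent th costs (t - s)^(-th/4). *)
have rho0 : 0 < (t - s) `^ (1 / 4) by rewrite powR_gt0.
have := @interp_holder _ _ (W gm t s) (C1 * (t - s) `^ (- ((J%:R - al) / 4))) ((t - s) `^ (1 / 4)) th x v _ rho0 th01 _ (fun y => (dW y).1) _.
have nstau : (s < tau) = false by rewrite ltNge stau.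
move=> H; apply: le_trans (H _ _ _) _.
- by rewrite mulr_ge0 ?powR_ge0.
- move=> y; apply: le_trans (Ha t s y tt st) _; rewrite /early_late nstau.
  by apply: ler_wpM2r; [exact: powR_ge0|exact: CaC].
- move=> y i; rewrite (dW y).2; apply: le_trans ((Hb i).2 t s y tt st) _; rewrite /early_late nstau.
  rewrite -[leRHS]mulrA -powRN -powRD; last by rewrite (gt_eqF ts0) implybT.
  have -> : - ((J%:R - al) / 4) + - (1 / 4) = - ((J.+1%:R - al) / 4) :> R by rewrite -[J.+1%:R]natr1; field.
  by apply: ler_wpM2r; [exact: powR_ge0|exact: CbC].
rewrite powRM// ?invr_ge0 ?(ltW rho0)//.
have -> : ((t - s) `^ (1 / 4))^-1 `^ th = (t - s) `^ (- (th / 4)).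
  by rewrite -powRN -powRrM; congr (_ `^ _); field.
have -> : (d%:R + 2) * (C1 * (t - s) `^ (- ((J%:R - al) / 4))) * (`|v| `^ th * (t - s) `^ (- (th / 4))) =
   (d%:R + 2) * C1 * ((t - s) `^ (- ((J%:R - al) / 4)) * (t - s) `^ (- (th / 4))) * `|v| `^ th by ring.
rewrite -powRD; last by rewrite (gt_eqF ts0) implybT.
have -> : - ((J%:R - al) / 4) + - (th / 4) = - e by rewrite /e; field.
apply: ler_wpM2r; first exact: powR_ge0.
by apply: (ler_wpM2l (mulr_ge0 d2 C10)); rewrite lerDr powR_ge0.
Qed.

(** J + th - al < 4 makes the time weight integrable, so the bounds on the integrand pass to the
    integral. Differentiating uses the Hoelder bound of the next word, hence one letter less is
    available there. *)
Lemma duhamel_partial_regular al th m J tau T B : 0 <= al <= 1 -> 0 < th <= 1 -> (0 < J)%N -> J%:R + th - al < 4 ->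
  0 < tau -> 0 <= B -> (forall s, tau <= s <= T -> ae_Ck al B m s) ->
  exists2 C, 0 <= C & forall t, 2 * tau <= t <= T ->
    (forall gm, (size gm + 2 <= m + J)%N -> (forall x, `|Dh gm t x| <= C) /\
       (forall x v, `|Dh gm t (x + v) - Dh gm t x| <= C * `|v| `^ th)) /\
    (forall gm x, (size gm + 3 <= m + J)%N -> differentiable (Dh gm t : _ -> R^o) x /\
       forall i, partial i (Dh gm t) x = Dh (i :: gm) t x).
Proof.
move=> al01 /andP[th0 th1] J0 Jth tau0 B0 HF; pose e := (J%:R + th - al) / 4.
have e1 : e < 1 by rewrite /e ltr_pdivrMr// mul1r.
have th01 : 0 <= th <= 1 by rewrite (ltW th0).
have [I I0 HI] := integrable_singular_weight T e1.
have /choice[Cg Hg] : forall gm, exists C, (size gm + 2 <= m + J)%N -> 0 <= C /\ forall t s, 2 * tau <= t <= T -> 0 < s < t ->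
    (forall x, `|W gm t s x| <= C * singular_weight e t s) /\
    (forall x v, `|W gm t s (x + v) - W gm t s x| <= C * singular_weight e t s * `|v| `^ th).
  move=> gm; have [gJ|] := boolP (size gm + 2 <= m + J)%N; last by exists 0.
  by have [C C0 H] := duhamel_integrand_holder al01 th01 J0 gJ tau0 B0 HF; exists C.
have [C [C0 HC]] := bounded_words Cg (m + J).
have {}Hg gm t s : (size gm + 2 <= m + J)%N -> 2 * tau <= t <= T -> 0 < s < t ->
    (forall x, `|W gm t s x| <= C * singular_weight e t s) /\
    (forall x v, `|W gm t s (x + v) - W gm t s x| <= C * singular_weight e t s * `|v| `^ th).
  move=> gJ tt st; have [_ H] := Hg gm gJ; have [h1 h2] := H t s tt st.
  have CC : Cg gm <= C by apply: HC; apply: leq_trans gJ; exact: leq_addr.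
  split => [x|x v].
    by apply: le_trans (h1 x) _; apply: ler_wpM2r CC; exact: singular_weight_ge0.
  apply: le_trans (h2 x v) _; apply: ler_wpM2r; first exact: powR_ge0.
  by apply: ler_wpM2r CC; exact: singular_weight_ge0.
exists (C * I); first exact: mulr_ge0.
move=> t tt; have t0 : 0 < t <= T by have /andP[h1 ->] := tt; rewrite andbT; lra.
have [Iw Iwb] := HI t t0.
have mD : measurable (`]0, t[%classic : set (measurableTypeR R)) by exact: measurable_itv.
have inD s : `]0, t[%classic s -> 0 < s < t by rewrite /= in_itv.
have Ic (c : R) : leb.-integrable `]0, t[ (EFin \o (fun s => c * singular_weight e t s)) by exact: integrable_Zl.
have IcE (c : R) : 0 <= c -> \int[leb]_(s in `]0, t[) (c * singular_weight e t s) <= c * I.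
  by move=> c0; rewrite RintegralZl//; exact: ler_wpM2l.
have IW gm x : (size gm + 2 <= m + J)%N -> leb.-integrable `]0, t[ (EFin \o (fun s => W gm t s x)).
  move=> gJ; apply: integrable_le mD _ _ (Ic C); first exact: measurable_duhamel_integrand1.
  by move=> s /inD st; exact: (Hg gm t s gJ tt st).1.
split.
  move=> gm gJ; split => [x|x v].
    apply: le_trans (le_normr_Rintegral mD (IW gm x gJ)) _.
    apply: le_trans (IcE C C0); apply: le_Rintegral => //.
    - by apply: integrable_norm; exact: IW.
    by move=> s /inD st; exact: (Hg gm t s gJ tt st).1.
  rewrite /Dh -RintegralB//; try exact: IW.
  have IB : leb.-integrable `]0, t[ (EFin \o (fun s => W gm t s (x + v) - W gm t s x)).
    have := integrableB mD (IW gm (x + v) gJ) (IW gm x gJ).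
    by apply: eq_integrable => // s _ /=.
  apply: le_trans (le_normr_Rintegral mD IB) _.
  have -> : C * I * `|v| `^ th = (C * `|v| `^ th) * I by ring.
  apply: le_trans (IcE _ (mulr_ge0 C0 (powR_ge0 _ _))); apply: le_Rintegral => //.
  - exact: integrable_norm.
  - move=> s /inD st; rewrite mulrAC; exact: (Hg gm t s gJ tt st).2.
move=> gm x gJ.
have gJ2 : (size gm + 2 <= m + J)%N by apply: leq_trans gJ; rewrite leq_add2l.
have gJi i : (size (i :: gm) + 2 <= m + J)%N by rewrite /= addSnnS.
(* The remainder is of order 1 + th: the first derivatives of the integrand are th-Hoelder with an
   integrable constant. *)
apply: (@rem_differentiable _ _ _ _ _ (d%:R * C * I) 1 th) => // v v1.
have H := @rem_integral _ _ _ _ leb `]0, t[%classic (fun s => W gm t s) (fun s i => W (i :: gm) t s x) (fun s => d%:R * C * singular_weight e t s) x v (`|v| * `|v| `^ th) mD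
  (fun y => IW gm y gJ2) (fun i => IW (i :: gm) x (gJi i)) (Ic _).
apply: le_trans (H _) _; last first.
  rewrite -[leRHS]mulrA; apply: ler_wpM2r; first by rewrite mulr_ge0 ?powR_ge0.
  by apply: IcE; rewrite mulr_ge0.
move=> s /inD st.
have dW y := duhamel_integrand_diff gm y st.
have -> : (fun i => W (i :: gm) t s x) = fun i => partial i (W gm t s) x by apply/funext => i; rewrite (dW x).2.
have -> : d%:R * C * singular_weight e t s * (`|v| * `|v| `^ th) = d%:R * (C * singular_weight e t s * `|v| `^ th) * `|v| by ring.
apply: rem_holder => [r _|r i /andP[r0 r1]]; first exact: (dW _).1.
rewrite !(dW _).2; apply: le_trans ((Hg (i :: gm) t s (gJi i) tt st).2 x (r *: v)) _.
apply: ler_wpM2l; first by rewrite mulr_ge0 ?singular_weight_ge0.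
apply: ge0_ler_powR; rewrite ?nnegrE ?(ltW th0)//.
by rewrite normrZ ger0_norm// ler_piMl.
Qed.

End duhamel_regularity.

(** * Bootstrapping *)

Section regularity.
Context {R : realType} {d : nat}.
Local Notation mu := (@lebesgue_rV R d).
Implicit Types (x y v : 'rV[R]_d) (f g k : 'rV[R]_d -> R) (B C al th s t T tau : R) (m J p : nat) (i : 'I_d) (w gm : seq 'I_d).

Lemma lipschitz_bound f : lipschitz (f : _ -> R^o) -> exists2 L, 0 <= L & forall x v, `|f (x + v) - f x| <= L * `|v|.
Proof.
move=> /pinfty_ex_gt0[L L0 H]; exists L; first exact: ltW.
move=> x v; have := H (x + v, x) (conj I I) => /=.
by rewrite /self_sub/= [x + v - x]addrAC subrr add0r.
Qed.

Lemma bounded_funP f : bounded_fun (f : _ -> R^o) <-> exists B, forall x, `|f x| <= B.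
Proof.
split; last by move=> [B HB]; exists B; split; [exact: num_real|move=> r Br x _; exact: le_trans (HB x) (ltW Br)].
by move=> [B [_ HB]]; exists (B + 1) => x; apply: HB => //; rewrite ltrDl.
Qed.

Lemma partial_conv_family_bound tau T k : 0 < tau -> conv_defined k ->
  (forall s, 0 < s <= T -> exists2 L, 0 <= L & forall x v, `|Defs.conv (K [::] s) k (x + v) - Defs.conv (K [::] s) k x| <= L * `|v|) ->
  tau <= T ->
  exists B : seq 'I_d -> R, forall w, w != [::] -> 0 <= B w /\ forall t x, tau <= t -> `|Defs.conv (K w t) k x| <= B w.
Proof.
move=> tau0 kd HL tauT; have tau20 : 0 < tau / 2 by rewrite divr_gt0.
have [|L L0 HL'] := HL (tau / 2); first by rewrite tau20/=; lra.
suff /choice[B HB] : forall w, exists B, w != [::] -> 0 <= B /\ forall t x, tau <= t -> `|Defs.conv (K w t) k x| <= B by exists B.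
move=> [|i w]; first by exists 0.
have tt : tau / 2 < tau by lra.
by have [B HB] := conv_bounded w i tau20 tt kd L0 HL'; exists B.
Qed.

Section bootstrap.
Variables (h0 : 'rV[R]_d -> R) (h : R -> 'rV[R]_d -> R) (F : R -> 'rV[R]_d -> R) (M T : R).
Hypothesis h0d : conv_defined h0.
Hypothesis uL : forall s, 0 < s <= T -> exists2 L, 0 <= L &
  forall x v, `|Defs.conv (K [::] s) h0 (x + v) - Defs.conv (K [::] s) h0 x| <= L * `|v|.
Hypothesis M0 : 0 <= M.
Hypothesis mF : measurable_fun setT (fun q : measurableTypeR R * 'rV[R]_d => F q.1 q.2).
Hypothesis FM : forall s x, 0 < s -> `|F s x| <= M * s `^ (- (1 / 2)).
Hypothesis Fh : forall s, 0 < s <= T -> \forall y \ae mu, F s y = dot (gradient (h s) y) (gradient (h s) y).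
Hypothesis hE : forall s, 0 < s <= T -> exists c, forall x,
  h s x = Defs.conv (K [::] s) h0 x - duhamel_partial F [::] s x + c.

Local Notation Dh := (duhamel_partial F).

(** For nonempty words, the candidate for the iterated derivative of [h t]; the constant in [hE]
    disappears after the first derivative. *)
Definition solution_partial gm t x : R := Defs.conv (K gm t) h0 x - Dh gm t x.
Local Notation G := solution_partial.

Definition source_regular al m := forall tau, 0 < tau <= T -> exists2 B, 0 <= B & forall s, tau <= s <= T -> ae_Ck F al B m s.

Lemma source_regular0 : source_regular 0 0.
Proof.
move=> tau /andP[tau0 tauT]; exists (2 * (M * tau `^ (- (1 / 2)))); first by rewrite !mulr_ge0 ?powR_ge0.
move=> s /andP[ts sT]; have s0 : 0 < s by exact: lt_le_trans ts.
have FB y : `|F s y| <= M * tau `^ (- (1 / 2)).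
  apply: le_trans (FM y s0) _; apply: (ler_wpM2l M0); rewrite !powRN lef_pV2 ?posrE ?powR_gt0//.
  by apply: ge0_ler_powR; rewrite ?nnegrE ?(ltW tau0) ?(ltW s0)//; lra.
have MM0 : 0 <= M * tau `^ (- (1 / 2)) by rewrite mulr_ge0 ?powR_ge0.
exists (F s); last exact: nearW.
split => //; split; first exact: measurable_Fs.
  by move=> y; apply: le_trans (FB y) _; rewrite ler_peMl// ler1n.
move=> y v; rewrite powRr0 mulr1 mulr2n mulrDl mul1r.
by apply: le_trans (ler_normB _ _) _; apply: lerD; exact: FB.
Qed.

Lemma duhamel_partials al th m J tau : source_regular al m -> 0 <= al <= 1 -> 0 < th <= 1 -> (0 < J)%N -> J%:R + th - al < 4 ->
  0 < tau <= T -> exists2 C, 0 <= C & forall t, tau <= t <= T ->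
    (forall gm, (size gm + 2 <= m + J)%N -> (forall x, `|Dh gm t x| <= C) /\
       (forall x v, `|Dh gm t (x + v) - Dh gm t x| <= C * `|v| `^ th)) /\
    (forall gm x, (size gm + 3 <= m + J)%N -> differentiable (Dh gm t : _ -> R^o) x /\
       forall i, partial i (Dh gm t) x = Dh (i :: gm) t x).
Proof.
move=> HS al01 th01 J0 Jth /andP[tau0 tauT].
have tau20 : 0 < tau / 2 by rewrite divr_gt0.
have [|B B0 HB] := HS (tau / 2); first by rewrite tau20/=; lra.
have [C C0 HC] := duhamel_partial_regular M0 mF FM al01 th01 J0 Jth tau20 B0 HB.
by exists C => // t tt; apply: HC; rewrite mulrC divfK.
Qed.

Lemma partial_sub f g x : differentiable (f : _ -> R^o) x -> differentiable (g : _ -> R^o) x ->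
  differentiable (fun x => f x - g x : R^o) x /\ forall i, partial i (fun x => f x - g x) x = partial i f x - partial i g x.
Proof.
move=> df dg; split; first exact: (differentiableB df dg).
move=> i; rewrite /partial; have := @deriveB _ _ _ (f : _ -> R^o) (g : _ -> R^o) x (delta_mx 0 i).
by apply; exact: diff_derivable.
Qed.

Lemma solution_partial_diff gm t x : 0 < t ->
  differentiable (Dh gm t : _ -> R^o) x /\ (forall i, partial i (Dh gm t) x = Dh (i :: gm) t x) ->
  differentiable (G gm t : _ -> R^o) x /\ forall i, partial i (G gm t) x = G (i :: gm) t x.
Proof.
move=> t0 [dD pD]; have [dc pc] := conv_diff gm x t0 h0d.
by have [h1 h2] := partial_sub dc dD; split; [exact: h1|move=> i; rewrite h2 pD pc].
Qed.

Lemma partial_h t x : 0 < t <= T ->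
  differentiable (Dh [::] t : _ -> R^o) x /\ (forall i, partial i (Dh [::] t) x = Dh [:: i] t x) ->
  differentiable (h t : _ -> R^o) x /\ forall i, partial i (h t) x = G [:: i] t x.
Proof.
move=> tT HD; have /andP[t0 _] := tT; have [c hc] := hE tT.
have [dG pG] := solution_partial_diff t0 HD.
have hE' : h t = fun x => G [::] t x - (fun=> - c) x by apply/funext => y; rewrite hc opprK.
have [h1 h2] := partial_sub dG (differentiable_cst (- c : R^o) x).
by rewrite hE'; split; [exact: h1|move=> i; rewrite h2 /partial derive_cst subr0 -pG].
Qed.

(** Words of length up to m + J - 2 are controlled for the Duhamel term, because the Laplacian takes
    two letters; the gradient takes one more, and the class [Ck] is stable under the square. *)
Lemma source_regular_step al th m J : source_regular al m -> 0 <= al <= 1 -> 0 < th <= 1 -> (3 <= J)%N -> J%:R + th - al < 4 ->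
  source_regular th (m + J - 3).
Proof.
move=> HS al01 th01 J3 Jth tau tT; have /andP[tau0 tauT] := tT.
have J0 : (0 < J)%N by exact: leq_trans J3.
have th01' : 0 <= th <= 1 by have /andP[/ltW -> ->] := th01.
have /andP[_ th0] := th01'.
have [C C0 HC] := duhamel_partials HS al01 th01 J0 Jth tT.
have [Bu HBu] := partial_conv_family_bound tau0 h0d uL tauT.
pose N := (m + J - 2)%N.
(* One letter beyond N: the Hoelder bound for the linear part interpolates between a word and its
   next derivative. *)
have [Cu [Cu0 HCu]] := bounded_words Bu N.+1.
pose B := (d%:R + 2) * Cu + C.
have d2 : 0 <= d%:R + 2 :> R by rewrite addr_ge0.
have B0 : 0 <= B by rewrite addr_ge0 ?mulr_ge0.
have CuB : Cu <= (d%:R + 2) * Cu by rewrite ler_peMl//; apply: ler_wpDl => //; rewrite ler1n.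
have [B' HB'] := @Ck_sqr_sum R d th B (m + J - 3).
have HCk s i : tau <= s <= T -> Ck th B (m + J - 3) (G [:: i] s).
  move=> ss; have [HC1 HC2] := HC s ss; have /andP[ts sT] := ss.
  have s0 : 0 < s by exact: lt_le_trans ts.
  apply: (@Ck_family _ _ (fun gm => G gm s) th B N) => //; last by rewrite /N /=; clear -J3; lia.
  - move=> gm /andP[g0 gN].
    have gN2 : (size gm + 2 <= m + J)%N by clear -gN J3; rewrite /N in gN; lia.
    have [D1 D2] := HC1 gm gN2.
    have gne : gm != [::] by case: gm g0 {gN gN2 D1 D2}.
    have ub y : `|Defs.conv (K gm s) h0 y| <= Cu.
      by apply: le_trans ((HBu gm gne).2 s y ts) _; apply: HCu; exact: leqW.
    have dc y := conv_diff gm y s0 h0d.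
    split.
    + apply: measurable_funB; first by apply: measurable_conv; exact: conv_defined_measurable.
      exact: measurable_duhamel_partial.
    + move=> x; apply: le_trans (ler_normB _ _) _; apply: lerD; last exact: D1.
      exact: le_trans (ub x) CuB.
    + move=> x v; rewrite /G mulrDl.
      have aux (a b c e : R) : a - b - (c - e) = (a - c) - (b - e) by ring.
      rewrite aux.
      apply: le_trans (ler_normB _ _) _; apply: lerD; last exact: D2.
      rewrite -[`|v|]divr1; apply: interp_holder => //; first by move=> y; exact: (dc y).1.
      move=> y i'; rewrite (dc y).2 divr1.
      have ine : i' :: gm != [::] by [].
      by apply: le_trans ((HBu _ ine).2 s y ts) _; apply: HCu; rewrite /= ltnS.
  - move=> gm x /andP[g0 gN].
    have gN3 : (size gm + 3 <= m + J)%N by clear -gN J3; rewrite /N in gN; lia.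
    exact: solution_partial_diff s0 (HC2 gm x gN3).
exists B'.
  have /andP[_ TT] : tau <= T <= T by rewrite tauT lexx.
  by apply: Ck_bound_ge0 (HB' _ (fun i => HCk T i _)); rewrite tauT lexx.
move=> s ss; have /andP[ts sT] := ss.
have s0 : 0 < s <= T by rewrite sT andbT; exact: lt_le_trans ts.
exists (fun x => \sum_i G [:: i] s x * G [:: i] s x); first by apply: HB' => i; exact: HCk.
apply: filterS (Fh s0) => y ->; rewrite /dot; apply: eq_bigr => i _; rewrite !mxE.
have J3' : (size ([::] : seq 'I_d) + 3 <= m + J)%N by rewrite /=; clear -J3; lia.
by rewrite (partial_h s0 ((HC s ss).2 [::] y J3')).2.
Qed.

(** The two rounds satisfy 3 + 1/2 - 0 < 4 and 4 + 1/4 - 1/2 < 4; the second gains a derivative, and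
    the exponent 1/4 is then given up. *)
Lemma source_regular_all m : source_regular 0 m.
Proof.
elim: m => [|m IH]; first exact: source_regular0.
have S1 : source_regular (1 / 2) m.
  rewrite -[m](addnK 3); apply: (source_regular_step IH) => //; lra.
have S2 : source_regular (1 / 4) m.+1.
  rewrite (_ : m.+1 = m + 4 - 3)%N; last by clear; lia.
  by apply: (source_regular_step S1) => //; lra.
move=> tau tT; have [B B0 HB] := S2 tau tT; exists (2 * B); first exact: mulr_ge0.
by move=> s ss; have [f Cf fE] := HB s ss; exists f => //; apply: Ck_lower Cf; lra.
Qed.

(** At order zero only the Duhamel term is bounded here; the linear evolution may be unbounded and
    is left to the final statement. *)
Lemma solution_smooth t : 0 < t <= T -> [/\ smooth (h t),
  forall w, w != [::] -> exists B, forall x, `|iter_partial w (h t) x| <= B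
  & exists B, forall x, `|Dh [::] t x| <= B].
Proof.
move=> tT; have /andP[t0 tT'] := tT.
have al01 : (0 <= 0 :> R) && (0 <= 1 :> R) by rewrite lexx ler01.
have th01 : (0 < 1 / 2 :> R) && (1 / 2 <= 1 :> R) by apply/andP; split; lra.
have e4 : (3%:R : R) + 1 / 2 - 0 < 4 by lra.
have tt : t <= t <= T by rewrite lexx.
have HD gm : exists B, (forall x, `|Dh gm t x| <= B) /\
    forall x, differentiable (Dh gm t : _ -> R^o) x /\ (forall i, partial i (Dh gm t) x = Dh (i :: gm) t x).
  have [C C0 HC] := duhamel_partials (source_regular_all (size gm)) al01 th01 (ltn0Sn 2) e4 tT.
  have [h1 h2] := HC t tt.
  exists C; split; last by move=> x; exact: h2.
  by have [] := h1 gm _; first by rewrite leq_add2l.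
have [B0 [HB0 H0]] := HD [::].
have HG w : w != [::] -> iter_partial w (h t) = G w t.
  elim: w => [//|i w IH] _; rewrite /iter_partial/= -/(iter_partial w _); apply/funext => x.
  case: w IH => [_|j w IH]; first exact: (partial_h tT (H0 x)).2.
  by rewrite IH//; have [B [_ H]] := HD (j :: w); exact: (solution_partial_diff t0 (H x)).2.
split; last by exists B0.
- move=> [|i w] x; first exact: (partial_h tT (H0 x)).1.
  rewrite HG//; have [B [_ H]] := HD (i :: w); exact: (solution_partial_diff t0 (H x)).1.
- have [Bu HBu] := partial_conv_family_bound t0 h0d uL tT'.
  move=> w w0; have [B [HB _]] := HD w; exists (Bu w + B) => x; rewrite HG//.
  by apply: le_trans (ler_normB _ _) _; apply: lerD => //; exact: (HBu w w0).2.
Qed.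

End bootstrap.

(** * The source of a given solution *)

Lemma gradient_bound (Rad : \bar R) (h : R -> 'rV[R]_d -> R) : inX Rad h ->
  exists2 N, 0 <= N & forall s, pos_times Rad s -> \forall y \ae mu, enorm (gradient (h s) y) <= N * s `^ (- (1 / 4)).
Proof.
move=> [_ _ hX].
have [N N0 HN] : exists2 N : R, 0 <= N & (normX Rad h <= N%:E)%E.
  case: (normX Rad h) hX => [r _|//|_]; last by exists 0 => //; exact: leNye.
  by exists `|r| => //; rewrite lee_fin ler_norm.
exists N => // s sp; have [s0 _] := sp.
have a0 : 0 < s `^ (1 / 4) by rewrite powR_gt0.
have H1 : ((s `^ (1 / 4))%:E * Lnorm mu +oo (fun x => (enorm (gradient (h s) x))%:E) <= N%:E)%E.
  by apply: le_trans HN; apply: ereal_sup_ubound; exists s.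
have H2 : (Lnorm mu +oo (fun x => (enorm (gradient (h s) x))%:E) <= (N * s `^ (- (1 / 4)))%:E)%E.
  move: H1; rewrite muleC -lee_pdivlMr// => H1.
  by apply: le_trans H1 _; rewrite powRN -EFinM.
move: H2; rewrite unlock /Lnorm measure_rV_setT_gt0 => /ess_supP.
apply: filterS => y /=; rewrite lee_fin; apply: le_trans; exact: ler_norm.
Qed.

Lemma measurable_pos_times (Rad : \bar R) : measurable (pos_times Rad : set (measurableTypeR R)).
Proof.
rewrite /pos_times; case: (horizon Rad) => [r| |].
- rewrite (_ : [set _ | _] = [set` `]0, r]]); first exact: measurable_itv.
  by apply/seteqP; split => t /=; rewrite in_itv/= lee_fin => /andP.
- rewrite (_ : [set _ | _] = [set` `]0, +oo[]); first exact: measurable_itv.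
  by apply/seteqP; split => t /=; rewrite in_itv/= andbT leey; [move=> []|].
- rewrite (_ : [set _ | _] = set0)//.
  by apply/seteqP; split => t //= [].
Qed.

Section truncation.
Variables (Rad : \bar R) (h : R -> 'rV[R]_d -> R) (N T : R).
Hypothesis hX : inX Rad h.
Hypothesis HN : forall s, pos_times Rad s -> \forall y \ae mu, enorm (gradient (h s) y) <= N * s `^ (- (1 / 4)).
Hypothesis HT : forall s, 0 < s <= T -> pos_times Rad s.

Let D : set (measurableTypeR R * 'rV[R]_d) := [set` `]0, T]] `*` setT.

Definition gradient_sqr s y : R := dot (gradient (h s) y) (gradient (h s) y).

(* The source term, modified on a null set so as to obey its bound everywhere. *)
Definition source s y : R :=
  ((fun q : measurableTypeR R * 'rV[R]_d => Num.min (gradient_sqr q.1 q.2) (N ^+ 2 * q.1 `^ (- (1 / 2)))) \_ D) (s, y).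

Lemma sourceE s y : 0 < s <= T -> source s y = Num.min (gradient_sqr s y) (N ^+ 2 * s `^ (- (1 / 2))).
Proof.
move=> sT; by rewrite /source patchE mem_set//; split => //=; rewrite in_itv.
Qed.

Lemma measurable_gradient_sqr : measurable_fun D (fun q => gradient_sqr q.1 q.2).
Proof.
have [_ mh _] := hX.
rewrite /gradient_sqr /dot; apply: measurable_sum => i.
under eq_fun do rewrite !mxE.
have mi : measurable_fun D (fun q : measurableTypeR R * 'rV[R]_d => partial i (h q.1) q.2).
  apply: measurable_funS (mh i); first by apply: measurableX => //; exact: measurable_pos_times.
  by move=> [s y] [/= sT _]; split => //; apply: HT; move: sT; rewrite in_itv.
exact: measurable_funM.
Qed.

Lemma measurable_gradient_sqr1 s : 0 < s <= T -> measurable_fun setT (gradient_sqr s).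
Proof.
move=> sT; have mD : measurable D by apply: measurableX => //; exact: measurable_itv.
have /(measurable_restrictT _ mD) mg := measurable_gradient_sqr.
rewrite (_ : gradient_sqr s = fun y => ((fun q => gradient_sqr q.1 q.2) \_ D) (s, y)).
  exact: (measurableT_comp mg (measurable_pair1 s)).
by apply/funext => y; rewrite patchE mem_set//; split => //=; rewrite in_itv.
Qed.

Lemma measurable_source : measurable_fun setT (fun q : measurableTypeR R * 'rV[R]_d => source q.1 q.2).
Proof.
have mD : measurable D by apply: measurableX => //; exact: measurable_itv.
rewrite /source (_ : (fun q => _) = (fun q : measurableTypeR R * 'rV[R]_d => Num.min (gradient_sqr q.1 q.2) (N ^+ 2 * q.1 `^ (- (1 / 2)))) \_ D); last first.
  by apply/funext => -[].
apply/(measurable_restrictT _ mD); apply: measurable_minr; first exact: measurable_gradient_sqr.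
apply: measurable_funTS; apply: measurable_funM => //.
exact: (measurableT_comp (measurable_powR _) measurable_fst).
Qed.

Lemma source_bound s y : 0 < s -> `|source s y| <= N ^+ 2 * s `^ (- (1 / 2)).
Proof.
move=> s0; have B0 : 0 <= N ^+ 2 * s `^ (- (1 / 2)) by rewrite mulr_ge0 ?powR_ge0 ?sqr_ge0.
have [sT|sT] := lerP s T.
  by rewrite sourceE ?s0// ger0_norm ?le_min ?dot_ge0// ge_min lexx orbT.
rewrite /source patchE memNset ?normr0// => -[/=].
by rewrite in_itv/= leNgt sT andbF.
Qed.

Lemma source_ae s : 0 < s <= T -> \forall y \ae mu, source s y = gradient_sqr s y.
Proof.
move=> sT; apply: filterS (HN (HT sT)) => y Hy; rewrite sourceE//; apply: min_idPl.
rewrite /gradient_sqr -sqr_enorm.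
have -> : N ^+ 2 * s `^ (- (1 / 2)) = (N * s `^ (- (1 / 4))) ^+ 2.
  rewrite exprMn; congr (_ * _); rewrite -powR_mulrn ?powR_ge0// -powRrM; congr (_ `^ _); by field.
rewrite !expr2; apply: ler_pM => //; exact: enorm_ge0.
Qed.

End truncation.

(** Convolution ignores the null set on which the source was modified, and the two derivatives of
    the Laplacian move onto the kernel. *)
Lemma duhamelE (F : R -> 'rV[R]_d -> R) (h : R -> 'rV[R]_d -> R) (M T : R) : 0 <= M ->
  measurable_fun setT (fun q : measurableTypeR R * 'rV[R]_d => F q.1 q.2) ->
  (forall s x, 0 < s -> `|F s x| <= M * s `^ (- (1 / 2))) ->
  (forall s, 0 < s <= T -> measurable_fun setT (gradient_sqr h s)) ->
  (forall s, 0 < s <= T -> \forall y \ae mu, F s y = gradient_sqr h s y) ->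
  forall t x, t <= T -> duhamel h h t x = duhamel_partial F [::] t x.
Proof.
move=> M0 mF FM mg Fg t x tT; apply: eq_Rintegral => s; rewrite inE/= in_itv/= => /andP[s0 st].
have ts0 : 0 < t - s by rewrite subr_gt0.
have sT : 0 < s <= T by rewrite s0 (le_trans (ltW st)).
rewrite /semigroup gt_eqF// kernel_GE.
rewrite (_ : Defs.conv (K [::] (t - s)) _ = Defs.conv (K [::] (t - s)) (F s)); last first.
  apply/esym; apply: conv_ae (Fg s sT); [exact: (rap_K _ ts0).1|exact: measurable_Fs|exact: mg].
rewrite /laplacian /duhamel_integrand; apply: eq_bigr => i _.
by rewrite !(partial_conv _ _ ts0 (Fs_defined M0 mF FM s0)).
Qed.

End regularity.

(* The order-zero bound is stated relatively to the linear evolution: the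
   spaces only control gradients, and the bound fails without that condition
   (h t x = x 0 i is a solution for finite Rad). *)
Theorem theorem6p1 (R : realType) (d : nat) (hd : (1 <= d <= 3)%N)
    (Rad : \bar R) (hRad : (0 < Rad)%E)
    (h0 : 'rV[R]_d -> R) (hh0 : inB Rad h0)
    (h : R -> 'rV[R]_d -> R) (hh : solution Rad h h0)
    (t : R) (ht0 : 0 < t) (htR : (t%:E < horizon Rad)%E) :
  [/\ smooth (h t),
      forall s : seq 'I_d, s != [::] ->
        bounded_fun (iter_partial s (h t) : 'rV[R]_d -> R^o)
    & bounded_fun (semigroup t h0 : 'rV[R]_d -> R^o) -> Cb_infty (h t)].
Proof.
have [h0d [u_lip _ _]] := hh0; have [hX hE] := hh.
(* The window ]0, t] lies in the admissible times whether the horizon is finite or not, so T is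
   taken to be t. *)
have HT s : 0 < s <= t -> pos_times Rad s.
  move=> /andP[s0 st]; split => //; apply: le_trans (ltW htR); by rewrite lee_fin.
have [N N0 HN] := gradient_bound hX.
pose F := source h N t.
have mF := measurable_source N hX HT : measurable_fun setT (fun q : measurableTypeR R * 'rV[R]_d => F q.1 q.2).
have FM := source_bound h N t.
have Fg := source_ae HN HT.
have semE s : 0 < s -> semigroup s h0 = Defs.conv (K [::] s) h0.
  by move=> s0; rewrite /semigroup (gt_eqF s0) kernel_GE.
have uL s : 0 < s <= t -> exists2 L, 0 <= L &
    forall x v, `|Defs.conv (K [::] s) h0 (x + v) - Defs.conv (K [::] s) h0 x| <= L * `|v|.
  move=> st; have /andP[s0 _] := st; rewrite -semE//; exact: lipschitz_bound (u_lip s (HT s st)).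
have mg := measurable_gradient_sqr1 hX HT.
have hE' s : 0 < s <= t -> exists c, forall x,
    h s x = Defs.conv (K [::] s) h0 x - duhamel_partial F [::] s x + c.
  move=> st; have /andP[s0 st'] := st.
  have [c Hc] : exists c, forall x, h s x = semigroup s h0 x - duhamel h h s x + c.
    by apply: hE; have [_ ?] := HT s st; split => //; exact: ltW.
  exists c => x; rewrite Hc semE//.
  by rewrite (duhamelE (sqr_ge0 N) mF FM mg Fg _ st').
have tt : 0 < t <= t by rewrite ht0 lexx.
have [sm bd [B HB]] := solution_smooth h0d uL (sqr_ge0 N) mF FM Fg hE' tt.
have bd' s : s != [::] -> bounded_fun (iter_partial s (h t) : 'rV[R]_d -> R^o).
  by move=> /bd ?; apply/bounded_funP.
(* The empty word is the only one that sees the linear evolution and the additive constant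
   themselves. *)
split => // /bounded_funP[C HC]; split => // -[|i s]; last exact: bd'.
apply/bounded_funP; have [c Hc] := hE' t tt.
exists (C + B + `|c|) => x; rewrite /= Hc -semE//.
apply: le_trans (ler_normD _ _) _; apply: lerD => //.
by apply: le_trans (ler_normB _ _) _; apply: lerD.
Qed.
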